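(* Let $K$ and $K'$ be regular Cantor sets with $HD(K)+HD(K')<1$, satisfying property $(H\alpha)$ for some $\alpha>0$. Call a $C^1$ map $h$ from a neighbourhood of $K\times K'$ to $\mathbb{R}$ admissible if, at some point of $K\times K'$, its gradient is not parallel to either of the two coordinate axes (i.e. both partial derivatives are nonzero there). Here $HD$ denotes Hausdorff dimension. Then: (i) If $K$ and $K'$ have periodic orbits (one of $K$ and one of $K'$) whose ratio of logarithms of the norms of their eigenvalues is irrational, then $HD(h(K\times K'))=HD(K)+HD(K')$ for every admissible $h$. Consequently, if $K$ has two periodic orbits whose ratio of logarithms of the norms of their eigenvalues is irrational, then $HD(h(K\times K'))=HD(K)+HD(K')$ for every admissible $h$. (ii) If $K$ has a sequence of periodic points $(x_n)$ with corresponding eigenvalues $(\mu_n)$ and $K'$ has a periodic point $y$ with eigenvalue $\lambda$ such that $(\log|\mu_n|/\log|\lambda|)$ is a sequence of rational numbers whose denominators tend to $+\infty$, then $HD(h(K\times K'))=HD(K)+HD(K')$ for every admissible $h$. Consequently, if $K$ has a sequence of periodic points $(x_n)$ with corresponding eigenvalues $(\mu_n)$ such that $(\log|\mu_n|/\log|\mu_1|)$ is a sequence of rational numbers whose denominators tend to $+\infty$, then $HD(h(K\times K'))=HD(K)+HD(K')$ for every admissible $h$.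
   Context: Regular Cantor sets. Let $\mathbf{A}$ be a finite alphabet and $\Sigma\subset\mathbf{A}^{\mathbb{Z}}$ a subshift of finite type defined by a transition set $\mathcal{B}\subset\mathbf{A}^2$; $\Sigma$ is always assumed to be mixing and to use all letters of $\mathbf{A}$. A word of $\Sigma$ is a finite sequence of letters respecting the transitions. For $a\in\mathbf{A}$ put $I(a)=[0,1]\times\{a\}$ (the $I(a)$ may be identified affinely with disjoint compact intervals of the line). Let $r\in(1,+\infty]$. A $C^r$ map $g$ is expanding of type $\Sigma$ if its domain is a finite disjoint union $\bigsqcup_{(a_0,a_1)\in\mathcal{B}}I(a_0,a_1)$, each $I(a_0,a_1)$ being a compact subinterval of $I(a_0)$, and if each restriction $g|_{I(a_0,a_1)}$ is a $C^r$-diffeomorphism onto $I(a_1)$ with $|Dg|>1$. It defines the regular Cantor set $K=\bigcap_{n\ge0}g^{-n}(\bigsqcup_{\mathcal{B}}I(a_0,a_1))$. A regular Cantor set is one obtained this way for some $r>1$; $K'$ is obtained from an expanding map $g'$ with its own alphabet and subshift. A periodic orbit (point) of $K$ means one of $g|_K$; the eigenvalue of a periodic point $x$ of period $n$ is $Dg^n(x)$; similarly for $K'$ and $g'$. Denominators of rational numbers are taken in lowest terms. Limit geometries. For $(a_0,a_1)\in\mathcal{B}$ let $f_{a_0a_1}=(g|_{I(a_0,a_1)})^{-1}$; for a word $\underline a=(a_0,\dots,a_n)$ let $f_{\underline a}=f_{a_0a_1}\circ\cdots\circ f_{a_{n-1}a_n}$, a diffeomorphism from $I(a_n)$ onto a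 subinterval $I(\underline a)$ of $I(a_0)$. Let $\Sigma^-$ be the set of one-sided admissible sequences $\underline\theta=(\theta_m)_{m\le0}$. For $n\ge1$ put $\underline\theta^n=(\theta_{-n},\dots,\theta_0)$ and $k_n^{\underline\theta}=B\circ f_{\underline\theta^n}$, where $B$ is the affine map from $I(\underline\theta^n)$ onto $I(\theta_0)$ making $k_n^{\underline\theta}$ orientation preserving. As $n\to\infty$, $k_n^{\underline\theta}$ converges (in $C^{r'}$ for all $r'<r$) to a diffeomorphism $k^{\underline\theta}$ of $I(\theta_0)$. For a word $\underline b$ beginning with $\theta_0$, put $I^{\underline\theta}(\underline b)=k^{\underline\theta}(I(\underline b))$. $|J|$ denotes the length of an interval $J$. Property $(H\alpha)$. A constant $c_0>1$, large enough, is fixed once and for all. For $0<\rho<1$ let $\Sigma(\rho)$ be the set of words $\underline a$ of $\Sigma$ with $c_0^{-1}\rho\le|I(\underline a)|\le c_0\rho$. Let $d=HD(K)$ and $\alpha\in(0,1]$. $K$ satisfies $(H\alpha)$ if there exist $\eta>0$ and $\rho_1\in(0,1)$ such that, for every $0<\rho<\rho_1$, every $1\le\xi\le\rho^{-\alpha}$ and every subset $X\subset\Sigma(\rho)$ with $\#(\Sigma(\rho)\setminus X)<\eta\rho^{-d}$, one can find $\underline a^0,\underline a^1\in X$ (with the same last letter) such that for every $\Phi\in\mathbb{R}$ and every $\underline\theta^0,\underline\theta^1\in\Sigma^-$ ending respectively by $\underline a^0,\underline a^1$, $$\#\Big\{\underline b\in\Sigma(\rho):\ \Big|\sin\Big[\tfrac12\,\xi\,\log\frac{|I^{\underline\theta^0}(\underline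 b)|}{|I^{\underline\theta^1}(\underline b)|}+\Phi\Big]\Big|\ge\eta\Big\}\ \ge\ \eta\,\rho^{-d},$$ where only words $\underline b$ beginning with the common last letter of $\underline\theta^0,\underline\theta^1$ are considered. The property for $K'$ is defined in the same way with $g',\Sigma',d'=HD(K')$ in place of $g,\Sigma,d$. *)

(* Defs.v *)
From HB Require Import structures.
From mathcomp Require Import all_boot all_order all_algebra.
From mathcomp Require Import all_classical all_reals all_analysis.

Set Implicit Arguments.
Unset Strict Implicit.
Unset Printing Implicit Defensive.

Import Order.TTheory GRing.Theory Num.Theory.
Import numFieldNormedType.Exports.

Local Open Scope classical_set_scope.
Local Open Scope ring_scope.

Section Hausdorff.
Context {R : realType}.
Implicit Types (U S : set R) (s delta : R).

(* [-oo] on the empty set. *)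
Definition diam U : \bar R :=
  ereal_sup [set `|x - y|%:E | x in U & y in U].

(* The empty set has weight 0 also for [s = 0]. *)
Definition hausdorff_weight s U : \bar R :=
  if U == set0 then 0%E else poweR (diam U) s.

Definition hausdorff_content s delta S : \bar R :=
  ereal_inf [set (\sum_(0 <= i <oo) hausdorff_weight s (U i))%E |
    U in [set U : nat -> set R |
           S `<=` \bigcup_i U i /\ (forall i, (diam (U i) <= delta%:E)%E)]].

Definition hausdorff_measure s S : \bar R :=
  ereal_sup [set hausdorff_content s delta S | delta in [set delta | 0 < delta]].

(* The set on the right contains every [s > 1] and is bounded below by 0, so
   the real infimum is the genuine one. *)
Definition HD S : R := inf [set s | 0 <= s /\ hausdorff_measure s S = 0%E].

End Hausdorff.

Section Smoothness.
Context {R : realType}.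
Implicit Types (S T : set R) (f : R -> R).

(* Derivatives relative to [S]: at an endpoint of an interval this is the
   one-sided derivative, and values of [f] outside [S] are never used. *)
Definition slope_in S f (x : R) : set_system R :=
  (f y - f x) / (y - x) @[y --> within S x^'].

Definition derivable_in S f (x : R) : Prop := cvg (slope_in S f x).

Definition derive_in S f (x : R) : R := lim (slope_in S f x).

Definition derive_in_n S (k : nat) f : R -> R := iter k (derive_in S) f.

Definition Ck_in S (k : nat) f : Prop :=
  (forall i, (i < k)%N ->
    forall x, S x -> derivable_in S (derive_in_n S i f) x) /\
  {within S, continuous (derive_in_n S k f)}.

Definition holder_in S (beta : R) f : Prop :=
  exists C : R, forall x y, S x -> S y -> `|f x - f y| <= C * `|x - y| `^ beta.

(* For finite [r = k + beta] with [k] the integer part: C^k with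
   beta-Hoelder k-th derivative.  For [beta = 0] the Hoelder condition only says
   that the k-th derivative has bounded oscillation, which is automatic on a
   compact [S]; so integer [r] gives the usual C^k. *)
Definition Cr_in S (r : \bar R) f : Prop :=
  match r with
  | r%:E => Ck_in S (Num.truncn r) f /\
            holder_in S (r - (Num.truncn r)%:R) (derive_in_n S (Num.truncn r) f)
  | +oo%E => forall k, Ck_in S k f
  | -oo%E => False
  end.

Definition Cr_diffeo (r : \bar R) S T f : Prop :=
  [/\ set_bij S T f, Cr_in S r f & Cr_in T r ('pinv_(fun=> 0) S f)].

End Smoothness.

Definition biinfinite (A : finType) (B : rel A) : set (int -> A) :=
  [set x | forall i : int, B (x i) (x (i + 1))].

(* Topological mixing of the shift, tested on the basis of central cylinders:
   [sigma^n] moves a point of the cylinder of [x] into that of [y]. *)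
Definition mixing (A : finType) (B : rel A) : Prop :=
  forall x y, biinfinite B x -> biinfinite B y -> forall m : nat,
  exists N : nat, forall n : nat, (N <= n)%N ->
  exists z, [/\ biinfinite B z,
    (forall i : int, `|i| <= m%:Z -> z i = x i) &
    (forall i : int, `|i| <= m%:Z -> z (i + n%:Z) = y i)].

Record subshift := Subshift {
  letter :> finType;
  trans : rel letter;
  trans_mixing : mixing trans;
  trans_letters : forall a : letter, exists2 x, biinfinite trans x & exists i, x i = a
}.

Arguments trans {s} _ _.

(* The unit interval I(a) = [0, 1] x {a} is laid isometrically on the line as
   [pos a, pos a + 1]; I(a, b) is [lo a b, hi a b].  The function [branch_map]
   is total but only its values on the union of the I(a, b), (a, b) in the
   transition set, are meaningful. *)
Record expanding_map (R : realType) (Sigma : subshift) (r : \bar R) :=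
  ExpandingMap {
  pos : Sigma -> R;
  lo : Sigma -> Sigma -> R;
  hi : Sigma -> Sigma -> R;
  branch_map :> R -> R;
  pos_disjoint : trivIset [set: Sigma] (fun a => `[pos a, pos a + 1]%classic);
  branch_sub : forall a b, trans a b ->
    `[lo a b, hi a b]%classic `<=` `[pos a, pos a + 1]%classic;
  branch_disjoint : trivIset [set e : Sigma * Sigma | trans e.1 e.2]
    (fun e => `[lo e.1 e.2, hi e.1 e.2]%classic);
  branch_diffeo : forall a b, trans a b ->
    Cr_diffeo r `[lo a b, hi a b]%classic `[pos b, pos b + 1]%classic branch_map;
  branch_expanding : forall a b, trans a b ->
    forall x, `[lo a b, hi a b]%classic x ->
      1 < `|derive_in `[lo a b, hi a b]%classic branch_map x|
}.

Section CantorSet.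
Context {R : realType} {Sigma : subshift} {r : \bar R}.
Variable g : expanding_map Sigma r.

Definition itvI (a : Sigma) : set R := `[pos g a, pos g a + 1]%classic.

Definition itvI2 (a b : Sigma) : set R := `[lo g a b, hi g a b]%classic.

Definition dom_map : set R :=
  \bigcup_(e in [set e : Sigma * Sigma | trans e.1 e.2]) itvI2 e.1 e.2.

Definition cantor_set : set R := \bigcap_n (iter n g @^-1` dom_map).

Definition dom_iter (n : nat) : set R :=
  [set x | forall i, (i < n)%N -> dom_map (iter i g x)].

(* [mu] is the eigenvalue D(g^n)(x) of the periodic point [x] of K, where
   [n] is the least period of [x]. *)
Definition periodic_eigenvalue (x mu : R) : Prop :=
  cantor_set x /\ exists n : nat,
    [/\ (0 < n)%N, iter n g x = x,
        (forall m, (0 < m < n)%N -> iter m g x <> x) &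
        mu = derive_in (dom_iter n) (iter n g) x].

Definition word (w : seq Sigma) : bool := (w != [::]) && sorted trans w.

Definition inv_branch (a b : Sigma) : R -> R := 'pinv_(fun=> 0) (itvI2 a b) g.

Fixpoint inv_word (w : seq Sigma) : R -> R :=
  match w with
  | a :: ((b :: _) as w') => inv_branch a b \o inv_word w'
  | _ => id
  end.

Definition itv_word (w : seq Sigma) : set R :=
  match w with
  | [::] => set0
  | a :: s => inv_word w @` itvI (last a s)
  end.

(* Used for compact intervals only. *)
Definition len (J : set R) : R := sup J - inf J.

(* [th m] is the letter theta_(-m). *)
Definition left_infinite : set (nat -> Sigma) :=
  [set th | forall m, trans (th m.+1) (th m)].

(* The word (theta_(-n), ..., theta_0). *)
Definition left_word (th : nat -> Sigma) (n : nat) : seq Sigma :=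
  rev (mkseq th n.+1).

Definition ends_by (th : nat -> Sigma) (w : seq Sigma) : Prop :=
  rev (mkseq th (size w)) = w.

(* k_n = B \o f with f = f_(theta^n): [B] is the affine map sending f(p) to p
   and f(p + 1) to p + 1, where I(theta_0) = [p, p + 1]. *)
Definition k_approx (th : nat -> Sigma) (n : nat) (x : R) : R :=
  let f := inv_word (left_word th n) in
  let p := pos g (th 0%N) in
  p + (f x - f p) / (f (p + 1) - f p).

Definition k_limit (th : nat -> Sigma) (x : R) : R :=
  lim (k_approx th n x @[n --> \oo]).

Definition limit_itv (th : nat -> Sigma) (b : seq Sigma) : set R :=
  k_limit th @` itv_word b.

Definition words_of_size (c0 rho : R) : set (seq Sigma) :=
  [set w | word w /\ c0^-1 * rho <= len (itv_word w) <= c0 * rho].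

Definition oscillating_words (c0 rho xi eta Phi : R) (c : Sigma)
    (th0 th1 : nat -> Sigma) : set (seq Sigma) :=
  [set b | [/\ words_of_size c0 rho b, ohead b = Some c &
     eta <= `|sin (2^-1 * xi *
               ln (len (limit_itv th0 b) / len (limit_itv th1 b)) + Phi)|]].

(* The words a^0, a^1 are [rcons s0 c] and [rcons s1 c], [c] being their
   common last letter. *)
Definition H_alpha (c0 alpha : R) : Prop :=
  let d := HD cantor_set in
  exists eta rho1 : R, [/\ 0 < eta, 0 < rho1 < 1 &
  forall rho xi : R, 0 < rho < rho1 -> 1 <= xi <= rho `^ (- alpha) ->
  forall X : set (seq Sigma), X `<=` words_of_size c0 rho ->
    (counting (words_of_size c0 rho `\` X) < (eta * rho `^ (- d))%:E)%E ->
  exists (s0 s1 : seq Sigma) (c : Sigma), [/\ X (rcons s0 c), X (rcons s1 c) &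
  forall (Phi : R) (th0 th1 : nat -> Sigma),
    left_infinite th0 -> left_infinite th1 ->
    ends_by th0 (rcons s0 c) -> ends_by th1 (rcons s1 c) ->
    ((eta * rho `^ (- d))%:E <=
     counting (oscillating_words c0 rho xi eta Phi c th0 th1))%E]].

End CantorSet.

Section Admissible.
Context {R : realType}.
Implicit Types (S : set (R * R)) (h : R * R -> R).

Definition C1_near S h : Prop :=
  exists U : set (R * R), [/\ open U, S `<=` U &
    forall z, U z -> [/\ differentiable h z,
      {for z, continuous ('D_(1, 0) h : R * R -> R)} &
      {for z, continuous ('D_(0, 1) h : R * R -> R)}]].

(* Only the values of [h] near [S] matter. *)
Definition admissible S h : Prop :=
  C1_near S h /\ exists2 z, S z & 'D_(1, 0) h z != 0 /\ 'D_(0, 1) h z != 0.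

Definition rational_denominators_to_infty (u : nat -> R) : Prop :=
  exists q : nat -> rat, (forall n, u n = ratr (q n)) /\
    ((denq (q n))%:~R : R) @[n --> \oo] --> +oo.

End Admissible.

(* Main.v *)
(* Near a point where both partial derivatives of [h] are nonzero, [h] maps a
   product of two small cylinders of [K] and [K'] almost affinely, as a projection
   [x + t y] whose parameter [t] is the ratio of the partial derivatives times the
   ratio of the slopes of the two inverse branches.  Fix a scale [rho] and consider
   the tree of pairs of nested cylinders, of size [rho ^ k] at level [k].  Since
   [HD K + HD K' < 1], averaging over a finite grid of parameters shows that for
   some [t] half of the branches of length [n] meet few vertices where the
   projections of many siblings collide, so that a small set meets the projections
   of few of these branches.  Periodic orbits with logarithms of eigenvalues [A] and
   [B] such that [m A - k B] takes arbitrarily small positive values allow one to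
   insert periodic words so as to bring the slope ratio back to this [t], at a cost
   bounded independently of [n].  Iterating yields a tree in [h(K x K')] of dimension
   close to [HD K + HD K']; box counting gives the upper bound.  If no such pair of
   orbits existed at some precision, the ratios [A / B] would all be rational with
   bounded denominators, which each of the arithmetic hypotheses excludes. *)

Require Import Defs.
From mathcomp Require Import all_boot all_order all_algebra.
From mathcomp Require Import all_classical all_reals all_analysis.
From mathcomp Require Import zify ring lra.

Set Implicit Arguments.
Unset Strict Implicit.
Unset Printing Implicit Defensive.

Import Order.TTheory GRing.Theory Num.Theory.
Import numFieldNormedType.Exports.

Local Open Scope classical_set_scope.
Local Open Scope ring_scope.

(** * Hausdorff dimension and covers *)

(** The constants are chosen in a forced order. Counting alone yields the scale [rho] and the factor
    [q]; [rho] fixes the precision [rho / 12] needed for slope ratios, the precision fixes the two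
    periodic orbits and how often their words are repeated, and these fix the loss [gam] of one
    return to the target parameter. Only then is the depth [n = q * p] chosen, so large that the
    exponent gained over [n] levels pays for [gam]. The collision constant of the model tree must
    therefore be independent of the depth and of the root cylinders. Inside one block of [n] levels
    the linear projection acts on actual cylinders, so a single parameter serves the whole block and
    the slope ratio drifts only from block to block. Each block is rooted at cylinders of long
    powers of the periodic words: there bounded distortion makes every preceding word a similarity
    up to the precision, so errors do not accumulate. Steering cannot change orientations, whence
    one target per relative orientation and even powers only. *)

Section Covers.
Context {R : realType}.
Implicit Types (S U : set R) (s d : R).

Lemma le_powR s (x y : R) : 0 <= s -> 0 <= x -> x <= y -> x `^ s <= y `^ s.
Proof.
by move=> s0 x0 xy; apply: ge0_ler_powR => //; rewrite nnegrE // (le_trans x0).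
Qed.

Lemma dist_le_diam U (x y : R) : U x -> U y -> (`|x - y|%:E <= diam U)%E.
Proof. by move=> Ux Uy; apply: ereal_sup_ubound; exists x => //; exists y. Qed.

Lemma diam_le U d : (forall x y, U x -> U y -> `|x - y| <= d) ->
  (diam U <= d%:E)%E.
Proof.
move=> h; apply: ge_ereal_sup => _ [x Ux [y Uy <-]]; rewrite lee_fin; exact: h.
Qed.

Lemma diam_fin U d : U !=set0 -> (diam U <= d%:E)%E ->
  exists D, [/\ diam U = D%:E, 0 <= D & D <= d].
Proof.
move=> [x Ux] Ud.
have D0 : (0 <= diam U)%E.
  by apply: le_trans (dist_le_diam Ux Ux); rewrite lee_fin.
case: (diam U) Ud D0 => [D| |] //; rewrite !lee_fin => Dd D0.
by exists D.
Qed.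

Lemma hausdorff_weight_ge0 s U : (0 <= hausdorff_weight s U)%E.
Proof. by rewrite /hausdorff_weight; case: ifP => // _; exact: poweR_ge0. Qed.

Lemma hausdorff_weight_le s U d : 0 <= s -> 0 <= d ->
  (forall x y, U x -> U y -> `|x - y| <= d) ->
  (hausdorff_weight s U <= (d `^ s)%:E)%E.
Proof.
move=> s0 d0 h; rewrite /hausdorff_weight; case: ifPn => [_|/set0P U0].
  by rewrite lee_fin powR_ge0.
have [D [-> D0 Dd]] := diam_fin U0 (diam_le h).
by rewrite poweR_EFin lee_fin le_powR.
Qed.

Lemma hausdorff_content_ge0 s d S : (0 <= hausdorff_content s d S)%E.
Proof.
apply: le_ereal_inf_tmp => _ [U _ <-].
by apply: nneseries_ge0 => n _ _; exact: hausdorff_weight_ge0.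
Qed.

Lemma hausdorff_content_le s d S : 0 < d ->
  (hausdorff_content s d S <= hausdorff_measure s S)%E.
Proof. by move=> d0; apply: ereal_sup_ubound; exists d. Qed.

Lemma hausdorff_measure_eq0 s S :
  (forall d, 0 < d -> (hausdorff_content s d S <= 0)%E) ->
  hausdorff_measure s S = 0%E.
Proof.
move=> h; apply/le_anti/andP; split.
  by apply: ge_ereal_sup => _ [d d0 <-]; exact: h.
by apply: le_trans (hausdorff_content_le s S (@ltr01 R)); exact: hausdorff_content_ge0.
Qed.

(** Finite covers of one common gauge suffice; the family is padded with empty sets, whose weight is
    0 also when [s = 0]. *)
Lemma null_of_covers S s : 0 <= s ->
  (forall e d0 : R, 0 < e -> 0 < d0 -> exists (M : nat) (U : nat -> set R) (d : R),
    [/\ 0 < d <= d0, S `<=` [set x | exists2 i, (i < M)%N & U i x],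
      (forall i x y, (i < M)%N -> U i x -> U i y -> `|x - y| <= d) &
      M%:R * d `^ s <= e]) ->
  hausdorff_measure s S = 0%E.
Proof.
move=> s0 h; apply: hausdorff_measure_eq0 => d0 d00.
apply/lee_addgt0Pr => e e0; rewrite add0e.
have [M [U [d [/andP[dgt dd0] SU Ud Me]]]] := h _ _ e0 d00.
pose V i := if (i < M)%N then U i else set0.
have Vd i x y : V i x -> V i y -> `|x - y| <= d.
  by rewrite /V; case: ifPn => // iM; exact: Ud.
apply: ge_ereal_inf.
exists (\sum_(0 <= i <oo) hausdorff_weight s (V i))%E.
  exists V => //; split.
    by move=> x /SU[i iM Uix]; exists i => //; rewrite /V iM.
  move=> i; apply: le_trans (diam_le (Vd i)) _; by rewrite lee_fin.
have W0 i : (0 <= hausdorff_weight s (V i))%E by exact: hausdorff_weight_ge0.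
apply: lime_le; first by apply: is_cvg_nneseries => n _ _; exact: W0.
apply: nearW => n.
have WM : (\sum_(0 <= i < n) hausdorff_weight s (V i) <=
   \sum_(0 <= i < n) (if (i < M)%N then (d `^ s)%:E else 0))%E.
  apply: lee_sum => i _; case: ifPn => iM.
    by apply: hausdorff_weight_le => //; [exact: ltW|exact: Vd].
  by rewrite /V (negbTE iM) /hausdorff_weight eqxx.
apply: le_trans WM _.
have -> : (\sum_(0 <= i < n) (if (i < M)%N then (d `^ s)%:E else 0) =
    ((minn n M)%:R * d `^ s)%:E)%E.
  elim: n => [|n IH]; first by rewrite big_geq // min0n mul0r.
  rewrite big_nat_recr // IH; have [nM|nM] := boolP (n < M)%N; last rewrite -leqNgt in nM.
    by rewrite (minn_idPl nM) (minn_idPl (ltnW nM)) /= -natr1 mulrDl mul1r.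
  by rewrite /= adde0 (minn_idPr nM) (minn_idPr (leqW nM)).
rewrite lee_fin (le_trans _ Me) // ler_wpM2r ?powR_ge0 // ler_nat.
exact: geq_minr.
Qed.

(** Every set receives a positive gauge, even if its diameter is 0, because the tree argument must
    assign to it a finite level. The added gauges are absorbed by a geometric series. *)
Lemma cover_of_null S s' s (e d0 : R) : 0 <= s' -> s' <= s -> 0 < s ->
  0 < e -> 0 < d0 -> hausdorff_measure s' S = 0%E ->
  exists (U : nat -> set R) (d : nat -> R),
    [/\ S `<=` \bigcup_i U i, forall i, 0 < d i <= d0,
      (forall i x y, U i x -> U i y -> `|x - y| <= d i) &
      (\sum_(0 <= i <oo) (d i `^ s)%:E <= e%:E)%E].
Proof.
move=> s'0 s's sgt e0 d00 HS.
(* Diameters at most [d1 <= 1] allow the exponent to rise from [s'] to [s]; the bound of [e1] by the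
   [s]-th power of [d1] keeps the added gauges below [d0]. *)
pose d1 := Num.min 1 d0; have d10 : 0 < d1 by rewrite lt_min ltr01.
pose e1 := Num.min (e / 2) (d1 `^ s).
have e10 : 0 < e1 by rewrite lt_min powR_gt0 // andbT divr_gt0.
have : (hausdorff_content s' d1 S < e1%:E)%E.
  by apply: le_lt_trans (hausdorff_content_le _ _ d10) _; rewrite HS lte_fin.
move=> /ereal_inf_lt[_ [U [SU Ud] <-] Ue].
pose ei (i : nat) := e1 / (2 ^ (i + 1))%:R : R.
have ei0 i : 0 < ei i by rewrite divr_gt0 // ltr0n expn_gt0.
have ei1 i : ei i <= e1.
  by rewrite ler_pdivrMr ?ltr0n ?expn_gt0 // ler_peMr ?ler1n ?expn_gt0 // ltW.
pose D i : R := if U i == set0 then 0 else fine (diam (U i)).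
pose d i : R := Num.max (D i) (ei i `^ s^-1).
have DU i : U i !=set0 -> diam (U i) = (D i)%:E /\ 0 <= D i <= d1.
  move=> Ui; have [x [xe x0 x1]] := diam_fin Ui (Ud i).
  by rewrite /D ifF ?xe //= ?x0 ?x1 //; apply/negbTE/set0P.
have D01 i : 0 <= D i <= d1.
  have [U0|/set0P/DU[]//] := eqVneq (U i) set0.
  by rewrite /D U0 eqxx lexx ltW.
exists U, d; split => //.
- move=> i; rewrite /d lt_max powR_gt0 // orbT ge_max /=.
  have d1d0 : d1 <= d0 by rewrite /d1 ge_min lexx orbT.
  rewrite (le_trans _ d1d0) ?(andP (D01 i)).2 //=.
  rewrite (le_trans _ d1d0) // -[leRHS](powRr1 (ltW d10)) -(@divff _ s) ?gt_eqF //.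
  rewrite [leRHS]powRrM; apply: le_powR; rewrite ?invr_ge0 ?(ltW sgt) ?(ltW (ei0 i)) //.
  by rewrite (le_trans (ei1 _)) // /e1 ge_min lexx orbT.
- move=> i x y Ux Uy; have [DE _] := DU i (ex_intro _ _ Ux).
  rewrite le_max; apply/orP; left.
  by rewrite -lee_fin -DE; exact: dist_le_diam.
- have step i : ((d i `^ s)%:E <= hausdorff_weight s' (U i) + (ei i)%:E)%E.
    have E0 : ei i `^ s^-1 `^ s = ei i.
      by rewrite -powRrM mulVf ?gt_eqF // powRr1 // ltW.
    rewrite /d; case: (leP (D i) (ei i `^ s^-1)) => _.
      by rewrite E0 leeDr // hausdorff_weight_ge0.
    apply: (@le_trans _ _ (hausdorff_weight s' (U i))); last first.
      by rewrite leeDl // lee_fin ltW.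
    rewrite /hausdorff_weight; case: eqVneq => U0.
      by rewrite /D U0 eqxx powR0 // gt_eqF.
    have [-> /andP[x0 x1]] := DU i (proj1 (set0P (U i)) U0); rewrite poweR_EFin lee_fin.
    have [->|xn0] := eqVneq (D i) 0.
      by rewrite powR0 ?powR_ge0 // gt_eqF.
    apply: ger_powR => //; rewrite lt_neqAle eq_sym xn0 x0 /=.
    by rewrite (le_trans x1) // /d1 ge_min lexx.
  apply: le_trans (lee_nneseries _ (fun i _ => step i)) _.
    by move=> i _ _; rewrite lee_fin powR_ge0.
  rewrite nneseriesD //; last by move=> i _ _; rewrite lee_fin ltW.
  2: by move=> i _ _; exact: hausdorff_weight_ge0.
  have -> : (e%:E = (e / 2)%:E + (e / 2)%:E)%E by rewrite -EFinD -splitr.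
  apply: leeD.
    by apply: ltW; apply: lt_le_trans Ue _; rewrite lee_fin /e1 ge_min lexx.
  rewrite (cvg_lim _ (@cvg_geometric_eseries_half R e1 0)) //.
  by rewrite expr0 divr1 lee_fin /e1 ge_min lexx.
Qed.

(** The first hypothesis excludes the infimum of the empty set, which is 0 by convention. *)
Lemma HD_ge S s : (exists s1, 0 <= s1 /\ hausdorff_measure s1 S = 0%E) ->
  (forall s', 0 <= s' -> s' <= s -> hausdorff_measure s' S <> 0%E) -> s <= HD S.
Proof.
move=> S0 h; apply: lb_le_inf; first by case: S0 => s1; exists s1.
move=> s' /= [s'0 HS]; rewrite leNgt; apply/negP => /ltW s's; exact: (h s').
Qed.

Lemma HD_le S s : 0 <= s -> hausdorff_measure s S = 0%E -> HD S <= s.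
Proof.
move=> s0 h; apply: ge_inf => /=; last by split.
by exists 0 => x /= [].
Qed.

Lemma HD_ge0 S : 0 <= HD S.
Proof.
have [E0|E0] := pselect ([set s | 0 <= s /\ hausdorff_measure s S = 0%E] !=set0).
  by apply: lb_le_inf => // x /= [].
rewrite /HD (_ : mkset _ = set0) ?inf0 //; apply/seteqP; split => // x hx.
by exfalso; apply: E0; exists x.
Qed.

(** Supplies the first hypothesis of [HD_ge]. Exponent 2 makes the total weight of [n + 1] intervals
    of length [L / n] tend to 0. *)
Lemma hausdorff_measure_bounded S (a b : R) : (forall x, S x -> a <= x <= b) ->
  hausdorff_measure 2 S = 0%E.
Proof.
move=> Sab; apply: null_of_covers => // e d0 e0 d00.
pose L := Num.max 1 (b - a).
have L0 : 0 < L by rewrite lt_max ltr01.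
pose n := (Num.truncn (L / d0 + 2 * L ^+ 2 / e)).+1.
have nb : L / d0 + 2 * L ^+ 2 / e < n%:R.
  rewrite /n; apply: truncnS_gt.
have n0 : 0 < n%:R :> R by rewrite ltr0n.
have p1 : 0 <= 2 * L ^+ 2 / e by rewrite divr_ge0 ?mulr_ge0 ?sqr_ge0 // ltW.
have p2 : 0 <= L / d0 by rewrite divr_ge0 // ltW.
exists n.+1, (fun i => [set x | a + i%:R * (L / n%:R) <= x <= a + (i.+1)%:R * (L / n%:R)]), (L / n%:R).
have Ln : 0 < L / n%:R by rewrite divr_gt0.
split.
- rewrite Ln /= ler_pdivrMr // -ler_pdivrMl // mulrC; lra.
- move=> x /Sab/andP[ax xb].
  pose i := Num.truncn ((x - a) / (L / n%:R)).
  have := @truncn_itv R ((x - a) / (L / n%:R)).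
  rewrite divr_ge0 ?(ltW Ln) ?subr_ge0 // => /(_ isT); rewrite -/i => /andP[i1 i2].
  exists i.
    rewrite ltnS -(ler_nat R) (le_trans i1) // ler_pdivrMr //.
    rewrite mulrCA divff ?gt_eqF // mulr1 (le_trans _ (_ : b - a <= L)) //.
      by rewrite lerD2r.
    by rewrite /L le_max lexx orbT.
  rewrite ler_pdivlMr // in i1; rewrite ltr_pdivrMr // in i2.
  by apply/andP; split; lra.
- move=> i x y _ /= /andP[x1 x2] /andP[y1 y2].
  rewrite -natr1 mulrDl mul1r in x2 y2.
  by rewrite ler_norml; apply/andP; split; lra.
- rewrite powR_mulrn ?(ltW Ln) // -natr1 exprMn exprVn.
  have n1 : 1 <= n%:R :> R by rewrite ler1n.
  have : 2 * L ^+ 2 / e <= n%:R by lra.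
  rewrite ler_pdivrMr // => h1.
  have -> : (n%:R + 1) * (L ^+ 2 / n%:R ^+ 2) = (n%:R + 1) * L ^+ 2 / n%:R ^+ 2 by rewrite mulrA.
  rewrite ler_pdivrMr ?exprn_gt0 //.
  have L2 : 0 <= L ^+ 2 by exact: sqr_ge0.
  have h2 : (n%:R + 1) * L ^+ 2 <= 2 * L ^+ 2 * n%:R by nra.
  apply: le_trans h2 _; have := ler_wpM2r (ltW n0) h1; lra.
Qed.

End Covers.

(** * A dimension bound from trees *)

Section TreeLemma.
Context {R : realType}.

Lemma exists_expr_lt (r e : R) : 0 <= r < 1 -> 0 < e -> exists n, r ^+ n < e.
Proof.
move=> /andP[r0 r1] e0.
have : (fun n => r ^+ n) @ \oo --> 0 by apply: cvg_expr; rewrite ger0_norm.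
move=> /cvgrPdist_lt/(_ e e0)[n _ /(_ n (leqnn n))].
by rewrite /= sub0r normrN ger0_norm ?exprn_ge0 // => h; exists n.
Qed.

Context {T : Type}.
Variables (child : T -> nat -> T) (N : nat) (img : T -> set R).

Definition hit (U : set R) (v : T) : bool := `[< img v `&` U !=set0 >].

Fixpoint nhit (U : set R) (v : T) (m : nat) : nat :=
  if m is m'.+1 then (\sum_(0 <= i < N) nhit U (child v i) m')%N else hit U v.

Fixpoint walk (v : T) (iota : nat -> nat) (k : nat) : T :=
  if k is k'.+1 then child (walk v iota k') (iota k') else v.

(** Vertices carry no level in their type; [Inv k v] says that [v] is a legitimate vertex of level
    [k], and all tree hypotheses are relative to it. *)
Variable Inv : nat -> T -> Prop.
Hypothesis Inv_child : forall k v i, Inv k v -> (i < N)%N -> Inv k.+1 (child v i).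
Hypothesis img_child : forall k v i, Inv k v -> (i < N)%N ->
  img (child v i) `<=` img v.

Lemma nhit_nohit U k v m : Inv k v -> ~~ hit U v -> nhit U v m = 0%N.
Proof.
elim: m k v => [|m IH] k v Iv hv /=; first by rewrite (negbTE hv).
rewrite big_nat big1 // => i /= iN; apply: (IH k.+1); first exact: Inv_child.
apply: contra hv => /asboolP[x [x1 x2]]; apply/asboolP; exists x; split => //.
exact: (img_child Iv iN).
Qed.

Variables (B : nat) (r c : R).
Hypothesis r01 : 0 < r < 1.
Hypothesis c0 : 0 < c.
Hypothesis few_hits : forall k v U, Inv k v ->
  (forall x y, U x -> U y -> `|x - y| <= c * r ^+ k.+1) ->
  (\sum_(0 <= i < N) hit U (child v i) <= B)%N.

Lemma nhit_le U k v m : Inv k v ->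
  (forall x y, U x -> U y -> `|x - y| <= c * r ^+ (k + m)) ->
  (nhit U v m <= B ^ m)%N.
Proof.
elim: m k v => [|m IH] k v Iv hU /=; first by case: (hit U v).
have h1 : (\sum_(0 <= i < N) nhit U (child v i) m <=
     \sum_(0 <= i < N) hit U (child v i) * B ^ m)%N.
  rewrite big_nat [leqRHS]big_nat; apply: leq_sum => i /= iN.
  have Ic := Inv_child Iv iN.
  case: (boolP (hit U (child v i))) => hi; last by rewrite (nhit_nohit _ Ic).
  by rewrite mul1n; apply: IH Ic _ => x y Ux Uy; rewrite addSnnS; exact: hU.
apply: leq_trans h1 _; rewrite -big_distrl /= expnS leq_mul2r.
apply/orP; right; apply: few_hits Iv _ => x y Ux Uy.
apply: le_trans (hU _ _ Ux Uy) _; rewrite ler_wpM2l ?(ltW c0) //.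
by apply: ler_wiXn2l; [case/andP: r01 => /ltW|case/andP: r01 => _ /ltW|lia].
Qed.

Variable S : set R.
Variable root : T.
Hypothesis Inv_root : Inv 0 root.
Hypothesis path_point : forall iota : nat -> nat, (forall k, iota k < N)%N ->
  exists2 x, S x & forall k, img (walk root iota k) x.

(** Method of conditional expectations: [Phi k v] is the expected number of [i] with [k <= lev i]
    such that a uniformly random branch below [v] is hit by [U i] at level [lev i]. Some child does
    not increase it, so it stays below 1; at level [lev i] the [i]-th term is 0 or 1, hence 0. *)
Lemma avoiding_path (U : nat -> set R) (lev : nat -> nat) : (0 < N)%N ->
  (\sum_(0 <= i <oo) ((nhit (U i) root (lev i))%:R / (N ^ lev i)%:R)%:E < 1 :> \bar R)%E ->
  exists iota : nat -> nat, (forall k, iota k < N)%N /\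
    forall i, ~~ hit (U i) (walk root iota (lev i)).
Proof.
move=> N0 sum1.
pose w i k v : R := if (k <= lev i)%N then
  (nhit (U i) v (lev i - k))%:R / (N ^ (lev i - k))%:R else 0.
have w0 i k v : 0 <= w i k v.
  by rewrite /w; case: ifP => // _; rewrite divr_ge0.
pose Phi k v : \bar R := (\sum_(0 <= i <oo) (w i k v)%:E)%E.
pose G k v := Inv k v /\ (Phi k v < 1)%E.
have step (kv : nat * T) : exists i, G kv.1 kv.2 ->
    (i < N)%N /\ G kv.1.+1 (child kv.2 i).
  case: kv => k v /=.
  have [[Iv Pv]|nG] := pselect (G k v); last by exists 0%N.
  apply: contrapT => /forallNP noi.
  have big i : (i < N)%N -> (1 <= Phi k.+1 (child v i))%E.
    move=> iN; rewrite leNgt; apply/negP => lti; apply: (noi i) => _.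
    by split => //; split => //; exact: Inv_child.
  (* An equality while [k < lev j]; at later levels the children contribute 0. *)
  have wsum j : \sum_(0 <= i < N) w j k.+1 (child v i) <= N%:R * w j k v.
    rewrite /w; case: (ltnP k (lev j)) => kj; last first.
      rewrite big1 // mulr_ge0 //; case: ifP => // _; rewrite divr_ge0 //.
    rewrite (ltnW kj) -mulr_suml -natr_sum.
    have -> : (lev j - k = (lev j - k.+1).+1)%N by lia.
    set x := (\sum_(0 <= i < N) _)%N; set y := (N ^ _)%N.
    have y0 : y%:R != 0 :> R by rewrite pnatr_eq0 -lt0n expn_gt0 N0.
    have n0 : N%:R != 0 :> R by rewrite pnatr_eq0 -lt0n.
    rewrite /= expnS natrM -/x -/y le_eqVlt; apply/orP; left; apply/eqP.
    by field; apply/andP.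
  have : (N%:R%:E <= N%:R%:E * Phi k v)%E.
    rewrite -nneseriesZl; last by move=> i _; rewrite lee_fin.
    apply: (@le_trans _ _ (\sum_(0 <= j <oo) \sum_(0 <= i < N) (w j k.+1 (child v i))%:E)%E).
      rewrite nneseries_sum_nat; last by move=> i j; rewrite lee_fin.
      rewrite -[X in (X%:E <= _)%E](_ : \sum_(0 <= i < N) 1 = N%:R); last first.
        by rewrite big_mkord sumr_const card_ord.
      rewrite -sumEFin big_nat [leRHS]big_nat; apply: lee_sum => i /= iN.
      exact: big.
    apply: lee_nneseries => [j _ _|j _].
      by apply: sume_ge0 => i _; rewrite lee_fin.
    by rewrite sumEFin -EFinM lee_fin.
  have P0 : (0 <= Phi k v)%E by apply: nneseries_ge0 => i _ _; rewrite lee_fin.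
  case: (Phi k v) P0 Pv => [p| |] // _; rewrite lte_fin -EFinM lee_fin => p1.
  by rewrite leNgt gtr_pMr ?p1 // ltr0n.
have G0 : G 0%N root.
  by split => //; rewrite /Phi /w; under eq_eseriesr do rewrite leq0n subn0.
have [f Hf] := choice step.
pose st := fix st k := if k is k'.+1 then child (st k') (f (k', st k')) else root.
have Gst k : G k (st k).
  by elim: k => //= k IH; exact: (Hf (k, st k) IH).2.
pose iota k := f (k, st k).
have wst k : walk root iota k = st k by elim: k => //= k ->.
exists iota; split; first by move=> k; exact: (Hf (k, st k) (Gst k)).1.
move=> i; rewrite wst; apply/negP => hi.
have [_] := Gst (lev i); rewrite ltNge => /negP; apply.
have : (\sum_(0 <= j < i.+1) (w j (lev i) (st (lev i)))%:E <= Phi (lev i) (st (lev i)))%E.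
  by apply: nneseries_lim_ge => j _ _; rewrite lee_fin.
apply: le_trans; rewrite big_nat_recr //=.
rewrite [X in (_ + X%:E)%E]/w leqnn subnn expn0 /= hi divr1.
by rewrite leeDr // sume_ge0 // => j _; rewrite lee_fin.
Qed.


(* A cover by sets of small diameter hits too few nodes to stop every branch, so
   a branch avoiding the cover can be chosen greedily; its point is uncovered. *)
Lemma tree_HD_ge s : (0 < N)%N -> 0 < s -> B%:R <= N%:R * r `^ s ->
  (exists a b, forall x, S x -> a <= x <= b) -> s <= HD S.
Proof.
move=> N0 s0 BN [a [b Sab]].
have [/andP[r0 r1]] := (r01).
have cr0 : 0 < (c * r) `^ s by rewrite powR_gt0 // mulr_gt0.
apply: HD_ge; first by exists 2; split => //; exact: hausdorff_measure_bounded Sab.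
move=> s' s'0 s's Ss'.
(* The budget compensates for rounding [d i] to a power of [r], which costs the factor
   [(c * r) ^ s]; the 2 makes the final sum strictly less than 1. *)
have e0 : 0 < (c * r) `^ s / 2 by rewrite divr_gt0.
have [U [d [SU d01 Ud sumd]]] := cover_of_null s'0 s's s0 e0 c0 Ss'.
have lev i : exists k, c * r ^+ k.+1 < d i /\ d i <= c * r ^+ k.
  have [di0 dic] := andP (d01 i).
  have : exists k, c * r ^+ k.+1 < d i.
    have [n hn] := exists_expr_lt (r := r) (e := d i / c) ltac:(lra) (divr_gt0 di0 c0).
    exists n; rewrite ltr_pdivlMr // mulrC in hn; apply: le_lt_trans hn.
    rewrite ler_wpM2l ?(ltW c0) // exprS ler_piMl ?exprn_ge0 ?(ltW r0) //.
    exact: ltW.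
  move=> ex; case: (ex_minnP ex) => [[|k] hk mink].
    by exists 0%N; rewrite expr0 mulr1.
  exists k.+1; split; first exact: hk.
  by rewrite leNgt; apply/negP => /mink; rewrite ltnn.
have [f Hf] := choice lev.
have [] := @avoiding_path U f N0; last first.
  move=> iota [iN av]; have [x Sx imx] := path_point iN.
  have [i _ Uix] := SU _ Sx; have /negP := av i; apply; apply/asboolP.
  by exists x; split => //; exact: imx.
(* For a set of level [k] the proportion of hit vertices is at most [(B / N) ^ k], hence at most
   [(r ^ k) ^ s], and [c * r ^ k.+1 < d i]. *)
apply: (@le_lt_trans _ _ (((c * r) `^ s)^-1%:E * \sum_(0 <= i <oo) (d i `^ s)%:E)%E).
  rewrite -nneseriesZl; last by move=> i _; rewrite lee_fin powR_ge0.
  apply: lee_nneseries => [i _ _|i _]; first by rewrite lee_fin divr_ge0.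
  rewrite -EFinM lee_fin; have [h1 h2] := Hf i.
  have di0 : 0 < d i by case/andP: (d01 i).
  apply: (@le_trans _ _ ((B ^ f i)%:R / (N ^ f i)%:R)).
    rewrite ler_wpM2r ?invr_ge0 // ler_nat; apply: (nhit_le Inv_root) => x y Ux Uy.
    by rewrite add0n; apply: le_trans (Ud i x y Ux Uy) h2.
  rewrite ler_pdivrMr ?ltr0n ?expn_gt0 ?N0 // !natrX.
  apply: (@le_trans _ _ ((N%:R * r `^ s) ^+ f i)).
    by apply: lerXn2r => //; rewrite nnegrE // mulr_ge0 // powR_ge0.
  rewrite exprMn mulrC ler_wpM2r ?exprn_ge0 //.
  have -> : (r `^ s) ^+ f i = (r ^+ f i) `^ s.
    by rewrite -powR_mulrn ?powR_ge0 // powRAC powR_mulrn // ltW.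
  have rk0 : 0 <= r ^+ f i by rewrite exprn_ge0 // ltW.
  have cr00 : 0 <= c * r by rewrite mulr_ge0 // ltW.
  rewrite mulrC ler_pdivlMr // -(powRM _ rk0 cr00).
  apply: le_powR; [exact: ltW|exact: mulr_ge0|].
  by rewrite mulrCA -exprSr ltW.
apply: (@le_lt_trans _ _ (((c * r) `^ s)^-1%:E * ((c * r) `^ s / 2)%:E)%E).
  by rewrite lee_pmul // ?lee_fin ?invr_ge0 ?(ltW cr0) // nneseries_ge0 // => i _ _; rewrite lee_fin powR_ge0.
by rewrite -EFinM lte_fin mulrA mulVf ?gt_eqF // mul1r invf_lt1 // ltr1n.
Qed.

End TreeLemma.

(** * Markov systems of contractions *)

(* The inverse branches [br a b : I(b) -> I(a)] of an expanding Markov map.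
   Smoothness enters only through secants: [br_slope] replaces the bounds on the
   derivative and [br_dist] its Hoelder continuity.  [ori a b] is [true] when the
   branch reverses orientation. *)
Record markov_ifs (R : realType) := MarkovIfs {
  alph : finType;
  tr : rel alph;
  base : alph -> R;
  br : alph -> alph -> R -> R;
  ori : alph -> alph -> bool;
  cmin : R;
  kap : R;
  hold : R;
  bet : R;
  cmin_gt0 : 0 < cmin;
  kap_lt1 : cmin <= kap < 1;
  hold_ge0 : 0 <= hold;
  bet_gt0 : 0 < bet;
  base_disj : forall a b x, base a <= x <= base a + 1 ->
    base b <= x <= base b + 1 -> a = b;
  br_in : forall a b x, tr a b -> base b <= x <= base b + 1 ->
    base a <= br a b x <= base a + 1;
  br_slope : forall a b x y, tr a b -> base b <= x -> x < y -> y <= base b + 1 ->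
    cmin * (y - x) <= (-1) ^+ ori a b * (br a b y - br a b x) <= kap * (y - x);
  br_dist : forall a b x y u v l, tr a b ->
    (forall p, p \in [:: x; y; u; v] -> base b <= p <= base b + 1) ->
    (forall p q, p \in [:: x; y; u; v] -> q \in [:: x; y; u; v] -> `|p - q| <= l) ->
    x != y -> u != v ->
    `|br a b x - br a b y| / `|x - y| <=
      expR (hold * l `^ bet) * (`|br a b u - br a b v| / `|u - v|);
  br_onto : forall a b y, tr a b ->
    Num.min (br a b (base b)) (br a b (base b + 1)) <= y <=
      Num.max (br a b (base b)) (br a b (base b + 1)) ->
    exists2 x, base b <= x <= base b + 1 & br a b x = y;
  br_disj : forall a b b' x x', tr a b -> tr a b' ->
    base b <= x <= base b + 1 -> base b' <= x' <= base b' + 1 ->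
    br a b x = br a b' x' -> b = b';
  connectable : forall a b, exists s, [/\ path tr a s, last a s = b & s != [::]]
}.

Section Words.
Context {R : realType}.
Variable F : markov_ifs R.
Implicit Types (a b e : alph F) (s t w : seq (alph F)) (x y u v l : R).
Local Notation tr := (@tr R F).

Definition inI a x : bool := base a <= x <= base a + 1.

(** A word is a letter [a] with a tail [s], so it is never empty; [fw a s] maps the interval of
    [last a s] into that of [a]. *)
Fixpoint fw a s (x : R) : R := if s is b :: s' then br a b (fw b s' x) else x.

Fixpoint sgw a s : bool := if s is b :: s' then ori a b (+) sgw b s' else false.

Definition cyl a s : set R := [set fw a s x | x in [set x | inI (last a s) x]].

Definition len_w a s : R :=
  `|fw a s (base (last a s) + 1) - fw a s (base (last a s))|.

Definition lo_w a s : R :=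
  Num.min (fw a s (base (last a s) + 1)) (fw a s (base (last a s))).

Definition limset : set R := [set x | forall n, exists a s,
  [/\ (n <= size s)%N, path tr a s & cyl a s x]].

(** Sum of the geometric series of distortions along a composition: after [j] letters all distances
    have shrunk by [kap F ^+ j]. *)
Definition Kd : R := hold F / (1 - kap F `^ bet F).
Definition Q : R := expR Kd.
(** Lower bound for the proportion of a cylinder that remains when one letter is appended. *)
Definition c1 : R := Q^-1 * cmin F.

Lemma kap_gt0 : 0 < kap F.
Proof. by have := cmin_gt0 F; have := kap_lt1 F; lra. Qed.

Lemma kapb_lt1 : 0 < kap F `^ bet F < 1.
Proof.
rewrite powR_gt0 ?kap_gt0 //=; have <- : 1 `^ bet F = 1 :> R by rewrite powR1.
rewrite gt0_ltr_powR ?bet_gt0 ?nnegrE ?ler01 ?(ltW kap_gt0) //.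
by case/andP: (kap_lt1 F).
Qed.

Lemma Kd_ge0 : 0 <= Kd.
Proof. by rewrite divr_ge0 ?hold_ge0 // subr_ge0 ltW //; case/andP: kapb_lt1. Qed.

Lemma Q_ge1 : 1 <= Q.
Proof. by rewrite -expR0 ler_expR Kd_ge0. Qed.

Lemma Q_gt0 : 0 < Q. Proof. exact: expR_gt0. Qed.

Lemma c1_gt0 : 0 < c1.
Proof. by rewrite mulr_gt0 ?invr_gt0 ?Q_gt0 ?cmin_gt0. Qed.

Lemma cmin_lt1 : cmin F < 1. Proof. by have := kap_lt1 F; lra. Qed.

Lemma c1_lt1 : c1 < 1.
Proof.
rewrite /c1 mulrC ltr_pdivrMr ?Q_gt0 // mul1r.
exact: lt_le_trans cmin_lt1 Q_ge1.
Qed.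

Lemma fw_cat a s t x : fw a (s ++ t) x = fw a s (fw (last a s) t x).
Proof. by elim: s a => //= b s IH a; rewrite IH. Qed.

Lemma sgw_cat a s t : sgw a (s ++ t) = sgw a s (+) sgw (last a s) t.
Proof. by elim: s a => //= b s IH a; rewrite IH addbA. Qed.

Lemma fw_in a s x : path tr a s -> inI (last a s) x -> inI a (fw a s x).
Proof. elim: s a => //= b s IH a /andP[ab bs] hx; exact: br_in (IH _ bs hx). Qed.

Lemma fw_slope a s x y : path tr a s -> inI (last a s) x -> inI (last a s) y -> x < y ->
  cmin F ^+ size s * (y - x) <= (-1) ^+ sgw a s * (fw a s y - fw a s x) <=
    kap F ^+ size s * (y - x).
Proof.
elim: s a => /= [|b s IH] a.
  by move=> _ _ _ _; rewrite !expr0 !mul1r lexx.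
move=> /andP[ab bs] hx hy xy.
have /andP[h1 h2] := IH _ bs hx hy xy.
have hx' := fw_in bs hx; have hy' := fw_in bs hy.
have yx0 : 0 < y - x by rewrite subr_gt0.
have cp : 0 < cmin F ^+ size s by rewrite exprn_gt0 // cmin_gt0.
have p0 : 0 < (-1) ^+ sgw b s * (fw b s y - fw b s x).
  by apply: lt_le_trans h1; rewrite mulr_gt0.
rewrite signr_addb.
move: hx' hy'; rewrite /inI => /andP[hx1 hx2] /andP[hy1 hy2].
have c0 := cmin_gt0 F; have k0 := kap_gt0.
case: (sgw b s) p0 h1 h2 => /=; rewrite ?expr1 ?expr0 ?mulN1r ?mul1r => p0 h1 h2.
  have lt1 : fw b s y < fw b s x by lra.
  have /andP[g1 g2] := br_slope ab hy1 lt1 hx2.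
  rewrite mulrN1 !mulNr -mulrN opprB !exprS; apply/andP; split.
    apply: le_trans g1; rewrite -mulrA ler_wpM2l ?(ltW c0) //; lra.
  apply: le_trans g2 _; rewrite -mulrA ler_wpM2l ?(ltW k0) //; lra.
have lt1 : fw b s x < fw b s y by lra.
have /andP[g1 g2] := br_slope ab hx1 lt1 hy2.
rewrite mulr1 !exprS; apply/andP; split.
  by apply: le_trans g1; rewrite -mulrA ler_wpM2l ?(ltW c0).
by apply: le_trans g2 _; rewrite -mulrA ler_wpM2l ?(ltW k0).
Qed.

Lemma fw_pos a s x y : path tr a s -> inI (last a s) x -> inI (last a s) y ->
  x < y -> (-1) ^+ sgw a s * (fw a s y - fw a s x) = `|fw a s x - fw a s y|.
Proof.
move=> ps hx hy xy; have /andP[h _] := fw_slope ps hx hy xy.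
have cp : 0 < cmin F ^+ size s * (y - x) by rewrite mulr_gt0 ?exprn_gt0 ?cmin_gt0 ?subr_gt0.
have := ltW (lt_le_trans cp h) => /ger0_norm <-.
by rewrite normrM normr_sign mul1r distrC.
Qed.

Lemma fw_diff a s x y : path tr a s -> inI (last a s) x -> inI (last a s) y ->
  x != y ->
  fw a s x - fw a s y = (-1) ^+ sgw a s * (`|fw a s x - fw a s y| / `|x - y|) * (x - y).
Proof.
move=> ps hx hy; case: ltgtP => // ne _.
  rewrite -(fw_pos ps hx hy ne) (ltr0_norm (_ : x - y < 0)) ?subr_lt0 //.
  have n0 : x - y != 0 by rewrite subr_eq0 lt_eqF.
  have e2 : (-1) ^+ sgw a s * (-1) ^+ sgw a s = 1 :> R by rewrite -expr2 sqrr_sign.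
  set e := _ ^+ _ in e2 *.
  transitivity (e * e * ((fw a s y - fw a s x) / (- (x - y)) * (x - y))); last by ring.
  by rewrite e2; field.
rewrite distrC -(fw_pos ps hy hx ne) (gtr0_norm (_ : 0 < x - y)) ?subr_gt0 //.
have n0 : x - y != 0 by rewrite subr_eq0 gt_eqF.
have e2 : (-1) ^+ sgw a s * (-1) ^+ sgw a s = 1 :> R by rewrite -expr2 sqrr_sign.
set e := _ ^+ _ in e2 *.
transitivity (e * e * ((fw a s x - fw a s y) / (x - y) * (x - y))); last by ring.
by rewrite e2; field.
Qed.

Lemma fw_le a s x y : path tr a s -> inI (last a s) x -> inI (last a s) y ->
  cmin F ^+ size s * `|x - y| <= `|fw a s x - fw a s y| <= kap F ^+ size s * `|x - y|.
Proof.
move=> ps; wlog xy : x y / x <= y => [h hx hy|].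
  have [xy|/ltW yx] := leP x y; first exact: h.
  by rewrite (distrC x) (distrC (fw a s x)); exact: h.
move: xy; rewrite le_eqVlt => /orP[/eqP-> _ _|xy hx hy].
  by rewrite !subrr normr0 !mulr0 lexx.
rewrite -(fw_pos ps hx hy xy) distrC gtr0_norm ?subr_gt0 //.
exact: fw_slope.
Qed.

Lemma fw_inj a s x y : path tr a s -> inI (last a s) x -> inI (last a s) y ->
  fw a s x = fw a s y -> x = y.
Proof.
move=> ps hx hy E; have /andP[h _] := fw_le ps hx hy.
move: h; rewrite E subrr normr0 pmulr_rle0 ?exprn_gt0 ?cmin_gt0 //.
by rewrite normr_le0 subr_eq0 => /eqP.
Qed.

Lemma base_in a : inI a (base a) && inI a (base a + 1).
Proof. by rewrite /inI; apply/andP; split; lra. Qed.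

Lemma baseI a : inI a (base a). Proof. by case/andP: (base_in a). Qed.
Lemma baseI1 a : inI a (base a + 1). Proof. by case/andP: (base_in a). Qed.

(** Distortions of the successive branches form a geometric series because the four points contract
    at each letter. The induction carries the factor [1 - q ^+ size s'], the part of the series
    already used, and drops it at the end. *)
Lemma fw_dist a s x y u v l : path tr a s ->
  (forall p, p \in [:: x; y; u; v] -> inI (last a s) p) ->
  (forall p q, p \in [:: x; y; u; v] -> q \in [:: x; y; u; v] -> `|p - q| <= l) ->
  x != y -> u != v ->
  `|fw a s x - fw a s y| / `|x - y| <=
    expR (Kd * l `^ bet F) * (`|fw a s u - fw a s v| / `|u - v|).
Proof.
have [k0 k1] := andP kapb_lt1; set q := kap F `^ bet F in k0 k1.
have gen a' s' : path tr a' s' ->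
  (forall p, p \in [:: x; y; u; v] -> inI (last a' s') p) ->
  (forall p q, p \in [:: x; y; u; v] -> q \in [:: x; y; u; v] -> `|p - q| <= l) ->
  x != y -> u != v ->
  `|fw a' s' x - fw a' s' y| / `|x - y| <=
    expR (Kd * l `^ bet F * (1 - q ^+ size s')) *
      (`|fw a' s' u - fw a' s' v| / `|u - v|).
  elim: s' a' => /= [|b s' IH] a'.
    move=> _ _ _ xy uv; rewrite expr0 subrr mulr0 expR0 mul1r.
    by rewrite !divff ?normr_eq0 ?subr_eq0.
  move=> /andP[ab bs] hI hl xy uv.
  have IHb := IH _ bs hI hl xy uv.
  have inx : inI (last b s') x by apply: hI; rewrite !inE eqxx.
  have iny : inI (last b s') y by apply: hI; rewrite !inE eqxx !orbT.
  have inu : inI (last b s') u by apply: hI; rewrite !inE eqxx !orbT.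
  have inv : inI (last b s') v by apply: hI; rewrite !inE eqxx !orbT.
  have l0 : 0 <= l.
    by apply: le_trans (normr_ge0 _) (hl x x _ _); rewrite !inE eqxx.
  have nxy : fw b s' x != fw b s' y.
    by apply: contra xy => /eqP/(fw_inj bs inx iny)/eqP.
  have nuv : fw b s' u != fw b s' v.
    by apply: contra uv => /eqP/(fw_inj bs inu inv)/eqP.
  have D := @br_dist R F a' b (fw b s' x) (fw b s' y) (fw b s' u) (fw b s' v)
    (kap F ^+ size s' * l) ab _ _ nxy nuv.
  have mapE : [:: fw b s' x; fw b s' y; fw b s' u; fw b s' v] =
    map (fw b s') [:: x; y; u; v] by [].
  have {D} D := D ltac:(by move=> p; rewrite mapE => /mapP[p' hp ->]; exact: fw_in bs (hI _ hp)).
  have {D} D := D ltac:(by move=> p p'; rewrite mapE => /mapP[p1 hp ->] /mapP[p2 hp' ->];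
    apply: le_trans (andP (fw_le bs (hI _ hp) (hI _ hp'))).2 _;
    rewrite ler_wpM2l ?hl // exprn_ge0 // ltW // kap_gt0).
  set X := `|fw b s' x - fw b s' y| in D IHb.
  set U := `|fw b s' u - fw b s' v| in D IHb.
  have X0 : 0 < X by rewrite normr_gt0 subr_eq0.
  have U0 : 0 < U by rewrite normr_gt0 subr_eq0.
  have xy0 : 0 < `|x - y| by rewrite normr_gt0 subr_eq0.
  have uv0 : 0 < `|u - v| by rewrite normr_gt0 subr_eq0.
  set A := `|br a' b (fw b s' x) - _| in D *.
  set C := `|br a' b (fw b s' u) - _| in D *.
  have -> : A / `|x - y| = A / X * (X / `|x - y|) by rewrite mulrA divfK ?gt_eqF.
  have -> : C / `|u - v| = C / U * (U / `|u - v|) by rewrite mulrA divfK ?gt_eqF.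
  have AX0 : 0 <= A / X by rewrite divr_ge0 // normr_ge0.
  have Xx0 : 0 <= X / `|x - y| by rewrite divr_ge0 // normr_ge0.
  apply: le_trans (ler_pM AX0 Xx0 D IHb) _.
  rewrite mulrACA -expRD ler_wpM2r //.
    by rewrite mulr_ge0 ?divr_ge0 ?normr_ge0.
  rewrite ler_expR powRM ?exprn_ge0 ?(ltW kap_gt0) //.
  rewrite -powR_mulrn ?(ltW kap_gt0) // powRAC powR_mulrn ?(ltW k0) // -/q.
  have HK : hold F = Kd * (1 - q) by rewrite /Kd divfK // gt_eqF // subr_gt0.
  rewrite HK exprS le_eqVlt; apply/orP; left; apply/eqP; ring.
move=> ps hI hl xy uv; apply: le_trans (gen _ _ ps hI hl xy uv) _.
rewrite ler_wpM2r ?divr_ge0 ?normr_ge0 // ler_expR.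
have : 0 <= Kd * l `^ bet F by rewrite mulr_ge0 ?Kd_ge0 ?powR_ge0.
have : 0 <= q ^+ size s by rewrite exprn_ge0 // ltW.
by set A := Kd * _; nra.
Qed.

Lemma len_w_gt0 a s : path tr a s -> 0 < len_w a s.
Proof.
move=> ps; have /andP[h _] := fw_le ps (baseI1 _) (baseI _).
apply: lt_le_trans h; rewrite mulr_gt0 ?exprn_gt0 ?cmin_gt0 //.
by rewrite addrC addKr normr1.
Qed.

Lemma len_nil a : len_w a [::] = 1.
Proof. by rewrite /len_w /= addrC addKr normr1. Qed.

Lemma inI_dist a x y : inI a x -> inI a y -> `|x - y| <= 1.
Proof. by rewrite /inI => /andP[? ?] /andP[? ?]; rewrite ler_norml; apply/andP; split; lra. Qed.

Lemma fw_len a s x y : path tr a s -> inI (last a s) x -> inI (last a s) y ->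
  Q^-1 * len_w a s * `|x - y| <= `|fw a s x - fw a s y| <= Q * len_w a s * `|x - y|.
Proof.
move=> ps hx hy; have [->|xy] := eqVneq x y.
  by rewrite !subrr normr0 !mulr0 lexx.
have xy0 : 0 < `|x - y| by rewrite normr_gt0 subr_eq0.
set b1 := base (last a s) + 1; set b0 := base (last a s).
have b10 : b1 != b0 by rewrite /b1 -subr_eq0 addrC addKr oner_eq0.
have n1 : `|b1 - b0| = 1 by rewrite /b1 addrC addKr normr1.
have hI p : p \in [:: x; y; b1; b0] -> inI (last a s) p.
  by rewrite !inE => /or4P[] /eqP->; rewrite ?baseI ?baseI1.
have hI' p : p \in [:: b1; b0; x; y] -> inI (last a s) p.
  by rewrite !inE => /or4P[] /eqP->; rewrite ?baseI ?baseI1.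
have := fw_dist (l := 1) ps hI (fun p q hp hq => inI_dist (hI _ hp) (hI _ hq)) xy b10.
have := fw_dist (l := 1) ps hI' (fun p q hp hq => inI_dist (hI' _ hp) (hI' _ hq)) b10 xy.
rewrite !powR1 mulr1 n1 divr1 -/(len_w a s) -/Q => h1 h2.
apply/andP; split.
  by rewrite -mulrA ler_pdivrMl ?Q_gt0 // -ler_pdivlMr // -mulrA.
by rewrite -ler_pdivrMr.
Qed.

End Words.

(** * Cylinders as nested intervals, and stopped words *)

Section Cylinders.
Context {R : realType}.
Variable F : markov_ifs R.
Implicit Types (a b e : alph F) (s t w : seq (alph F)) (x y u v l : R).
Local Notation tr := (@tr R F).

Lemma fw_between a s x y z : path tr a s -> inI (last a s) x -> inI (last a s) y ->
  inI (last a s) z -> x <= y ->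
  (Num.min (fw a s x) (fw a s y) <= fw a s z <= Num.max (fw a s x) (fw a s y)) =
  (x <= z <= y).
Proof.
move=> ps hx hy hz xy.
have lt p q : inI (last a s) p -> inI (last a s) q -> p < q ->
    0 < (-1) ^+ sgw a s * (fw a s q - fw a s p).
  move=> hp hq pq; have /andP[h _] := fw_slope ps hp hq pq; apply: lt_le_trans h.
  by rewrite mulr_gt0 ?exprn_gt0 ?cmin_gt0 ?subr_gt0.
have le p q : inI (last a s) p -> inI (last a s) q -> p <= q ->
    0 <= (-1) ^+ sgw a s * (fw a s q - fw a s p).
  move=> hp hq; rewrite le_eqVlt => /orP[/eqP->|pq]; first by rewrite subrr mulr0.
  by rewrite ltW // lt.
have xy' := le x y hx hy xy.
apply/idP/idP => [|/andP[xz zy]]; last first.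
  have := le _ _ hx hz xz; have := le _ _ hz hy zy.
  rewrite ge_min le_max.
  case: (sgw a s); rewrite ?expr1 ?expr0 ?mulN1r ?mul1r => h1 h2.
    by apply/andP; split; apply/orP; [right|left]; lra.
  by apply/andP; split; apply/orP; [left|right]; lra.
have lt1 := lt z x hz hx; have lt2 := lt y z hy hz.
rewrite ge_min le_max; rewrite !leNgt.
move: xy' lt1 lt2.
case: (sgw a s); rewrite ?expr1 ?expr0 ?mulN1r ?mul1r => xy' lt1 lt2 /andP[/orP h1 /orP h2];
  apply/andP; split; apply/negP => h;
  [have := lt1 h|have := lt2 h|have := lt1 h|have := lt2 h];
  case: h1 => /negP; rewrite ?ltNge => /negP; rewrite negbK => h1;
  case: h2 => /negP; rewrite ?ltNge => /negP; rewrite negbK => h2; lra.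
Qed.

Lemma fw_onto a s y : path tr a s ->
  Num.min (fw a s (base (last a s))) (fw a s (base (last a s) + 1)) <= y <=
    Num.max (fw a s (base (last a s))) (fw a s (base (last a s) + 1)) ->
  exists2 x, inI (last a s) x & fw a s x = y.
Proof.
elim: s a y => [|b s IH] a y.
  move=> _ /= h; exists y => //; move: h; rewrite /inI.
  by rewrite (min_idPl _) ?(max_idPr _) // lerDl.
move=> /= /andP[ab bs] h.
have b1 : path tr a [:: b] by rewrite /= ab.
have i0 := fw_in bs (baseI _); have i1 := fw_in bs (baseI1 _).
have le01 : base b <= base b + 1 by rewrite lerDl.
have B0 := fw_between b1 (baseI b) (baseI1 b) i0 le01.
have B1 := fw_between b1 (baseI b) (baseI1 b) i1 le01.
rewrite /= -/(inI b _) i0 in B0; rewrite /= -/(inI b _) i1 in B1.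
have [z zI zy] : exists2 x, base b <= x <= base b + 1 & br a b x = y.
  apply: br_onto => //; move/andP: h => [h1 h2].
  move/andP: B0 => [B01 B02]; move/andP: B1 => [B11 B12].
  apply/andP; split.
    by apply: le_trans h1; rewrite le_min B01 B11.
  by apply: le_trans h2 _; rewrite ge_max B02 B12.
have [x xI xz] : exists2 x, inI (last b s) x & fw b s x = z.
  apply: IH => //; rewrite -zy in h.
  have [le|/ltW le] := leP (fw b s (base (last b s))) (fw b s (base (last b s) + 1)).
    by have := fw_between b1 i0 i1 zI le; rewrite /= h => <-.
  by have := fw_between b1 i1 i0 zI le; rewrite /= minC maxC h => <-.
by exists x => //; rewrite xz.
Qed.

Lemma cylE a s x : path tr a s -> cyl a s x <-> lo_w a s <= x <= lo_w a s + len_w a s.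
Proof.
move=> ps; rewrite /lo_w /len_w.
set p := fw a s _; set q := fw a s _.
have -> : Num.min p q + `|p - q| = Num.max q p.
  case: (leP p q) => pq.
    by rewrite ler0_norm ?subr_le0 //; ring.
  by rewrite gtr0_norm ?subr_gt0 //; ring.
split=> [[z zI <-]|h].
  rewrite minC; rewrite (fw_between ps (baseI _) (baseI1 _) zI) ?lerDl //.
rewrite minC in h; have [z zI zx] := fw_onto ps h; by exists z.
Qed.

Lemma cyl_lo a s : path tr a s -> cyl a s (lo_w a s).
Proof. by move=> ps; apply/(cylE _ ps); rewrite lexx lerDl ltW // len_w_gt0. Qed.

Lemma cyl_dist a s x y : path tr a s -> cyl a s x -> cyl a s y -> `|x - y| <= len_w a s.
Proof.
move=> ps /(cylE _ ps)/andP[? ?] /(cylE _ ps)/andP[? ?].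
by rewrite ler_norml; apply/andP; split; lra.
Qed.

Lemma cyl_cat a s t x : path tr a (s ++ t) ->
  cyl a (s ++ t) x <-> exists2 z, cyl (last a s) t z & fw a s z = x.
Proof.
rewrite cat_path => /andP[ps pt]; split.
  move=> [z]; rewrite /= last_cat => zI <-; rewrite fw_cat.
  by exists (fw (last a s) t z) => //; exists z.
move=> [_ [z zI <-] <-]; exists z; first by rewrite /= last_cat.
by rewrite fw_cat.
Qed.

Lemma cyl_inI a s x : path tr a s -> cyl a s x -> inI a x.
Proof. by move=> ps [z zI <-]; exact: fw_in. Qed.

Lemma cyl_sub a s t : path tr a (s ++ t) -> cyl a (s ++ t) `<=` cyl a s.
Proof.
move=> pst x /(cyl_cat _ pst)[z zc <-]; move: pst; rewrite cat_path => /andP[ps pt].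
by exists z => //; exact: cyl_inI zc.
Qed.

Lemma len_cat a s t : path tr a (s ++ t) ->
  (Q F)^-1 * len_w a s * len_w (last a s) t <= len_w a (s ++ t) <=
    Q F * len_w a s * len_w (last a s) t.
Proof.
rewrite cat_path => /andP[ps pt]; rewrite [len_w a (s ++ t)]/len_w [len_w (last a s) t]/len_w last_cat !fw_cat.
by apply: fw_len => //; apply: fw_in => //; rewrite ?baseI ?baseI1.
Qed.

Lemma cyl_subset_len a s a' s' : path tr a s -> path tr a' s' ->
  cyl a s `<=` cyl a' s' -> len_w a s <= len_w a' s'.
Proof.
move=> ps ps' sub; have l0 := len_w_gt0 ps.
have h1 := sub _ (cyl_lo ps).
have /sub h2 : cyl a s (lo_w a s + len_w a s).
  by apply/(cylE _ ps); rewrite lexx lerDl ltW.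
have := cyl_dist ps' h2 h1; rewrite addrC addKr gtr0_norm //.
Qed.

Lemma len_mono a s t : path tr a (s ++ t) -> len_w a (s ++ t) <= len_w a s.
Proof.
move=> pst; have := pst; rewrite cat_path => /andP[ps _].
by apply: cyl_subset_len => //; exact: cyl_sub.
Qed.

Lemma len_le_kap a s : path tr a s -> len_w a s <= kap F ^+ size s.
Proof.
move=> ps; have /andP[_ h] := fw_le ps (baseI1 _) (baseI _).
by apply: le_trans h _; rewrite addrC addKr normr1 mulr1.
Qed.

Lemma len_ge_cmin a s : path tr a s -> cmin F ^+ size s <= len_w a s.
Proof.
move=> ps; have /andP[h _] := fw_le ps (baseI1 _) (baseI _).
by apply: le_trans h; rewrite addrC addKr normr1 mulr1.
Qed.

Lemma len_le1 a s : path tr a s -> len_w a s <= 1.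
Proof. by move=> ps; rewrite -(len_nil a); exact: (@len_mono a [::] s). Qed.

Lemma len_rcons a s b : path tr a (rcons s b) ->
  c1 F * len_w a s <= len_w a (rcons s b).
Proof.
rewrite -cats1 => ps; have /andP[h _] := len_cat ps; apply: le_trans h.
have := ps; rewrite cat_path => /andP[ps' pb].
rewrite /c1 -!mulrA [cmin F * _]mulrC ler_wpM2l ?invr_ge0 ?(ltW (Q_gt0 F)) //.
rewrite ler_wpM2l ?(ltW (len_w_gt0 ps')) // -[leLHS]expr1.
exact: (@len_ge_cmin (last a s) [:: b]).
Qed.

Lemma cyl_comparable a s a' s' x : path tr a s -> path tr a' s' ->
  cyl a s x -> cyl a' s' x -> (size s <= size s')%N ->
  a = a' /\ s = take (size s) s'.
Proof.
elim: s a a' s' x => [|b s IH] a a' s' x ps ps' cx cx' ss.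
  rewrite take0; split => //.
  by have := cyl_inI ps' cx'; have := cyl_inI ps cx; exact: base_disj.
have aa' : a = a'.
  by have := cyl_inI ps' cx'; have := cyl_inI ps cx; exact: base_disj.
case: s' ps' cx' ss => // b' s' ps' cx' /= ss; subst a'.
have [z zc zx] := proj1 (@cyl_cat a [:: b] s x ps) cx.
have [z' zc' zx'] := proj1 (@cyl_cat a [:: b'] s' x ps') cx'.
move: ps ps' => /= /andP[ab ps] /andP[ab' ps'].
have zI := cyl_inI ps zc; have zI' := cyl_inI ps' zc'.
have zz0 := etrans zx (esym zx').
have bb : b = b' by exact: (br_disj ab ab' zI zI').
subst b'; have zz : z = z'.
  apply: (@fw_inj _ F a [:: b]) => //=; first by rewrite ab.
subst z'; by have [_ <-] := IH _ _ _ _ ps ps' zc zc' ss.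
Qed.

Lemma limset_cyl a s x n : limset F x -> path tr a s -> cyl a s x -> exists t,
  [/\ (n <= size t)%N, path tr a (s ++ t) & cyl a (s ++ t) x].
Proof.
move=> xl ps cx; have [a' [s' [ns ps' cx']]] := xl (size s + n)%N.
have [aa E] := cyl_comparable ps ps' cx cx' (leq_trans (leq_addr _ _) ns).
subst a'.
exists (drop (size s) s').
have E' : s ++ drop (size s) s' = s' by rewrite {1}E cat_take_drop.
by rewrite E'; split => //; rewrite size_drop; lia.
Qed.

Lemma limset_fw a s x : path tr a s -> limset F x -> inI (last a s) x ->
  limset F (fw a s x).
Proof.
move=> ps xl xI n; have c0 : cyl (last a s) [::] x by exists x.
have [t [nt pt ct]] := limset_cyl n xl (isT : path tr (last a s) [::]) c0.
exists a, (s ++ t); rewrite size_cat cat_path ps; split => //.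
  exact: leq_trans nt (leq_addl _ _).
by apply/cyl_cat; [rewrite cat_path ps|exists x].
Qed.

(** First prefix whose cylinder has length at most [X]. Stopped words have pairwise disjoint
    cylinders of length comparable to [X], which words of a fixed number of letters do not. *)
Definition stopping (X : R) a s := [/\ path tr a s, len_w a s <= X &
  forall k, (k < size s)%N -> X < len_w a (take k s)].

Lemma stopping_ge X a s : X < 1 -> stopping X a s -> c1 F * X < len_w a s.
Proof.
move=> X1 [ps lX sX]; case/lastP: s ps lX sX => [|s b] ps lX sX.
  by move: lX; rewrite len_nil => /le_lt_trans/(_ X1); rewrite ltxx.
apply: lt_le_trans (len_rcons ps); rewrite ltr_pM2l ?c1_gt0 //.
have := sX (size s); rewrite size_rcons => /(_ (ltnSn _)).
by rewrite -cats1 take_size_cat.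
Qed.

Lemma stopping_eq X a s a' s' x : stopping X a s -> stopping X a' s' -> cyl a s x -> cyl a' s' x ->
  a = a' /\ s = s'.
Proof.
wlog ss : a s a' s' / (size s <= size s')%N.
  move=> h; case: (leqP (size s) (size s')) => [|/ltnW] ss s1 s2 c1 c2.
    exact: h.
  by have [-> ->] := h _ _ _ _ ss s2 s1 c2 c1.
move=> [ps lX sX] [ps' lX' sX'] cx cx'.
have [E1 E2] := cyl_comparable ps ps' cx cx' ss; split => //.
move: ss; rewrite leq_eqVlt => /orP[/eqP E|lt]; first by rewrite E2 E take_size.
have := sX' _ lt; rewrite -E2 -E1 => /lt_le_trans/(_ lX); by rewrite ltxx.
Qed.

Lemma stopping_exists X x a w : 0 < X -> limset F x -> path tr a w -> cyl a w x ->
  X < len_w a w -> exists t, [/\ stopping X a (w ++ t), cyl a (w ++ t) x & t != [::]].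
Proof.
move=> X0 xl pw cw Xw.
have [n hn] : exists n, kap F ^+ n < X.
  apply: exists_expr_lt => //; have := kap_gt0 F; have := kap_lt1 F; lra.
have [t [nt pt ct]] := limset_cyl n xl pw cw.
have ex : exists k, len_w a (w ++ take k t) <= X.
  exists (size t); rewrite take_size (le_trans (len_le_kap pt)) //.
  apply: le_trans (ltW hn); apply: ler_wiXn2l; first exact: ltW (kap_gt0 F).
    by have := kap_lt1 F; lra.
  by rewrite size_cat; lia.
case: (ex_minnP ex) => k hk mink.
have pk : path tr a (w ++ take k t).
  by have := pt; rewrite !cat_path => /andP[-> h] /=; exact: take_path.
exists (take k t); split.
- split => // j; case: (ltnP j (size w)) => jw.
    move=> _; rewrite takel_cat ?(ltnW jw) //.
    apply: lt_le_trans Xw _; rewrite -{1}(cat_take_drop j w).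
    by apply: len_mono; rewrite cat_take_drop.
  rewrite size_cat take_cat [(j < size w)%N]ltnNge jw /= => jk.
  rewrite ltNge take_takel //; last by move: jk; rewrite size_take; case: ifP; lia.
  apply/negP => /mink; move: jk; rewrite size_take; case: ifP; lia.
- have := pt; rewrite -{1}(cat_take_drop k t) catA => pt'.
  by apply: (cyl_sub pt'); rewrite -catA cat_take_drop.
- apply/eqP => E; move: hk; rewrite E cats0 => /(lt_le_trans Xw); by rewrite ltxx.
Qed.

(** The cylinders are nested compact intervals; the common point is the supremum of their left
    ends. *)
Lemma nested_point a (W V : nat -> seq (alph F)) :
  (forall k, W k.+1 = W k ++ V k) -> (forall k, V k != [::]) ->
  (forall k, path tr a (W k)) -> exists2 x, limset F x & forall k, cyl a (W k) x.
Proof.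
move=> WS V0 pW.
have nest k j : (k <= j)%N -> cyl a (W j) `<=` cyl a (W k).
  elim: j => [|j IH]; first by rewrite leqn0 => /eqP->.
  rewrite leq_eqVlt ltnS => /orP[/eqP->//|/IH kj].
  by apply: subset_trans kj; rewrite WS; apply: cyl_sub; rewrite -WS.
have szW k : (k <= size (W k))%N.
  elim: k => // k IH; rewrite WS size_cat; have := V0 k; case: (V k) => //= *; lia.
pose E := [set lo_w a (W k) | k in [set: nat]].
have ub k : ubound E (lo_w a (W k) + len_w a (W k)).
  move=> _ [j _ <-]; case: (leqP k j) => kj.
    by have /(cylE _ (pW k))/andP[] := nest _ _ kj _ (cyl_lo (pW j)).
  have /(cylE _ (pW j))/andP[h _] := nest _ _ (ltnW kj) _ (cyl_lo (pW k)).
  by rewrite (le_trans h) // lerDl ltW // len_w_gt0.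
have supE : has_sup E by split; [exists (lo_w a (W 0%N)); exists 0%N|exists (lo_w a (W 0%N) + len_w a (W 0%N)); exact: ub].
have cx k : cyl a (W k) (sup E).
  apply/(cylE _ (pW k))/andP; split; first by apply: ub_le_sup => //; [case: supE|exists k].
  by apply: ge_sup; [case: supE|exact: ub].
exists (sup E) => // n; exists a, (W n); split => //.
Qed.

End Cylinders.

(** * Counting cylinders *)

Section Counting.
Context {R : realType}.

Lemma card_sep (I : finType) (P : {set I}) (x : I -> R) (z L l : R) :
  0 < l -> 0 <= L -> (forall i, i \in P -> z <= x i <= z + L) ->
  (forall i j, i \in P -> j \in P -> i != j -> l <= `|x i - x j|) ->
  #|P|%:R <= L / l + 1.
Proof.
move=> l0 L0 xP sep.
pose n := Num.truncn (L / l).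
pose f i : 'I_n.+1 := inord (Num.truncn ((x i - z) / l)).
have xz i : i \in P -> 0 <= (x i - z) / l <= L / l.
  move=> /xP /andP[h1 h2]; rewrite divr_ge0 ?subr_ge0 ?(ltW l0) //=.
  by rewrite ler_pM2r ?invr_gt0 // lerBlDl.
have fE i : i \in P -> f i = Num.truncn ((x i - z) / l) :> nat.
  move=> iP; rewrite /f inordK // ltnS /n; apply: le_truncn.
  by case/andP: (xz i iP).
have finj : {in P &, injective f}.
  move=> i j iP jP ij; apply/eqP; apply: contraT => nij.
  have := sep i j iP jP nij; have := congr1 (@nat_of_ord _) ij; rewrite !fE // => E.
  have /andP[hi _] := xz i iP; have /andP[hj _] := xz j jP.
  have /andP[a1 a2] := truncn_itv hi; have /andP[b1 b2] := truncn_itv hj.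
  rewrite E in a1 a2.
  have : `|(x i - z) / l - (x j - z) / l| < 1.
    by rewrite ltr_norml -!natr1 in a2 b2 *; apply/andP; split; lra.
  rewrite -mulrBl normrM (ger0_norm (_ : 0 <= l^-1)) ?invr_ge0 ?(ltW l0) //.
  rewrite ltr_pdivrMr // mul1r (_ : x i - z - (x j - z) = x i - x j); last by ring.
  by move=> h1 h2; have := le_lt_trans h2 h1; rewrite ltxx.
rewrite -(card_in_imset finj).
have : (#|f @: P| <= n.+1)%N by rewrite -[X in (_ <= X)%N]card_ord max_card.
rewrite -(ler_nat R) => h; apply: le_trans h _; rewrite -natr1 lerD2r.
by have /andP[] := truncn_itv (divr_ge0 L0 (ltW l0)).
Qed.

Lemma sum_nat_card (n : nat) (b : nat -> bool) :
  (\sum_(0 <= i < n) b i)%N = #|[set i : 'I_n | b i]%SET|.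
Proof.
rewrite big_mkord -sum1_card [RHS]big_mkcond /=.
by apply: eq_bigr => i _; rewrite inE; case: (b i).
Qed.

Variable F : markov_ifs R.
Local Notation tr := (@tr R F).

Lemma card_cyl (I : finType) (P : {set I}) a (E : I -> seq (alph F)) (z D l : R) :
  0 < l -> 0 <= D -> (forall i, i \in P -> path tr a (E i) /\ l <= len_w a (E i)) ->
  (forall i j x, i \in P -> j \in P -> cyl a (E i) x -> cyl a (E j) x -> i = j) ->
  (forall i, i \in P -> exists2 x, cyl a (E i) x & z <= x <= z + D) ->
  #|P|%:R <= D / l + 2.
Proof.
move=> l0 D0 pE dE mE.
(* The left end is cut at [z - l], so that a cylinder sticking out to the left still contains
   [[x i, x i + l]] with [x i] in [[z - l, z + D]]. Disjointness then separates the points [x i] by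
   [l]. *)
pose x i := Num.max (lo_w a (E i)) (z - l).
have xc i : i \in P -> cyl a (E i) (x i) /\ cyl a (E i) (x i + l).
  move=> iP; have [pi li] := pE i iP.
  have [y /(cylE _ pi)/andP[y1 y2] /andP[zy yz]] := mE i iP.
  split; apply/(cylE _ pi); rewrite /x; case: (leP (lo_w a (E i)) (z - l)) => h; apply/andP; split; lra.
have -> : D / l + 2 = (D + l) / l + 1 by rewrite mulrDl divff ?gt_eqF //; ring.
apply: (@card_sep _ P x (z - l)) => //; first by rewrite addr_ge0 // ltW.
  move=> i iP; have [pi li] := pE i iP; rewrite /x le_max lexx orbT /=.
  have [y /(cylE _ pi)/andP[y1 y2] /andP[zy yz]] := mE i iP.
  by case: (leP (lo_w a (E i)) (z - l)) => h; lra.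
have lt i j : i \in P -> j \in P -> i != j -> x i <= x j -> l <= x j - x i.
  move=> iP jP ij xij; rewrite leNgt; apply/negP => h.
  have [c1 c2] := xc i iP; have [c3 _] := xc j jP; have [pi _] := pE i iP.
  move/eqP: ij; apply; apply: (dE i j (x j)) => //.
  move/(cylE _ pi)/andP: c1 => [? ?]; move/(cylE _ pi)/andP: c2 => [? ?].
  by apply/(cylE _ pi)/andP; split; lra.
move=> i j iP jP ij; have [le|/ltW le] := leP (x i) (x j).
  by rewrite distrC ger0_norm ?subr_ge0 // lt.
by rewrite ger0_norm ?subr_ge0 // lt // eq_sym.
Qed.

Definition connector (a b : alph F) : seq (alph F) := sval (cid (connectable a b)).

Lemma connectorP a b : [/\ path tr a (connector a b), last a (connector a b) = b & connector a b != [::]].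
Proof. by rewrite /connector; case: (cid _). Qed.

Definition connector_bound : nat := \max_(p : alph F * alph F) size (connector p.1 p.2).

Lemma connector_size a b : (size (connector a b) <= connector_bound)%N.
Proof. exact: (@leq_bigmax _ (fun p : alph F * alph F => size (connector p.1 p.2)) (a, b)). Qed.

Definition connector_slope : R := cmin F ^+ connector_bound.

Lemma connector_slope_gt0 : 0 < connector_slope. Proof. by rewrite exprn_gt0 // cmin_gt0. Qed.

Lemma connector_slope_le1 : connector_slope <= 1.
Proof. by rewrite exprn_ile1 ?ltW ?cmin_gt0 ?cmin_lt1. Qed.

Lemma connector_slope_le a b x y : inI b x -> inI b y ->
  connector_slope * `|x - y| <= `|fw a (connector a b) x - fw a (connector a b) y|.
Proof.
have [pc lc _] := connectorP a b => hx hy.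
have := @fw_le _ F a (connector a b) x y pc; rewrite lc => /(_ hx hy)/andP[h _].
apply: le_trans h; rewrite ler_wpM2r //; apply: ler_wiXn2l => //.
- by rewrite ltW // cmin_gt0.
- by rewrite ltW // cmin_lt1.
- exact: connector_size.
Qed.

Lemma le_sum_term (I : finType) (f : I -> R) (a : I) : (forall i, 0 <= f i) ->
  f a <= \sum_i f i.
Proof. by move=> f0; rewrite (bigD1 a) //= lerDl sumr_ge0. Qed.

Lemma limset_bounded : exists m M, forall x, limset F x -> m <= x <= M.
Proof.
pose M := \sum_a (`|base (m := F) a| + 1).
have leM a : `|base (m := F) a| + 1 <= M.
  by apply: (@le_sum_term _ (fun a => `|base a| + 1)) => b; rewrite addr_ge0.
exists (- M), M => x /(_ 0%N)[a [s [_ ps /(cyl_inI ps)]]].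
rewrite /inI => /andP[h1 h2]; have := leM a; have := ler_norm (base a); have := ler_norm (- base a).
by rewrite normrN => *; apply/andP; split; lra.
Qed.

(** If [P] were too large, concatenating its words freely, each followed by a connector back to [e],
    would give a full tree with [#|P|] children per vertex inside the limit set, shrinking at most
    by [r] per level; the tree bound would then make the dimension at least [s]. *)
Lemma card_words_up1 (s : R) : HD (limset F) < s ->
  forall e z (I : finType) (P : {set I}) (E : I -> seq (alph F)) (eta : R),
  0 < eta <= 1 ->
  (forall i, i \in P -> [/\ path tr e (E i), last e (E i) = z & eta <= len_w e (E i)]) ->
  (forall i j x, i \in P -> j \in P -> cyl e (E i) x -> cyl e (E j) x -> i = j) ->
  #|P|%:R * (c1 F * eta * connector_slope) `^ s < 4.
Proof.
move=> HDs e z I P E eta /andP[eta0 eta1] pE dE.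
have s0 : 0 < s by apply: le_lt_trans HDs; exact: HD_ge0.
rewrite ltNge; apply/negP => big.
set r := c1 F * eta * connector_slope in big.
have r0 : 0 < r by rewrite /r mulr_gt0 ?connector_slope_gt0 // mulr_gt0 ?c1_gt0.
have r1 : r < 1.
  apply: le_lt_trans (c1_lt1 F); rewrite /r -mulrA ler_piMr ?(ltW (c1_gt0 F)) //.
  by rewrite mulr_ile1 ?(ltW eta0) ?(ltW connector_slope_gt0) ?connector_slope_le1.
have N0 : (0 < #|P|)%N.
  by rewrite lt0n; apply/eqP => P0; move: big; rewrite P0 mul0r; lra.
have [i0 i0P] : exists i, i \in P by apply/set0Pn; rewrite -card_gt0.
have [kp lk kn] := connectorP z e.
pose tau i := E (nth i0 (enum P) i) ++ connector z e.
pose child (t : seq (alph F)) i := t ++ tau i.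
have nP i : (i < #|P|)%N -> nth i0 (enum P) i \in P.
  by move=> iP; rewrite -mem_enum mem_nth // -cardE.
have ptau i : (i < #|P|)%N -> path tr e (tau i) /\ last e (tau i) = e.
  move=> /nP iP; have [p1 l1 _] := pE _ iP.
  by rewrite /tau cat_path last_cat p1 l1 kp lk.
pose Inv k t := [/\ path tr e t, last e t = e &
  forall u v, inI e u -> inI e v -> r ^+ k * `|u - v| <= `|fw e t u - fw e t v|].
have Ic k t i : Inv k t -> (i < #|P|)%N -> Inv k.+1 (child t i).
  move=> [pt lt sl] iN; have [p1 l1] := ptau i iN.
  have [p2 l2 eta2] := pE _ (nP i iN).
  rewrite /child; split; [by rewrite cat_path pt lt p1|by rewrite last_cat lt l1|].
  move=> u v uI vI; rewrite (fw_cat e t (tau i) u) (fw_cat e t (tau i) v) lt.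
  have uz : inI z (fw z (connector z e) u) by apply: fw_in; rewrite ?lk.
  have vz : inI z (fw z (connector z e) v) by apply: fw_in; rewrite ?lk.
  have uz' : inI e (fw e (tau i) u) by apply: fw_in; rewrite ?l1.
  have vz' : inI e (fw e (tau i) v) by apply: fw_in; rewrite ?l1.
  apply: le_trans (sl _ _ uz' vz').
  rewrite exprSr -mulrA ler_wpM2l ?exprn_ge0 ?(ltW r0) //.
  rewrite /tau !fw_cat l2.
  have := @fw_len _ F e _ (fw z (connector z e) u) (fw z (connector z e) v) p2.
  rewrite l2 => /(_ uz vz)/andP[h _]; apply: le_trans h.
  apply: (@le_trans _ _ ((Q F)^-1 * eta * (connector_slope * `|u - v|))).
    rewrite /r /c1 !mulrA ler_wpM2r // ler_wpM2r ?(ltW connector_slope_gt0) // ler_wpM2r ?(ltW eta0) //.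
    by rewrite ler_piMr ?invr_ge0 ?(ltW (Q_gt0 F)) // ltW // cmin_lt1.
  apply: ler_pM; rewrite ?mulr_ge0 ?invr_ge0 ?(ltW (Q_gt0 F)) ?(ltW eta0) ?(ltW connector_slope_gt0) //.
    by rewrite ler_wpM2l ?invr_ge0 ?(ltW (Q_gt0 F)).
  exact: connector_slope_le.
suff : s <= HD (limset F) by rewrite leNgt HDs.
apply: (@tree_HD_ge R _ child #|P| (cyl e) Inv _ _ 4 r 1 _ _ _ _ [::]) => //.
- move=> k t i [pt lt sl] iN; have [p1 l1] := ptau i iN.
  by apply: cyl_sub; rewrite cat_path pt lt p1.
- by rewrite r0 r1.
- move=> k t U [pt lt sl] dU.
  pose H := [set i : 'I_#|P| | hit (cyl e) U (child t i)]%SET.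
  rewrite sum_nat_card -/H.
  case: (set_0Vmem H) => [->|[j jH]]; first by rewrite cards0.
  have [x0 [_ Ux0]] : cyl e (child t j) `&` U !=set0 by move: jH; rewrite inE => /asboolP.
  rewrite -(ler_nat R); rewrite mul1r in dU; set d := r ^+ k.+1 in dU.
  have d0 : 0 < d by rewrite exprn_gt0.
  (* Origin of the 4: a set of gauge [d] lies in an interval of length [2 * d], which meets at most
     [2 * d / d + 2] disjoint cylinders of length at least [d]. *)
  apply: (@le_trans _ _ (2 * d / d + 2)); last by rewrite mulfK ?gt_eqF // -natrD.
  have pch i : (i < #|P|)%N -> path tr e (child t i).
    by move=> iN; have [p1 l1] := ptau i iN; rewrite cat_path pt lt p1.
  apply: (@card_cyl _ H e (fun i => child t i) (x0 - d)) => //.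
  + by rewrite mulr_ge0 // ltW.
  + move=> i _; have iN := ltn_ord i; split; first exact: pch.
    have [_ lc sc] := Ic _ _ _ (And3 pt lt sl) iN.
    rewrite /len_w lc; apply: le_trans (sc _ _ (baseI1 _) (baseI _)).
    by rewrite addrC addKr normr1 mulr1.
  + move=> i i' x _ _ ci ci'; apply/val_inj/eqP.
    have szi (j' : 'I_#|P|) : (j' < size (enum P))%N by rewrite -cardE.
    rewrite -(nth_uniq i0 (szi i) (szi i') (enum_uniq (mem P))); apply/eqP.
    have [p1 l1 _] := pE _ (nP _ (ltn_ord i)); have [p2 l2 _] := pE _ (nP _ (ltn_ord i')).
    have sub j' w : (j' < #|P|)%N -> cyl e (child t j') w ->
        exists2 y, cyl e (E (nth i0 (enum P) j')) y & fw e t y = w.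
      move=> jN cj; have := pch j' jN; rewrite /child /tau catA => pc.
      have := cyl_sub pc; rewrite /child /tau catA in cj => /(_ _ cj).
      by move: pc; rewrite cat_path => /andP[pc _] /(cyl_cat _ pc); rewrite lt.
    have [y cy yx] := sub _ _ (ltn_ord i) ci; have [y' cy' yx'] := sub _ _ (ltn_ord i') ci'.
    have yy : y = y'.
      apply: (@fw_inj _ F e t) => //; rewrite ?lt ?yx //.
      - exact: cyl_inI cy.
      - exact: cyl_inI cy'.
    subst y'; exact: (dE _ _ y (nP _ (ltn_ord i)) (nP _ (ltn_ord i')) cy cy').
  + move=> i; rewrite inE => /asboolP[x [cx Ux]]; exists x => //.
    by have := dU _ _ Ux Ux0; rewrite ler_norml => /andP[? ?]; apply/andP; split; lra.
- by split => // u v _ _; rewrite expr0 mul1r.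
- move=> io ioN.
  have Iw k : Inv k (walk child [::] io k).
    by elim: k => [|k IH] /=; [split => // u v _ _; rewrite expr0 mul1r|exact: Ic].
  apply: (@nested_point _ F e (walk child [::] io) (fun k => tau (io k))) => //.
  - move=> k; rewrite /tau; move: kn; case: (connector z e) => // b c _.
    by case: (E _).
  - by move=> k; case: (Iw k).
- exact: limset_bounded.
Qed.

End Counting.

(** * Upper bounds for the number of disjoint cylinders *)

Section UpperCount.
Context {R : realType}.
Variable F : markov_ifs R.
Local Notation tr := (@tr R F).

Lemma card_fibres (I J : finType) (P : {set I}) (f : I -> J) :
  #|P| = (\sum_(z : J) #|[set i in P | f i == z]%SET|)%N.
Proof.
rewrite -sum1_card (partition_big f predT) //=; apply: eq_bigr => z _.
by rewrite -sum1_card; apply: eq_bigl => i; rewrite inE.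
Qed.

(** Words are sorted by their last letter, which determines the connector closing them up. *)
Lemma card_words_up (s : R) : HD (limset F) < s -> exists2 C, 1 <= C &
  forall e (I : finType) (P : {set I}) (E : I -> seq (alph F)) (eta : R),
  0 < eta <= 1 ->
  (forall i, i \in P -> path tr e (E i) /\ eta <= len_w e (E i)) ->
  (forall i j x, i \in P -> j \in P -> cyl e (E i) x -> cyl e (E j) x -> i = j) ->
  #|P|%:R <= C * eta `^ (- s).
Proof.
move=> HDs; pose r1 := c1 F * connector_slope F.
have r10 : 0 < r1 by rewrite mulr_gt0 ?c1_gt0 ?connector_slope_gt0.
pose C := 4 * r1 `^ (- s) * #|alph F|%:R.
exists (Num.max 1 C); first by rewrite le_max lexx.
move=> e I P E eta eta01 pE dE; have eta0 : 0 < eta by case/andP: eta01.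
apply: (@le_trans _ _ (C * eta `^ (- s))); last first.
  by rewrite ler_wpM2r ?powR_ge0 // le_max lexx orbT.
rewrite (card_fibres P (fun i => last e (E i))) natr_sum.
have -> : C * eta `^ (- s) = \sum_(z : alph F) 4 * (r1 * eta) `^ (- s).
  rewrite sumr_const -mulr_natr powRM ?(ltW r10) ?(ltW eta0) // /C; ring.
apply: ler_sum => z _; set Pz := finset _.
have := @card_words_up1 _ F s HDs e z I Pz E eta eta01.
have -> : c1 F * eta * connector_slope F = r1 * eta by rewrite /r1; ring.
have re0 : 0 < (r1 * eta) `^ s by rewrite powR_gt0 // mulr_gt0.
rewrite powRN ler_pdivlMr // => h; apply/ltW/h.
  by move=> i; rewrite inE => /andP[iP /eqP->]; have [] := pE i iP.
by move=> i j x; rewrite !inE => /andP[iP _] /andP[jP _]; exact: dE.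
Qed.

(** The global count applied inside the cylinder of [w]; bounded distortion costs a power of
    [Q F]. *)
Lemma card_ext_up (s : R) : HD (limset F) < s -> exists2 C, 1 <= C &
  forall a w (I : finType) (P : {set I}) (E : I -> seq (alph F)) (eta : R),
  0 < eta <= 1 ->
  (forall i, i \in P -> path tr a (w ++ E i) /\
    eta * len_w a w <= len_w a (w ++ E i)) ->
  (forall i j x, i \in P -> j \in P -> cyl a (w ++ E i) x -> cyl a (w ++ E j) x ->
     i = j) ->
  #|P|%:R <= C * eta `^ (- s).
Proof.
move=> HDs; have [C C1 HC] := card_words_up HDs.
have s0 : 0 < s by apply: le_lt_trans HDs; exact: HD_ge0.
exists (C * Q F `^ s).
  rewrite mulr_ege1 // -(powRr0 (Q F)); apply: ler_powR; [exact: Q_ge1|exact: ltW].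
move=> a w I P E eta /andP[eta0 eta1] pE dE.
have Qi : (Q F)^-1 `^ (- s) = Q F `^ s.
  by rewrite -powR_inv1 ?(ltW (Q_gt0 F)) // -powRrM mulrNN mul1r.
have qp : 0 < (Q F)^-1 by rewrite invr_gt0 Q_gt0.
have q0 := ltW qp.
rewrite -Qi -mulrA -powRM ?(ltW eta0) //.
apply: (HC (last a w)).
- rewrite mulr_gt0 //= mulr_ile1 ?(ltW eta0) //.
  by rewrite invf_le1 ?Q_gt0 ?Q_ge1.
- move=> i iP; have [pi li] := pE i iP.
  have /andP[_ h] := len_cat pi; move: pi; rewrite cat_path => /andP[pw pi].
  have lw := len_w_gt0 pw; split; first exact: pi.
  rewrite mulrC ler_pdivrMr ?Q_gt0 // -(ler_pM2r lw) (le_trans li) //.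
  by rewrite (le_trans h) // le_eqVlt; apply/orP; left; apply/eqP; ring.
- move=> i j x iP jP ci cj; have [pi _] := pE i iP; have [pj _] := pE j jP.
  apply: (dE i j (fw a w x)) => //.
  + by apply/(cyl_cat _ pi); exists x.
  + by apply/(cyl_cat _ pj); exists x.
Qed.

(** An interval need not be a cylinder. Each word is cut at its first prefix of length at most [L];
    these prefixes have length at least [c1 F * L], so boundedly many of them meet the interval, and
    [card_ext_up] counts the words below each. *)
Lemma card_itv_up (s : R) : HD (limset F) < s -> exists2 C, 1 <= C &
  forall a (I : finType) (P : {set I}) (E : I -> seq (alph F)) (eta z L : R),
  0 < eta <= L ->
  (forall i, i \in P -> path tr a (E i) /\ eta <= len_w a (E i)) ->
  (forall i j x, i \in P -> j \in P -> cyl a (E i) x -> cyl a (E j) x -> i = j) ->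
  (forall i, i \in P -> exists2 x, cyl a (E i) x & z <= x <= z + L) ->
  #|P|%:R <= C * (L / eta) `^ s.
Proof.
move=> HDs; have [C C1 HC] := card_ext_up HDs.
have s0 : 0 < s by apply: le_lt_trans HDs; exact: HD_ge0.
have c1p := c1_gt0 F.
pose B := (c1 F)^-1 + 2.
have ci0 : 0 < (c1 F)^-1 by rewrite invr_gt0.
have B1 : 1 <= B by rewrite /B; lra.
exists (B * C); first by rewrite mulr_ege1.
move=> a I P E eta z L /andP[eta0 etaL] pE dE mE.
have L0 : 0 < L by exact: lt_le_trans etaL.
have C0 : 0 <= C by exact: le_trans C1.
have flip : (eta / L) `^ (- s) = (L / eta) `^ s.
  rewrite -[eta / L]invf_div -(@powR_inv1 _ (L / eta)).
    by rewrite -powRrM mulrNN mul1r.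
  by rewrite divr_ge0 ?(ltW eta0) ?(ltW L0).
have X1 : 1 <= (L / eta) `^ s.
  rewrite -(powRr0 (L / eta)); apply: ler_powR; last exact: ltW.
  by rewrite ler_pdivlMr // mul1r.
(* For [L >= 1] the count in the whole of one base interval already suffices. *)
have [L1|L1] := leP 1 L.
  case: (set_0Vmem P) => [->|[i0 i0P]].
    by rewrite cards0 mulr_ge0 ?powR_ge0 // mulr_ge0 // (le_trans _ B1).
  have [p0 l0] := pE _ i0P.
  have eta1 : eta <= 1 by apply: le_trans l0 (len_le1 p0).
  apply: (@le_trans _ _ (C * eta `^ (- s))).
    apply: (HC a [::] _ _ E); rewrite ?eta0 // => i /pE[pi li].
    by rewrite len_nil mulr1.
  apply: ler_pM; rewrite ?powR_ge0 //; first by rewrite ler_peMl.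
  have inv : (eta^-1) `^ s = eta `^ (- s).
    by rewrite -(@powR_inv1 _ eta) ?(ltW eta0) // -powRrM mulN1r.
  rewrite powRM ?(ltW L0) ?invr_ge0 ?(ltW eta0) // inv ler_peMl ?powR_ge0 //.
  rewrite -(powRr0 L); apply: ler_powR => //; exact: ltW.
(* The cut is at [size e] when no proper prefix is short; if even the full word is longer than [L],
   it is alone above its prefix. *)
have pf (e : seq (alph F)) : exists k, [/\ (k <= size e)%N,
    len_w a (take k e) <= L \/ k = size e &
    forall j, (j < k)%N -> L < len_w a (take j e)].
  have ex : exists k, (len_w a (take k e) <= L) || (size e <= k)%N.
    by exists (size e); rewrite leqnn orbT.
  case: (ex_minnP ex) => k hk mink.
  have ks : (k <= size e)%N by apply: mink; rewrite leqnn orbT.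
  exists k; split => //.
    by case/orP: hk => h; [left|right; apply/eqP; rewrite eqn_leq ks].
  move=> j jk; rewrite ltNge; apply/negP => h; have kj : (k <= j)%N by apply: mink; rewrite h.
  by rewrite leqNgt jk in kj.
have [kf Hk] := choice pf.
pose p i := take (kf (E i)) (E i).
have szp i : size (p i) = kf (E i).
  by rewrite size_takel //; case: (Hk (E i)).
have pp i : i \in P -> path tr a (p i) by move=> /pE[pi _]; exact: take_path.
have pc i : i \in P -> cyl a (E i) `<=` cyl a (p i).
  move=> /pE[pi _]; rewrite -{1}(cat_take_drop (kf (E i)) (E i)).
  by apply: cyl_sub; rewrite cat_take_drop.
have lenp i : i \in P -> c1 F * L <= len_w a (p i).
  move=> iP; have [k1 k2 k3] := Hk (E i); have ppi := pp i iP.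
  case kE : (kf (E i)) k1 k2 k3 => [|k] k1 _ k3.
    rewrite /p kE take0 len_nil mulr_ile1 ?(ltW c1p) ?(ltW L0) ?(ltW L1) //.
    by rewrite ltW // c1_lt1.
  have [b Eb] : exists b, p i = rcons (take k (E i)) b.
    by exists (nth a (E i) k); rewrite /p kE -take_nth.
  have := pp i iP; rewrite Eb => /len_rcons; apply: le_trans.
  by rewrite ler_wpM2l ?(ltW c1p) // ltW // k3.
have pdis i j x : i \in P -> j \in P -> cyl a (p i) x -> cyl a (p j) x -> p i = p j.
  wlog sij : i j / (size (p i) <= size (p j))%N.
    move=> h iP jP ci cj; case: (leqP (size (p i)) (size (p j))) => [|/ltnW] ss.
      exact: h.
    by apply/esym; exact: h.
  move=> iP jP ci cj; have [_ Epi] := cyl_comparable (pp i iP) (pp j jP) ci cj sij.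
  move: sij; rewrite leq_eqVlt => /orP[/eqP E1|lt]; first by rewrite Epi E1 take_size.
  have [_ _ k3] := Hk (E j); have [_ k2 _] := Hk (E i).
  have Epi' : p i = take (size (p i)) (E j).
    have lt' : (size (p i) <= kf (E j))%N by rewrite -(szp j) ltnW.
    by rewrite -(take_takel (E j) lt').
  have := k3 (size (p i)); rewrite -szp => /(_ lt); rewrite -Epi' => big.
  case: k2 => [|k2]; first by rewrite leNgt big.
  have pE' : p i = E i by rewrite /p k2 take_size.
  have [pj _] := pE j jP.
  suff -> : i = j by [].
  apply: (dE i j (lo_w a (E j))) => //; last exact: cyl_lo.
  rewrite -pE' Epi'; apply: (@cyl_sub _ _ a _ (drop (size (p i)) (E j))).
    by rewrite cat_take_drop.
  by rewrite cat_take_drop; exact: cyl_lo.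
have fib i0 : i0 \in P -> #|[set i in P | p i == p i0]%SET|%:R <= C * (L / eta) `^ s.
  move=> i0P; set Pf := finset _.
  have PfP i : i \in Pf -> i \in P /\ p i = p i0 by rewrite inE => /andP[? /eqP].
  have [le|lt] := leP (len_w a (p i0)) L.
    rewrite -flip; apply: (HC a (p i0) _ _ (fun i => drop (kf (E i)) (E i))).
    - by rewrite divr_gt0 //= ler_pdivrMr // mul1r.
    - move=> i /PfP[iP Ei]; rewrite -Ei cat_take_drop; have [pi li] := pE i iP; split => //.
      apply: le_trans li; rewrite -mulrA ler_piMr ?(ltW eta0) //.
      by rewrite mulrC ler_pdivrMr // mul1r Ei.
    - by move=> i j x /PfP[iP Ei] /PfP[jP Ej]; rewrite -{1}Ei -Ej !cat_take_drop; exact: dE.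
  apply: (@le_trans _ _ 1); last by rewrite mulr_ege1.
  rewrite lern1; apply/card_le1_eqP => i j /PfP[iP pi] /PfP[jP pj].
  have full k : k \in P -> p k = p i0 -> E k = p i0.
    move=> kP pk; have [_ k2 _] := Hk (E k); case: k2; first by rewrite -/(p k) pk leNgt lt.
    by move=> k2; rewrite -pk /p k2 take_size.
  have [pEi _] := pE i iP.
  apply: (dE j i (lo_w a (E i))) => //; last exact: cyl_lo.
  by rewrite (full j) // -(full i iP pi); exact: cyl_lo.
(* A canonical representative of the words with the same prefix, so that distinct prefixes can be
   counted through indices. *)
pose r i := odflt i [pick i' in P | p i' == p i].
have rP i : i \in P -> r i \in P /\ p (r i) = p i.
  move=> iP; rewrite /r; case: pickP => [i' /andP[? /eqP]|/(_ i)] //=; rewrite iP eqxx.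
have rr i j : i \in P -> j \in P -> p i = p j -> r i = r j.
  move=> iP jP ij; rewrite /r ij; case: pickP => [i' //|/(_ j)] /=.
  by rewrite jP eqxx.
pose J := r @: P.
have -> : #|P| = (\sum_(j in J) #|[set i in P | r i == j]%SET|)%N.
  rewrite (card_fibres P r) [RHS]big_mkcond /=; apply: eq_bigr => j _.
  case: ifPn => // jJ; apply/eqP; rewrite cards_eq0; apply/eqP/setP => i; rewrite !inE.
  apply/negP => /andP[iP /eqP ij]; move/negP: jJ; apply.
  by rewrite -ij; exact: imset_f.
have JP j : j \in J -> exists2 i, i \in P & j = r i by move=> /imsetP.
have cardJ : #|J|%:R <= B.
  have -> : B = L / (c1 F * L) + 2 by rewrite /B; field; rewrite !gt_eqF.
  have cL : 0 < c1 F * L by apply: mulr_gt0.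
  apply: (@card_cyl _ F _ J a p z) => //; first exact: ltW.
  - by move=> j /JP[i iP ->]; have [? ?] := rP i iP; split; [exact: pp|exact: lenp].
  - move=> j j' x /JP[i iP ->] /JP[i' iP' ->] c1 c2.
    have [h1 h2] := rP i iP; have [h3 h4] := rP i' iP'.
    by apply: rr => //; rewrite -h2 -h4; exact: (pdis _ _ x).
  - move=> j /JP[i iP ->]; have [h1 h2] := rP i iP.
    by have [x cx zx] := mE _ h1; exists x => //; exact: pc cx.
rewrite natr_sum; apply: (@le_trans _ _ (\sum_(j in J) C * (L / eta) `^ s)).
  apply: ler_sum => j /JP[i iP ->]; have [h1 h2] := rP i iP.
  apply: le_trans (fib _ h1); rewrite ler_nat; apply: subset_leq_card.
  apply/fintype.subsetP => k; rewrite !inE => /andP[kP /eqP rk]; rewrite kP /=.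
  by have [_ <-] := rP k kP; rewrite rk.
rewrite sumr_const -[leLHS]mulr_natr -[B * C * _]mulrA [leRHS]mulrC.
by rewrite ler_wpM2l // mulr_ge0 ?powR_ge0.
Qed.

End UpperCount.

(** * Lower bounds for the number of cylinders *)

Section LowerCount.
Context {R : realType}.
Variable F : markov_ifs R.
Local Notation tr := (@tr R F).

(** A cheap cover of the limit set inside one cylinder would spread to the whole limit set: every
    base interval is mapped into that cylinder by a connector with controlled slope, and the cover
    is pulled back. *)
Lemma words_low (s : R) : 0 <= s < HD (limset F) -> exists c eta0,
  [/\ 0 < c, 0 < eta0 &
  forall a w (X : R) (M : nat) (E : nat -> seq (alph F)),
    path tr a w -> 0 < X -> X / len_w a w <= eta0 ->
    (forall i, (i < M)%N -> path tr a (E i) /\ len_w a (E i) <= X) ->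
    (forall x, limset F x -> cyl a w x -> exists2 i, (i < M)%N & cyl a (E i) x) ->
    c * (len_w a w / X) `^ s <= M%:R].
Proof.
move=> /andP[s0 sHD].
(* Contrapositive of [null_of_covers]: since [s] is below the dimension, finite covers of a common
   small gauge cannot be arbitrarily cheap. *)
have [e [d0 [e0 d00 He]]] : exists e d0 : R, [/\ 0 < e, 0 < d0 &
    forall (M : nat) (U : nat -> set R) (d : R),
    0 < d <= d0 -> limset F `<=` [set x | exists2 i, (i < M)%N & U i x] ->
    (forall i x y, (i < M)%N -> U i x -> U i y -> `|x - y| <= d) ->
    e < M%:R * d `^ s].
  apply: contrapT => no; suff H0 : hausdorff_measure s (limset F) = 0%E.
    by have := HD_le s0 H0; rewrite leNgt sHD.
  apply: null_of_covers => // e d0 e0 d00; apply: contrapT => nc; apply: no.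
  exists e, d0; split => // M U d d1 cov dia; rewrite ltNge; apply/negP => le.
  by apply: nc; exists M, U, d.
pose k := Q F / connector_slope F.
have k0 : 0 < k by rewrite divr_gt0 ?Q_gt0 ?connector_slope_gt0.
pose A := #|alph F|.
exists (e / (A.+1%:R * k `^ s)), (d0 / k); split.
- by rewrite divr_gt0 // mulr_gt0 ?powR_gt0.
- by rewrite divr_gt0.
move=> a w X M E pw X0 Xl pE cE.
have l0 := len_w_gt0 pw.
pose d := X / len_w a w * k.
have dd : 0 < d <= d0.
  have dp : 0 < d by apply: mulr_gt0 => //; exact: divr_gt0.
  by rewrite dp /= /d -ler_pdivlMr.
pose pfx b := w ++ connector (last a w) b.
have ppfx b : path tr a (pfx b) /\ last a (pfx b) = b.
  by have [p1 p2 _] := connectorP (last a w) b; rewrite cat_path last_cat pw p1 p2.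
(* The index encodes a pair: the base letter is numbered [j %/ M] and the covering word [j %% M]. *)
pose U j := [set x | let b := nth a (enum (alph F)) (j %/ M) in
  inI b x /\ cyl a (E (j %% M)%N) (fw a (pfx b) x)].
have slope b x y : inI b x -> inI b y ->
    (Q F)^-1 * len_w a w * (connector_slope F * `|x - y|) <= `|fw a (pfx b) x - fw a (pfx b) y|.
  move=> xb yb; have [p1 p2 _] := connectorP (last a w) b; rewrite !fw_cat.
  have x' : inI (last a w) (fw (last a w) (connector (last a w) b) x) by apply: fw_in; rewrite ?p2.
  have y' : inI (last a w) (fw (last a w) (connector (last a w) b) y) by apply: fw_in; rewrite ?p2.
  have /andP[h _] := fw_len pw x' y'; apply: le_trans h.
  rewrite ler_wpM2l ?mulr_ge0 ?invr_ge0 ?(ltW l0) ?(ltW (Q_gt0 F)) //.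
  exact: connector_slope_le.
have covU : limset F `<=` [set x | exists2 i, (i < A * M)%N & U i x].
  move=> x xl; have [b [s' [_ ps' cs']]] := xl 0%N; have xb := cyl_inI ps' cs'.
  have [pb lb] := ppfx b.
  have xl' : limset F (fw a (pfx b) x) by apply: limset_fw; rewrite ?lb.
  have [|i iM ci] := cE _ xl'.
    apply: (@cyl_sub _ _ a w (connector (last a w) b)) => //; exists x => //=.
    by rewrite lb.
  exists (index b (enum (alph F)) * M + i)%N.
    apply: (@leq_trans ((index b (enum (alph F))).+1 * M)%N); first by rewrite mulSn addnC ltn_add2r.
    by rewrite leq_mul2r /A cardE index_mem mem_enum orbT.
  have M0 : (0 < M)%N by exact: leq_ltn_trans iM.
  rewrite /U /= divnMDl // (divn_small iM) addn0 modnMDl (modn_small iM).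
  by rewrite nth_index ?mem_enum.
have diaU i x y : (i < A * M)%N -> U i x -> U i y -> `|x - y| <= d.
  move: i => j jAM [xb cx] [yb cy].
  have M0 : (0 < M)%N by rewrite lt0n; apply: contraTneq jAM => ->; rewrite muln0.
  have [pe le] := pE _ (ltn_pmod j M0).
  have h1 := le_trans (cyl_dist pe cx cy) le.
  have h2 := le_trans (slope _ _ _ xb yb) h1.
  have c0 := connector_slope_gt0 F; have q0 := Q_gt0 F.
  have g0 : 0 < (Q F)^-1 * len_w a w * connector_slope F by rewrite !mulr_gt0 ?invr_gt0.
  rewrite mulrA -ler_pdivlMl // in h2.
  apply: le_trans h2 _; rewrite le_eqVlt; apply/orP; left; apply/eqP.
  by rewrite /d /k; field; rewrite !gt_eqF.
have := He (A * M)%N U d dd covU diaU.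
have -> : (len_w a w / X) `^ s = ((X / len_w a w) `^ s)^-1.
  by rewrite -powRN -invf_div -(@powR_inv1 _ (X / len_w a w)) ?divr_ge0 ?(ltW l0) ?(ltW X0) // -powRrM mulN1r.
have xl0 : 0 <= X / len_w a w by rewrite divr_ge0 ?(ltW l0) ?(ltW X0).
rewrite /d (powRM _ xl0 (ltW k0)) => h.
have t0 : 0 < (X / len_w a w) `^ s by rewrite powR_gt0 // divr_gt0.
have k1 : 0 < k `^ s by rewrite powR_gt0.
rewrite ler_pdivrMr // ler_pdivrMr ?mulr_gt0 //.
apply: le_trans (ltW h) _; rewrite natrM -natr1.
set t := _ `^ s in t0 *; set kk := k `^ s in k1 *.
have : 0 <= M%:R * t * kk by rewrite !mulr_ge0 // ltW.
lra.
Qed.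

(** The children are stopped words at length [X]. Fewer than [N] of them cannot cover the limit set
    in the cylinder of [w], by [words_low], so more can always be added. The number [N] depends on
    [rho] only, which makes the tree regular. *)
Lemma children_exist (s : R) : limset F !=set0 -> s < HD (limset F) ->
  exists2 rho0, 0 < rho0 < c1 F & forall rho, 0 < rho <= rho0 ->
  exists N : nat, [/\ (0 < N)%N, rho `^ (- s) <= N%:R &
  forall a w (X : R), path tr a w -> 0 < X -> c1 F * X <= rho * len_w a w ->
  exists E : nat -> seq (alph F),
    (forall i, (i < N)%N -> [/\ path tr a (w ++ E i), E i != [::] &
       c1 F * X <= len_w a (w ++ E i) <= X]) /\
    (forall i j x, (i < N)%N -> (j < N)%N -> cyl a (w ++ E i) x ->
       cyl a (w ++ E j) x -> i = j)].
Proof.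
move=> [x0 x0l] sHD.
have c10 := c1_gt0 F; have c11 := c1_lt1 F.
have pt a w : path tr a w -> exists2 x, limset F x & cyl a w x.
  move=> pw; have [b [s' [_ ps' cs']]] := x0l 0%N; have xb := cyl_inI ps' cs'.
  have [p1 p2 _] := connectorP (last a w) b.
  have pc : path tr a (w ++ connector (last a w) b) by rewrite cat_path pw.
  have lc : last a (w ++ connector (last a w) b) = b by rewrite last_cat.
  exists (fw a (w ++ connector (last a w) b) x0); first by apply: limset_fw; rewrite ?lc.
  by apply: (cyl_sub pc); exists x0 => //=; rewrite lc.
have core N (rho : R) : 0 < rho < c1 F ^+ 2 -> (0 < N)%N ->
  (forall a w (X : R) n (E : nat -> seq (alph F)), path tr a w -> 0 < X ->
     c1 F * X <= rho * len_w a w -> (0 < n < N)%N ->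
     (forall i, (i < n)%N -> path tr a (E i) /\ len_w a (E i) <= X) ->
     (forall x, limset F x -> cyl a w x -> exists2 i, (i < n)%N & cyl a (E i) x) -> False) ->
  forall a w (X : R), path tr a w -> 0 < X -> c1 F * X <= rho * len_w a w ->
  exists E : nat -> seq (alph F),
    (forall i, (i < N)%N -> [/\ path tr a (w ++ E i), E i != [::] &
       c1 F * X <= len_w a (w ++ E i) <= X]) /\
    (forall i j x, (i < N)%N -> (j < N)%N -> cyl a (w ++ E i) x ->
       cyl a (w ++ E j) x -> i = j).
  move=> /andP[rho0 rho1] N0 noc a w X pw X0 Xl.
  have l0 := len_w_gt0 pw; have l1 := len_le1 pw.
  have Xlt : X < c1 F * len_w a w.
    by rewrite -(ltr_pM2l c10) (le_lt_trans Xl) // mulrA -expr2 ltr_pM2r.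
  have Xw : X < len_w a w by apply: lt_le_trans Xlt _; rewrite ler_piMl ?(ltW l0) ?ltW.
  have X1 : X < 1 by exact: lt_le_trans Xw l1.
  (* Greedy choice: were the family of [n < N] stopped words maximal, it would cover the limit set
     in the cylinder of [w], which [noc] forbids. *)
  have fam n : (n <= N)%N -> exists E : nat -> seq (alph F),
      (forall i, (i < n)%N -> stopping X a (w ++ E i)) /\
      (forall i j, (i < n)%N -> (j < n)%N -> E i = E j -> i = j).
    elim: n => [|n IH] nN; first by exists (fun=> [::]).
    have [E [sE iE]] := IH (ltnW nN).
    have [t [st nt]] : exists t, stopping X a (w ++ t) /\ forall i, (i < n)%N -> E i <> t.
      apply: contrapT => no.
      have cov x : limset F x -> cyl a w x -> exists2 i, (i < n)%N & cyl a (w ++ E i) x.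
        move=> xl cx; have [t [st ct _]] := stopping_exists X0 xl pw cx Xw.
        apply: contrapT => ni; apply: no; exists t; split => // i iN ti.
        by apply: ni; exists i => //; rewrite ti.
      have n0 : (0 < n)%N.
        by have [x xl cx] := pt a w pw; have [i iN _] := cov x xl cx; exact: leq_ltn_trans iN.
      apply: (noc a w X n (fun i => w ++ E i)) => //; first by rewrite n0.
      by move=> i /sE[].
    exists (fun i => if i == n then t else E i); split.
      by move=> i; rewrite ltnS leq_eqVlt; case: eqP => //= _; exact: sE.
    move=> i j; rewrite !ltnS (leq_eqVlt i) (leq_eqVlt j).
    case: (i =P n) => [->|_]; case: (j =P n) => [->|_] /= ii jj E1.
    - by [].
    - by case: (nt _ jj).
    - by case: (nt _ ii).
    - exact: iE.
  have [E [sE iE]] := fam N (leqnn N).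
  exists E; split.
    move=> i iN; have sEi := sE i iN; have [p1 p2 p3] := sEi; split => //.
      apply/eqP => E0; move: p2; rewrite E0 cats0 => /(lt_le_trans Xw).
      by rewrite ltxx.
    by rewrite p2 (ltW (stopping_ge X1 sEi)).
  move=> i j x iN jN ci cj; apply: iE => //.
  have [_ /eqP] := stopping_eq (sE i iN) (sE j jN) ci cj.
  by rewrite eqseq_cat // => /andP[_ /eqP].
have cs0 : 0 < c1 F ^+ 2 by rewrite exprn_gt0.
have cs1 : c1 F ^+ 2 < c1 F by rewrite expr2 gtr_pMl.
(* For [s <= 0] one child is enough, as [rho ^ (- s) <= 1]. *)
have [s0|s0] := leP s 0.
  exists (c1 F ^+ 2 / 2); first by apply/andP; split; lra.
  move=> rho /andP[rho0 rho1]; exists 1%N; split => //.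
    apply: (@le_trans _ _ (rho `^ 0)); last by rewrite powRr0.
    by apply: ger_powR; lra.
  apply: core => //; first by apply/andP; split; lra.
  by move=> a w X n E _ _ _; case: n.
(* The count is made with a larger exponent [s']; for small [rho] the gain [rho ^ (s' - s)] absorbs
   the constant [c] of [words_low], which is the last bound in [rho0]. *)
have [s' /andP[ss' s'HD]] : exists s', s < s' < HD (limset F).
  by exists ((s + HD (limset F)) / 2); apply/andP; split; lra.
have [c [eta0 [c0 eta00 Hc]]] := @words_low s' ltac:(lra).
have K0 : 0 < c * c1 F `^ s' / 2 by rewrite divr_gt0 // mulr_gt0 ?powR_gt0.
pose rho0 := Num.min (Num.min (c1 F ^+ 2 / 2) (eta0 * c1 F))
   ((c * c1 F `^ s' / 2) `^ (s' - s)^-1).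
have rho00 : 0 < rho0.
  rewrite !lt_min; apply/andP; split; last exact: powR_gt0.
  by apply/andP; split; [exact: divr_gt0|exact: mulr_gt0].
exists rho0.
  rewrite rho00 /rho0 !gt_min; apply/orP; left; apply/orP; left; lra.
move=> rho /andP[rhop rhole].
move: rhole; rewrite !le_min => /andP[/andP[r1 r2] r3].
have Kr : rho `^ (s' - s) <= c * c1 F `^ s' / 2.
  have ds : 0 < s' - s by lra.
  have := le_powR (ltW ds) (ltW rhop) r3.
  by rewrite -[X in _ <= X]powRrM mulVf ?gt_eqF // powRr1 // ltW.
have rs1 : 1 <= rho `^ (- s).
  rewrite powRN invf_ge1 ?powR_gt0 // -(powRr0 rho); apply: ger_powR; lra.
have rs0 : 0 <= rho `^ (- s) by exact: powR_ge0.
exists (Num.truncn (rho `^ (- s))).+1; split => //; first exact: ltW (truncnS_gt _).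
apply: core => //; first by apply/andP; split; lra.
move=> a w X n E pw X0 Xl /andP[_ nN] pE cE.
have l0 := len_w_gt0 pw.
have XlE : X / len_w a w <= rho / c1 F by rewrite ler_pdivrMr // mulrAC ler_pdivlMr // mulrC.
have h := Hc a w X n E pw X0 _ pE cE.
have {h} h : c * (len_w a w / X) `^ s' <= n%:R.
  by apply: h; apply: le_trans XlE _; rewrite ler_pdivrMr.
have h2 : n%:R <= rho `^ (- s).
  have /andP[h2 _] := truncn_itv rs0; apply: le_trans h2; rewrite ler_nat -ltnS //.
have h3 : (c1 F / rho) `^ s' <= (len_w a w / X) `^ s'.
  apply: le_powR; [lra|by rewrite divr_ge0 ?ltW|].
  by rewrite ler_pdivlMr // mulrAC ler_pdivrMr // mulrC mulrC [leRHS]mulrC.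
have h4 : c * (c1 F / rho) `^ s' <= rho `^ (- s).
  by apply: le_trans h2; apply: le_trans h; rewrite ler_wpM2l // ltW.
have ri : (rho^-1) `^ s' = rho `^ (- s').
  by rewrite -(@powR_inv1 _ rho) ?(ltW rhop) // -powRrM mulN1r.
rewrite powRM ?invr_ge0 ?(ltW c10) ?(ltW rhop) // ri in h4.
have E1 : rho `^ (- s) = rho `^ (- s') * rho `^ (s' - s).
  rewrite -powRD; first by congr (_ `^ _); ring.
  by rewrite (gt_eqF rhop) implybT.
have p0 : 0 < rho `^ (- s') by rewrite powR_gt0.
rewrite E1 in h4.
have : rho `^ (- s') * (c * c1 F `^ s') <= rho `^ (- s') * rho `^ (s' - s) by lra.
rewrite ler_pM2l // => {}h4.
have : 0 < c * c1 F `^ s' by rewrite mulr_gt0 ?powR_gt0.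
lra.
Qed.

(** A maximal family of words stopped at [rho] covers the limit set, and [card_words_up] bounds its
    size. *)
Lemma box_cover (s : R) : limset F !=set0 -> HD (limset F) < s -> exists2 C, 0 <= C & forall rho, 0 < rho < 1 ->
  exists (M : nat) (W : nat -> alph F * seq (alph F)),
  [/\ M%:R <= C * rho `^ (- s),
      forall i, (i < M)%N -> path tr (W i).1 (W i).2 /\ len_w (W i).1 (W i).2 <= rho &
      forall x, limset F x -> exists2 i, (i < M)%N & cyl (W i).1 (W i).2 x].
Proof.
move=> [x0 x0l] HDs; have [C C1 HC] := card_words_up HDs.
have [a0 _] := x0l 0%N.
have c10 := c1_gt0 F; have c11 := c1_lt1 F.
exists (#|alph F|%:R * C * c1 F `^ (- s)).
  by rewrite !mulr_ge0 ?powR_ge0 // (le_trans _ C1).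
move=> rho /andP[rho0 rho1].
pose good n (W : nat -> alph F * seq (alph F)) :=
  (forall i, (i < n)%N -> stopping rho (W i).1 (W i).2) /\
  (forall i j, (i < n)%N -> (j < n)%N -> W i = W j -> i = j).
have bound n W : good n W -> n%:R <= #|alph F|%:R * C * c1 F `^ (- s) * rho `^ (- s).
  move=> [sW iW].
  have -> : n%:R = #|[set: 'I_n]%SET|%:R :> R by rewrite cardsT card_ord.
  rewrite (card_fibres [set: 'I_n]%SET (fun i => (W i).1)) natr_sum.
  rewrite -!mulrA mulr_natl -sumr_const; apply: ler_sum => a _.
  rewrite -powRM ?(ltW c10) ?(ltW rho0) //.
  apply: (HC a _ _ (fun i : 'I_n => (W i).2)).
  - by rewrite mulr_gt0 //= mulr_ile1 ?ltW.
  - move=> i; rewrite !inE /= => /eqP <-; have si := sW i (ltn_ord i).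
    by split; [case: si|rewrite ltW // stopping_ge].
  - move=> i j x; rewrite !inE /= => /eqP Ei /eqP Ej ci cj.
    have si := sW i (ltn_ord i); have sj := sW j (ltn_ord j).
    rewrite -Ei in ci; rewrite -Ej in cj.
    have [e1 e2] := stopping_eq si sj ci cj.
    apply/val_inj/iW; [exact: ltn_ord|exact: ltn_ord|].
    by rewrite (surjective_pairing (W i)) e1 e2 -surjective_pairing.
pose P n := `[< exists W, good n W >].
have exP : exists n, P n by exists 0%N; apply/asboolP; exists (fun=> (a0, [::])).
have ubP n : P n -> (n <= Num.truncn (#|alph F|%:R * C * c1 F `^ (- s) * rho `^ (- s)))%N.
  by move=> /asboolP[W /bound h]; rewrite truncn_ge_nat // (le_trans _ h).
case: (ex_maxnP exP ubP) => n /asboolP[W gW] maxn.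
have [sW iW] := gW.
exists n, W; split; first exact: bound gW.
  by move=> i /sW[].
move=> x xl; apply: contrapT => nx.
have [b [s' [_ ps' cs']]] := xl 0%N; have xb := cyl_inI ps' cs'.
have cb : cyl b [::] x by exists x.
have [|t [st ct _]] := @stopping_exists _ F rho x b [::] rho0 xl isT cb; first by rewrite len_nil.
have : P n.+1; last by move/maxn; rewrite ltnn.
apply/asboolP; exists (fun i => if i == n then (b, t) else W i); split.
  by move=> i; rewrite ltnS leq_eqVlt; case: eqP => //= _; exact: sW.
have nW i : (i < n)%N -> W i <> (b, t).
  by move=> iN E; apply: nx; exists i => //; rewrite E.
move=> i j; rewrite !ltnS (leq_eqVlt i) (leq_eqVlt j).
case: (i =P n) => [->|_]; case: (j =P n) => [->|_] /= ii jj E1.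
- by [].
- by case: (nW _ jj).
- by case: (nW _ ii).
- exact: iW.
Qed.

End LowerCount.

(** * Selecting a subtree with few collisions *)

Section SelectPaths.
Local Open Scope nat_scope.

Fixpoint paths (N n : nat) : seq (seq nat) :=
  if n is n'.+1 then [seq i :: pi | i <- iota 0 N, pi <- paths N n'] else [:: [::]].

Lemma size_paths N n : size (paths N n) = N ^ n.
Proof. by elim: n => //= n IH; rewrite size_allpairs size_iota IH expnS. Qed.

Lemma paths_lt N n pi : pi \in paths N n -> size pi = n /\ {in pi, forall i, i < N}.
Proof.
elim: n pi => [|n IH] pi /=; first by rewrite inE => /eqP->.
move=> /allpairsP[[i pi'] /= [iN /IH[s1 s2] ->]]; rewrite /= s1; split => // j.
rewrite inE => /orP[/eqP->|/s2//]; by rewrite mem_iota in iN; case/andP: iN.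
Qed.

Lemma big_paths N n (f : seq nat -> nat) :
  \sum_(pi <- paths N n.+1) f pi = \sum_(0 <= i < N) \sum_(pi <- paths N n) f (i :: pi).
Proof.
rewrite /= big_flatten big_map /index_iota subn0.
by apply: eq_bigr => i _; rewrite big_map.
Qed.

Variables (T : Type) (child : T -> nat -> T) (N G : nat).
Variables (Inv : T -> Prop) (bad : nat -> T -> nat -> bool).
Hypothesis Inv_child : forall v i, Inv v -> i < N -> Inv (child v i).

(** Badness is attached to the edge from [v] to its child [i], so the last vertex of a path is
    counted and its root is not. *)
Fixpoint badc g v pi : nat :=
  if pi is i :: pi' then bad g v i + badc g (child v i) pi' else 0.

Lemma badc_size g v pi : badc g v pi <= size pi.
Proof. by elim: pi v => //= i pi IH v; rewrite -add1n leq_add ?leq_b1. Qed.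

Variable q : nat.
Hypothesis few_bad : forall v, Inv v ->
  q * (\sum_(0 <= g < G) \sum_(0 <= i < N) bad g v i) <= G * N.

Lemma badc_average v n : Inv v ->
  q * (\sum_(0 <= g < G) \sum_(pi <- paths N n) badc g v pi) <= n * (G * N ^ n).
Proof.
elim: n v => [|n IH] v Iv.
  rewrite big1 ?muln0 // => g _; by rewrite big_seq1.
have -> : \sum_(0 <= g < G) \sum_(pi <- paths N n.+1) badc g v pi =
   N ^ n * (\sum_(0 <= g < G) \sum_(0 <= i < N) bad g v i) +
   \sum_(0 <= i < N) \sum_(0 <= g < G) \sum_(pi <- paths N n) badc g (child v i) pi.
  rewrite [X in _ + X]exchange_big /= big_distrr -big_split /=; apply: eq_bigr => g _.
  rewrite big_paths big_distrr -big_split /=; apply: eq_bigr => i _.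
  by rewrite big_split /= big_const_seq count_predT iter_addn_0 size_paths mulnC.
rewrite mulnDr.
have h1 : q * (N ^ n * (\sum_(0 <= g < G) \sum_(0 <= i < N) bad g v i)) <= N ^ n * (G * N).
  by rewrite mulnCA leq_mul2l few_bad ?orbT.
have h2 : q * (\sum_(0 <= i < N) \sum_(0 <= g < G) \sum_(pi <- paths N n) badc g (child v i) pi)
   <= N * (n * (G * N ^ n)).
  rewrite big_distrr /= -[leqRHS](_ : \sum_(0 <= i < N) n * (G * N ^ n) = _).
    rewrite big_nat [leqRHS]big_nat; apply: leq_sum => i /= iN.
    by apply: IH; exact: Inv_child.
  by rewrite sum_nat_const_nat subn0.
apply: leq_trans (leq_add h1 h2) _; rewrite expnS; nia.
Qed.

(* Average over [g] the number of bad vertices on a path: for some [g], half of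
   all paths meet a proportion at most [2 / q] of bad vertices. *)
Lemma select_paths (v : T) (p C : nat) : Inv v -> 0 < G -> 0 < N -> 1 < q ->
  exists g (L : seq (seq nat)), [/\ g < G, {subset L <= paths N (q * p)},
    N ^ (q * p) <= 2 * size L &
    forall hit : pred T, (forall v i, Inv v -> i < N -> hit (child v i) -> hit v) ->
      (forall v, Inv v -> \sum_(0 <= i < N) (hit (child v i) && ~~ bad g v i) <= C) ->
      count (fun pi => hit (foldl child v pi)) L <= N ^ (2 * p) * C.+1 ^ (q * p)].
Proof.
move=> Iv G0 N0 q1; set n := q * p.
have avg := badc_average n Iv.
have [g gG Hg] : exists2 g, g < G & q * (\sum_(pi <- paths N n) badc g v pi) <= n * N ^ n.
  apply: contrapT => no.
  have big g : g < G -> (n * N ^ n).+1 <= q * (\sum_(pi <- paths N n) badc g v pi).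
    by move=> gG; rewrite ltnNge; apply/negP => h; apply: no; exists g.
  have : \sum_(0 <= g < G) (n * N ^ n).+1 <= q * (\sum_(0 <= g < G) \sum_(pi <- paths N n) badc g v pi).
    rewrite big_distrr /= big_nat [leqRHS]big_nat; apply: leq_sum => g /= gG.
    exact: big.
  rewrite sum_nat_const_nat subn0; nia.
pose ok pi := badc g v pi <= 2 * p.
exists g, [seq pi <- paths N n | ok pi]; split => //.
- by move=> pi; rewrite mem_filter => /andP[].
(* Markov inequality: the average number of bad vertices is at most [p], so at most half of the
   paths have more than [2 * p]. *)
- have : (2 * p).+1 * count (predC ok) (paths N n) <= \sum_(pi <- paths N n) badc g v pi.
    rewrite -sum1_count big_distrr /= big_mkcond /=; apply: leq_sum => pi _.
    by rewrite /ok /= -ltnNge muln1; case: ifP.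
  rewrite size_filter; set x := count ok _; set y := count (predC ok) _ => h.
  have e1 : x + y = N ^ n by rewrite -(size_paths N n); exact: count_predC.
  have h2 : \sum_(pi <- paths N n) badc g v pi <= p * N ^ n.
    by rewrite -(leq_pmul2l (ltnW q1)) mulnA.
  rewrite -e1 in h2 *; nia.
- move=> hit hnest hfew.
  have leq_exp2l' a b : a <= b -> N ^ a <= N ^ b by move=> ab; rewrite leq_pexp2l.
  have hit_end v' pi : Inv v' -> {in pi, forall i, i < N} -> hit (foldl child v' pi) -> hit v'.
    elim: pi v' => //= i pi IH v' Iv' piN h.
    have iN : i < N by apply: piN; rewrite inE eqxx.
    apply: (hnest v' i Iv' iN); apply: IH h; first exact: Inv_child.
    by move=> j jp; apply: piN; rewrite inE jp orbT.
  (* A hit path is weighted by [N] to the number of its good vertices. At each level at most [C] hit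
     children are good, with weight [N], and at most [N] are bad, with weight 1, so the weighted
     count grows by at most [N * C.+1]. *)
  have gen m v' : Inv v' -> \sum_(pi <- paths N m | hit (foldl child v' pi)) N ^ (m - badc g v' pi)
      <= (N * C.+1) ^ m.
    elim: m v' => [|m IH] v' Iv'.
      by rewrite big_mkcond big_seq1 /=; case: ifP.
    rewrite big_mkcond big_paths.
    apply: (@leq_trans (\sum_(0 <= i < N) (hit (child v' i) * N ^ (1 - bad g v' i)) *
        (N * C.+1) ^ m)).
      rewrite big_nat [leqRHS]big_nat; apply: leq_sum => i /= iN.
      have Ic := Inv_child Iv' iN.
      have [hi|nhi] := boolP (hit (child v' i)); last first.
        rewrite big_seq big1 // => pi /paths_lt[_ piN]; case: ifP => // h.
        by case/negP: nhi; exact: hit_end h.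
      rewrite mul1n -big_mkcond /=.
      apply: leq_trans (leq_mul (leqnn _) (IH _ Ic)); rewrite big_distrr /=.
      rewrite big_seq_cond [leqRHS]big_seq_cond; apply: leq_sum => pi /andP[/paths_lt[sp _] _].
      have bs := badc_size g (child v' i) pi; rewrite sp in bs.
      by rewrite -expnD; apply: leq_exp2l'; case: (bad g v' i); lia.
    rewrite -big_distrl /= expnS leq_mul2r; apply/orP; right.
    apply: (@leq_trans (\sum_(0 <= i < N) ((hit (child v' i) && ~~ bad g v' i) * N + 1))).
      apply: leq_sum => i _; case: (hit _); case: (bad g v' i) => //=; rewrite ?expn0 ?expn1; lia.
    rewrite big_split /= sum_nat_const_nat subn0 -big_distrl /= muln1 mulnS addnC leq_add2l.
    by rewrite mulnC leq_mul2l hfew ?orbT.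
  have np : 2 * p <= n by rewrite leq_mul2r q1 orbT.
  rewrite count_filter -sum1_count.
  rewrite -(@leq_pmul2l (N ^ (n - 2 * p))) ?expn_gt0 ?N0 // mulnA -expnD subnK //.
  rewrite -expnMn; apply: leq_trans (gen n v Iv); rewrite big_distrr /= big_mkcond [leqRHS]big_mkcond /=.
  apply: leq_sum => pi _; case: (hit _) => //=; case: ifP => // okp; rewrite muln1.
  by apply: leq_exp2l'; rewrite /ok in okp; lia.
Qed.

End SelectPaths.

(** * Transversality *)

Section Degree.
Context {R : realType}.

(** The values form a progression of step [|b| / G], of which at most [12 * G / |b| + 1] terms lie
    in an interval of length 12; the assumption [|b| <= G] turns the last 1 into one more
    [G / |b|]. *)
Lemma card_translates (G : nat) (a b : R) (sg : bool) : `|b| <= G%:R ->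
  #|[set g : 'I_G | `|a + (-1) ^+ sg * (1 + g%:R / G%:R) * b| <= 6]%SET|%:R
    <= 13 * G%:R / Num.max 1 `|b|.
Proof.
move=> bG; set P := finset _.
have PG : #|P|%:R <= G%:R :> R by rewrite ler_nat -[X in (_ <= X)%N]card_ord max_card.
have G0 : 0 <= G%:R :> R by [].
have [b1|b1] := leP `|b| 1.
  by rewrite divr1; lra.
have Gp : 0 < G%:R :> R by lra.
have b0 : 0 < `|b| by lra.
have := @card_sep R _ P (fun g : 'I_G => a + (-1) ^+ sg * (1 + g%:R / G%:R) * b) (-6) 12
  (`|b| / G%:R).
have h1 : 0 < `|b| / G%:R by rewrite divr_gt0.
move=> /(_ h1 ltac:(lra)) h.
have {}h : #|P|%:R <= 12 / (`|b| / G%:R) + 1.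
  apply: h.
    by move=> g; rewrite inE ler_norml => /andP[? ?]; apply/andP; split; lra.
  move=> g h _ _ gh.
  have -> : a + (-1) ^+ sg * (1 + g%:R / G%:R) * b - (a + (-1) ^+ sg * (1 + h%:R / G%:R) * b)
     = (-1) ^+ sg * ((g%:R - h%:R) * (b / G%:R)).
    by field; rewrite gt_eqF.
  rewrite normrM normr_sign mul1r normrM [`|b / _|]normrM (gtr0_norm (_ : 0 < G%:R^-1)) ?invr_gt0 //.
  rewrite ler_peMl ?(ltW h1) //.
  have : (g != h :> nat) by [].
  by rewrite neq_ltn => /orP[] lt; [rewrite distrC|]; rewrite -natrB 1?ltnW // normr_nat ler1n subn_gt0.
apply: le_trans h _.
rewrite invf_div mulrA ler_pdivlMr // mulrDl divfK ?gt_eqF //; lra.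
Qed.

Lemma translates_near (G : nat) (g : 'I_G) (a b : R) (sg : bool) :
  `|a + (-1) ^+ sg * (1 + g%:R / G%:R) * b| <= 6 -> `|a| <= 8 * Num.max 1 `|b|.
Proof.
move=> h.
have G0 : 0 < G%:R :> R by rewrite ltr0n (leq_ltn_trans _ (ltn_ord g)).
have gG : 0 <= (g%:R / G%:R : R) <= 1.
  by rewrite divr_ge0 //= ler_pdivrMr // mul1r ler_nat ltnW.
have hb : `|(-1) ^+ sg * (1 + g%:R / G%:R) * b| <= 2 * `|b|.
  rewrite !normrM normr_sign mul1r ler_wpM2r // ger0_norm; lra.
have := ler_normB (a + (-1) ^+ sg * (1 + g%:R / G%:R) * b) ((-1) ^+ sg * (1 + g%:R / G%:R) * b).
rewrite addrK => h2.
have : `|b| <= Num.max 1 `|b| by rewrite le_max lexx orbT.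
have : 1 <= Num.max 1 `|b| by rewrite le_max lexx.
lra.
Qed.

(** Replaces [1 / D] by indicators of dyadic scales, so that a sum of such terms becomes a count of
    pairs scale by scale. *)
Lemma inv_le_dyadic (n : nat) (D : R) : 1 <= D -> D <= 2 ^+ n ->
  D^-1 <= 2 * \sum_(l < n.+1) (2^-1) ^+ l * (D <= 2 ^+ l)%R%:R.
Proof.
move=> D1 Dn; have D0 : 0 < D by lra.
have ex : exists l, D <= 2 ^+ l by exists n.
case: (ex_minnP ex) => l hl minl.
have ln : (l < n.+1)%N by rewrite ltnS; exact: minl.
rewrite (bigD1 (Ordinal ln)) //= hl mulr1.
have s0 : 0 <= \sum_(i < n.+1 | i != Ordinal ln) (2^-1) ^+ i * (D <= 2 ^+ i)%R%:R :> R.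
  by apply: sumr_ge0 => i _; rewrite mulr_ge0 ?exprn_ge0.
suff : D^-1 <= 2 * (2^-1) ^+ l by lra.
case: l hl minl {ln s0} => [|l] hl minl.
  by rewrite expr0 mulr1 invf_ple ?posrE //; lra.
rewrite exprS mulrA mulfV // mul1r exprVn lef_pV2 ?posrE ?exprn_gt0 //.
by rewrite leNgt; apply/negP => /ltW /minl; rewrite ltnn.
Qed.

(* For fixed [j] the parameters [g] that bring the two points together form a set
   of size [O(G / |b i2 - b j.2|)], so a dyadic decomposition in [|b i2 - b j.2|]
   gives a geometric series of ratio [2 `^ (s1 + s2 - 1)]. *)
Lemma degree_bound (I1 I2 : finType) (a : I1 -> R) (b : I2 -> R) (A B s1 s2 : R)
    (G : nat) (sg : bool) : 0 <= A -> 0 <= B -> s1 + s2 < 1 ->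
  (forall i r, 1 <= r -> #|[set j | `|a i - a j| <= r]%SET|%:R <= A * r `^ s1) ->
  (forall i r, 1 <= r -> #|[set j | `|b i - b j| <= r]%SET|%:R <= B * r `^ s2) ->
  (forall i j, `|b i - b j| <= G%:R) ->
  forall i1 i2, \sum_(j : I1 * I2) #|[set g : 'I_G |
     `|a i1 - a j.1 + (-1) ^+ sg * (1 + g%:R / G%:R) * (b i2 - b j.2)| <= 6]%SET|%:R
    <= 26 * A * B * 8 `^ s1 / (1 - 2 `^ (s1 + s2 - 1)) * G%:R.
Proof.
move=> A0 B0 s12 hA hB hb i1 i2.
set sgm := s1 + s2 in s12 *.
have q0 : 0 < 2 `^ (sgm - 1) :> R by rewrite powR_gt0.
have q1 : 2 `^ (sgm - 1) < 1 :> R.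
  rewrite /powR pnatr_eq0 /= -[ltRHS]expR0 ltr_expR pmulr_llt0 ?ln_gt0 ?ltr1n //; lra.
set q := 2 `^ (sgm - 1) in q0 q1 *.
have [n Gn] : exists n, G%:R <= 2 ^+ n :> R.
  by exists G; rewrite -natrX ler_nat ltnW // ltn_expl.
have term (j : I1 * I2) : #|[set g : 'I_G |
     `|a i1 - a j.1 + (-1) ^+ sg * (1 + g%:R / G%:R) * (b i2 - b j.2)| <= 6]%SET|%:R <=
   26 * G%:R * \sum_(l < n.+1) (2^-1) ^+ l *
     (j \in finset.setX [set j1 | `|a i1 - a j1| <= 8 * 2 ^+ l]%SET
                 [set j2 | `|b i2 - b j2| <= 2 ^+ l]%SET)%:R :> R.
  case: (set_0Vmem [set g : 'I_G |
     `|a i1 - a j.1 + (-1) ^+ sg * (1 + g%:R / G%:R) * (b i2 - b j.2)| <= 6]%SET) => [->|[g gP]].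
    rewrite cards0; apply: mulr_ge0; first exact: mulr_ge0.
    by apply: sumr_ge0 => l _; apply: mulr_ge0 => //; exact: exprn_ge0.
  have near := translates_near (sg := sg) (g := g) (a := a i1 - a j.1) (b := b i2 - b j.2).
  rewrite inE in gP; have {}near := near gP.
  apply: le_trans (@card_translates G (a i1 - a j.1) (b i2 - b j.2) sg (hb i2 j.2)) _.
  set D := Num.max 1 _ in near *.
  have D1 : 1 <= D by rewrite le_max lexx.
  have Dn : D <= 2 ^+ n.
    by rewrite ge_max exprn_ege1 ?ler1n //=; exact: le_trans Gn.
  have h := inv_le_dyadic D1 Dn.
  have h2 : \sum_(l < n.+1) (2^-1) ^+ l * (D <= 2 ^+ l)%R%:R <=
    \sum_(l < n.+1) (2^-1) ^+ l *
     (j \in finset.setX [set j1 | `|a i1 - a j1| <= 8 * 2 ^+ l]%SET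
                 [set j2 | `|b i2 - b j2| <= 2 ^+ l]%SET)%:R :> R.
    apply: ler_sum => l _; rewrite ler_wpM2l ?exprn_ge0 // ler_nat.
    have [Dl|] // := boolP (D <= 2 ^+ l).
    rewrite !inE (le_trans near) ?ler_pM2l //=.
    by rewrite (le_trans _ Dl) // le_max lexx orbT.
  have -> : 26 * G%:R = 13 * G%:R * 2 :> R by ring.
  rewrite -[leRHS]mulrA ler_wpM2l ?mulr_ge0 //; lra.
apply: le_trans (ler_sum _ (fun j _ => term j)) _.
rewrite -mulr_sumr exchange_big /=.
have -> : 26 * A * B * 8 `^ s1 / (1 - q) * G%:R = 26 * G%:R * (A * B * 8 `^ s1 / (1 - q)) by ring.
rewrite ler_wpM2l ?mulr_ge0 //.
(* At scale [2 ^ l] the pairs are counted by the product of the two growth bounds, and the weight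
   [2 ^ (- l)] leaves the exponent [s1 + s2 - 1 < 0]. *)
have lev (l : 'I_n.+1) : \sum_(j : I1 * I2) (2^-1) ^+ l *
     (j \in finset.setX [set j1 | `|a i1 - a j1| <= 8 * 2 ^+ l]%SET
                 [set j2 | `|b i2 - b j2| <= 2 ^+ l]%SET)%:R
   <= A * B * 8 `^ s1 * q ^+ l :> R.
  rewrite -mulr_sumr -natr_sum.
  set X := finset.setX _ _.
  have -> : (\sum_(j : I1 * I2) (j \in X))%N = #|X|.
    by rewrite -sum1_card [RHS]big_mkcond /=; apply: eq_bigr => j _; case: (j \in X).
  rewrite cardsX natrM.
  have p1 : 1 <= 2 ^+ l :> R by rewrite exprn_ege1 // ler1n.
  have h1 := hA i1 (8 * 2 ^+ l) ltac:(lra); have h2 := hB i2 (2 ^+ l) p1.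
  apply: (@le_trans _ _ ((2^-1) ^+ l * (A * (8 * 2 ^+ l) `^ s1 * (B * (2 ^+ l) `^ s2)))).
    by rewrite ler_wpM2l ?exprn_ge0 // ler_pM.
  rewrite powRM ?exprn_ge0 //.
  have -> : (2^-1) ^+ l * (A * (8 `^ s1 * (2 ^+ l) `^ s1) * (B * (2 ^+ l) `^ s2)) =
     A * B * 8 `^ s1 * ((2^-1) ^+ l * ((2 ^+ l) `^ s1 * (2 ^+ l) `^ s2)) :> R by ring.
  rewrite ler_wpM2l ?mulr_ge0 ?powR_ge0 //.
  have n0 : 2 ^+ l != 0 :> R by rewrite expf_neq0 // pnatr_eq0.
  rewrite -powRD ?n0 ?implybT //.
  rewrite -(powR_mulrn l (_ : 0 <= 2 :> R)) // -powRrM exprVn -powR_invn // -powRD; last first.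
    by rewrite pnatr_eq0 /= implybT.
  rewrite -powR_mulrn ?(ltW q0) // /q -powRrM /sgm.
  by rewrite le_eqVlt; apply/orP; left; apply/eqP; congr (_ `^ _); ring.
apply: le_trans (ler_sum _ (fun l _ => lev l)) _.
rewrite -mulr_sumr; apply: ler_wpM2l; first by rewrite !mulr_ge0 ?powR_ge0.
have d0 : 0 < 1 - q by lra.
rewrite -[leRHS]div1r ler_pdivlMr // mulrC.
have -> : (1 - q) * \sum_(l < n.+1) q ^+ l = 1 - q ^+ n.+1 by rewrite -[RHS]opprB subrX1; ring.
by rewrite gerBl exprn_ge0 // ltW.
Qed.

End Degree.

(** * Trees of cylinders with geometric sizes *)

Section RegularTree.
Context {R : realType}.
Variable F : markov_ifs R.

(** Lengths are compared with [rho ^+ k] directly at every level, so the tolerance [c1 F] does not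
    degrade along a branch. *)
Definition node (rho : R) (a : alph F) (w : seq (alph F)) (k : nat) (s : seq (alph F)) :=
  path (@tr _ F) a (w ++ s) /\
  c1 F * (rho ^+ k * len_w a w) <= len_w a (w ++ s) <= rho ^+ k * len_w a w.

(** The last clause says that normalised left ends of siblings are spread out with exponent [su],
    the growth condition needed by [degree_bound]. The constant [A] is independent of [rho], of the
    root and of the level. *)
Lemma regular_tree (s su : R) : limset F !=set0 -> s < HD (limset F) < su ->
  exists rho0 A : R, [/\ 0 < rho0 < 1, 0 <= A & forall rho, 0 < rho <= rho0 ->
  exists N : nat, [/\ (0 < N)%N, rho `^ (- s) <= N%:R & forall a w, path (@tr _ F) a w ->
  exists ch : nat -> seq (alph F) -> nat -> seq (alph F),
  forall k s0, node rho a w k s0 ->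
   [/\ forall i, (i < N)%N -> node rho a w k.+1 (s0 ++ ch k s0 i),
       forall i, (i < N)%N -> ch k s0 i != [::] &
       forall (i : 'I_N) r, 1 <= r ->
        #|[set j : 'I_N | `|lo_w a (w ++ s0 ++ ch k s0 i) / (rho ^+ k.+1 * len_w a w)
           - lo_w a (w ++ s0 ++ ch k s0 j) / (rho ^+ k.+1 * len_w a w)| <= r]%SET|%:R
         <= A * r `^ su]]].
Proof.
move=> lne /andP[sd dsu].
have c10 := c1_gt0 F; have c11 := c1_lt1 F.
have [rho0 /andP[r00 r01] Hc] := children_exist lne sd.
have [C C1 HC] := card_itv_up dsu.
have C0 : 0 <= C by exact: le_trans C1.
exists rho0, (C * (2 / c1 F) `^ su); split.
- by rewrite r00 (lt_trans r01).
- by rewrite mulr_ge0 ?powR_ge0.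
move=> rho rhoP; have [N [N0 Ns HN]] := Hc rho rhoP.
have /andP[rho_gt0 rho_le] := rhoP.
exists N; split => // a w pw; have l0 := len_w_gt0 pw.
have X0 k : 0 < rho ^+ k * len_w a w by rewrite mulr_gt0 ?exprn_gt0.
have ex (ks : nat * seq (alph F)) : exists E : nat -> seq (alph F), node rho a w ks.1 ks.2 ->
    (forall i, (i < N)%N -> [/\ path (@tr _ F) a ((w ++ ks.2) ++ E i), E i != [::] &
       c1 F * (rho ^+ ks.1.+1 * len_w a w) <= len_w a ((w ++ ks.2) ++ E i) <=
         rho ^+ ks.1.+1 * len_w a w]) /\
    (forall i j x, (i < N)%N -> (j < N)%N -> cyl a ((w ++ ks.2) ++ E i) x ->
       cyl a ((w ++ ks.2) ++ E j) x -> i = j).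
  case: ks => k s0 /=; have [[ps /andP[ls _]]|nn] := pselect (node rho a w k s0); last by exists (fun=> [::]).
  have [|E HE] := HN a (w ++ s0) (rho ^+ k.+1 * len_w a w) ps (X0 _).
    by rewrite exprS -mulrA mulrCA ler_pM2l.
  by exists E.
have [E HE] := choice ex.
exists (fun k s0 => E (k, s0)) => k s0 nd; have [E1 E2] := HE (k, s0) nd; split.
- by move=> i /E1[p1 _ p2]; rewrite /node catA.
- by move=> i /E1[].
move=> i r r1; set X := rho ^+ k.+1 * len_w a w.
set P := finset _.
have Xp : 0 < X by exact: X0.
have h : #|P|%:R <= C * (2 * r * X / (c1 F * X)) `^ su.
  apply: (HC a _ P (fun j : 'I_N => (w ++ s0) ++ E (k, s0) j) (c1 F * X)
    (lo_w a (w ++ s0 ++ E (k, s0) i) - r * X)).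
  - rewrite mulr_gt0 //= ler_pM2r //; lra.
  - by move=> j _; have [p1 _ /andP[p2 _]] := E1 j (ltn_ord j).
  - by move=> j j' x _ _ h1 h2; apply: val_inj; exact: (E2 _ _ x (ltn_ord j) (ltn_ord j') h1 h2).
  - move=> j; rewrite inE => hj; exists (lo_w a (w ++ s0 ++ E (k, s0) j)).
      by rewrite -catA; apply: cyl_lo; rewrite catA; have [] := E1 j (ltn_ord j).
    move: hj; rewrite -mulrBl normrM (gtr0_norm (_ : 0 < X^-1)) ?invr_gt0 // ler_pdivrMr //.
    by rewrite ler_norml => /andP[? ?]; apply/andP; split; lra.
apply: le_trans h _; rewrite -[leRHS]mulrA ler_wpM2l //.
have h2 : 0 <= 2 / c1 F by rewrite divr_ge0 ?(ltW c10).
rewrite -(powRM _ h2) //; last by lra.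
rewrite le_eqVlt; apply/orP; left; apply/eqP; congr (_ `^ _).
by field; rewrite !gt_eqF.
Qed.

End RegularTree.

Lemma sum_divmod (N1 N2 : nat) (f : nat -> nat -> nat) : (0 < N1)%N ->
  (\sum_(0 <= j < N1 * N2) f (j %% N1) (j %/ N1))%N =
  (\sum_(p : 'I_N1 * 'I_N2) f p.1 p.2)%N.
Proof.
move=> N10; rewrite -(pair_big xpredT xpredT (fun (i : 'I_N1) (j : 'I_N2) => f i j)) /= exchange_big /=.
rewrite -(big_mkord predT (fun j => \sum_(i < N1) f i j)%N).
elim: N2 => [|n IH]; first by rewrite muln0 !big_geq.
rewrite big_nat_recr //= -IH.
have -> : (N1 * n.+1 = N1 * n + N1)%N by rewrite mulnS addnC.
rewrite (@big_cat_nat _ _ _ (N1 * n)%N) ?leq_addr //=; congr (_ + _)%N.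
rewrite -{1}[(N1 * n)%N]add0n big_addn addKn big_mkord.
by apply: eq_bigr => i _; rewrite addnC mulnC modnMDl modn_small // divnMDl // divn_small // addn0.
Qed.

Lemma abs_shift (R : realType) (x1 x2 l1 l2 d1 d2 X : R) : l1 <= x1 -> x1 <= l1 + d1 ->
  d1 <= X -> l2 <= x2 -> x2 <= l2 + d2 -> d2 <= X -> `|(x1 - l1) - (x2 - l2)| <= X.
Proof. by move=> *; rewrite ler_norml; apply/andP; split; lra. Qed.

(** Passes from colliding points to left ends, in units of cylinder size: 3 from the collision, 1
    from moving the points [x] and 2 from moving the points [y], whose coefficient [1 + c] is at
    most 2. *)
Lemma rescale_collision (R : realType) (x1 x2 y1 y2 l1 l2 l3 l4 X Y X0 Y0 e c : R) :
  0 < X -> 0 < Y -> 0 < X0 -> 0 < Y0 -> X0 / Y0 = X / Y -> `|e| = 1 -> 0 <= c <= 1 ->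
  `|(x1 - l1) - (x2 - l2)| <= X -> `|(y1 - l3) - (y2 - l4)| <= Y ->
  `|x1 - x2 + e * (X0 / Y0) * (1 + c) * (y1 - y2)| <= 3 * X ->
  `|l1 / X - l2 / X + e * (1 + c) * (l3 / Y - l4 / Y)| <= 6.
Proof.
move=> Xp Yp X0p Y0p -> e1 /andP[c0 c1] hx hy h.
have -> : l1 / X - l2 / X + e * (1 + c) * (l3 / Y - l4 / Y) =
  (x1 - x2 + e * (X / Y) * (1 + c) * (y1 - y2) - ((x1 - l1) - (x2 - l2)) -
     e * (X / Y) * (1 + c) * ((y1 - l3) - (y2 - l4))) / X.
  by field; rewrite !gt_eqF.
rewrite normrM (gtr0_norm (_ : 0 < X^-1)) ?invr_gt0 // ler_pdivrMr //.
have XY0 : 0 < X / Y by rewrite divr_gt0.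
have h3 : `|e * (X / Y) * (1 + c) * ((y1 - l3) - (y2 - l4))| <= 2 * X.
  have -> : 2 * X = (X / Y) * 2 * Y by field; rewrite gt_eqF.
  rewrite normrM; apply: ler_pM => //.
  rewrite !normrM e1 mul1r -normrM gtr0_norm // ler_wpM2l ?(ltW XY0) //.
  by rewrite ger0_norm; lra.
move: h hx h3; set p := x1 - x2 + _; set q := _ - (x2 - l2); set u := e * _ * _ * (_ - (y2 - l4)).
rewrite !ler_norml => /andP[? ?] /andP[? ?] /andP[? ?].
by apply/andP; split; lra.
Qed.

(** For every child, [degree_bound] limits its collisions summed over the grid to [Cd * G]; a child
    with at least [q * Cd] collisions is bad, so bad children form on average at most a proportion
    [1 / q], as [select_paths] requires. The relation [h] will say that the image of [(x, y)] lies
    in a given small set; keeping it abstract separates the linear count from the nonlinear map. *)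
Lemma model_tree (R : realType) (F F' : markov_ifs R) (s s' su su' : R) :
  limset F !=set0 -> limset F' !=set0 ->
  s < HD (limset F) < su -> s' < HD (limset F') < su' -> su + su' < 1 ->
  exists (rho0 : R) (Cd : nat), [/\ 0 < rho0 < 1, (0 < Cd)%N &
  forall rho, 0 < rho <= rho0 -> exists N : nat, [/\ (0 < N)%N,
    rho `^ (- (s + s')) <= N%:R &
  forall (G : nat) a w a' w' (sg : bool) (q p : nat), rho^-1 <= G%:R ->
    path (@tr _ F) a w -> path (@tr _ F') a' w' -> (1 < q)%N ->
  exists (g M : nat) (L : nat -> seq (alph F) * seq (alph F')),
  [/\ (g < G)%N, (N ^ (q * p) <= 2 * M)%N,
     forall j, (j < M)%N -> node rho a w (q * p) (L j).1 /\
       node rho a' w' (q * p) (L j).2 &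
     forall h : R -> R -> Prop,
       (forall k x1 x2 y1 y2, (k < q * p)%N ->
          cyl a w x1 -> cyl a w x2 -> cyl a' w' y1 -> cyl a' w' y2 ->
          `|x1 - x2| <= rho ^+ k * len_w a w -> `|y1 - y2| <= rho ^+ k * len_w a' w' ->
          h x1 y1 -> h x2 y2 ->
          `|x1 - x2 + (-1) ^+ sg * (len_w a w / len_w a' w') * (1 + g%:R / G%:R) * (y1 - y2)|
             <= 3 * (rho ^+ k.+1 * len_w a w)) ->
       (\sum_(0 <= j < M) `[< exists x y, [/\ cyl a (w ++ (L j).1) x,
          cyl a' (w' ++ (L j).2) y & h x y] >] <= N ^ (2 * p) * (q * Cd) ^ (q * p))%N]]].
Proof.
move=> lne lne' sd sd' su1.
have [r1 [A [/andP[r10 r11] A0 H1]]] := regular_tree lne sd.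
have [r2 [B [/andP[r20 r21] B0 H2]]] := regular_tree lne' sd'.
pose D := 26 * A * B * 8 `^ su / (1 - 2 `^ (su + su' - 1)).
pose Cd := (Num.truncn D).+1.
have DCd : D <= Cd%:R by rewrite ltW // /Cd truncnS_gt.
exists (Num.min r1 r2), Cd; split => //.
  by rewrite lt_min r10 r20 /= gt_min r11.
move=> rho /andP[rho0]; rewrite le_min => /andP[rle1 rle2].
have [N1 [N10 Ns1 T1]] := H1 rho ltac:(by rewrite rho0).
have [N2 [N20 Ns2 T2]] := H2 rho ltac:(by rewrite rho0).
exists (N1 * N2)%N; split; first by rewrite muln_gt0 N10.
  have rn0 : rho != 0 by rewrite gt_eqF.
  rewrite opprD powRD ?rn0 ?implybT // natrM.
  by apply: ler_pM; rewrite ?powR_ge0.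
move=> G a w a' w' sg q p rG pw pw' q1.
have [ch1 Hch1] := T1 a w pw; have [ch2 Hch2] := T2 a' w' pw'.
set X0 := len_w a w; set Y0 := len_w a' w'.
have X0p : 0 < X0 by exact: len_w_gt0.
have Y0p : 0 < Y0 by exact: len_w_gt0.
pose X k := rho ^+ k * X0; pose Y k := rho ^+ k * Y0.
have Xp k : 0 < X k by rewrite mulr_gt0 ?exprn_gt0.
have Yp k : 0 < Y k by rewrite mulr_gt0 ?exprn_gt0.
have G0 : (0 < G)%N.
  by rewrite -(ltr0n R) (lt_le_trans _ rG) // invr_gt0.
set n := (q * p)%N; set N := (N1 * N2)%N.
pose T := (nat * (seq (alph F) * seq (alph F')))%type.
pose child (v : T) (i : nat) : T :=
  (v.1.+1, (v.2.1 ++ ch1 v.1 v.2.1 (i %% N1)%N, v.2.2 ++ ch2 v.1 v.2.2 (i %/ N1)%N)).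
pose Inv (v : T) := node rho a w v.1 v.2.1 /\ node rho a' w' v.1 v.2.2.
pose tt (g : nat) : R := (-1) ^+ sg * (X0 / Y0) * (1 + g%:R / G%:R).
pose coll (g : nat) (v : T) (i j : nat) := `[< exists x1 x2 y1 y2,
  [/\ cyl a (w ++ (child v i).2.1) x1, cyl a (w ++ (child v j).2.1) x2,
      cyl a' (w' ++ (child v i).2.2) y1, cyl a' (w' ++ (child v j).2.2) y2 &
      `|x1 - x2 + tt g * (y1 - y2)| <= 3 * X v.1.+1] >].
(* A child collides with itself, so a good child has fewer than [q * Cd] collisions including this
   one. *)
pose bad (g : nat) (v : T) (i : nat) := (q * Cd <= \sum_(0 <= j < N) coll g v i j)%N.
have divN i : (i < N)%N -> (i %/ N1 < N2)%N by move=> iN; rewrite ltn_divLR // mulnC.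
have modN i : (i %% N1 < N1)%N by rewrite ltn_mod.
have Inv_child v i : Inv v -> (i < N)%N -> Inv (child v i).
  move=> [n1 n2] iN; have [c1 _ _] := Hch1 _ _ n1; have [c2 _ _] := Hch2 _ _ n2.
  by split; [exact/c1/modN|exact/c2/divN].
have cyl_child v i : Inv v -> (i < N)%N ->
    cyl a (w ++ (child v i).2.1) `<=` cyl a (w ++ v.2.1) /\
    cyl a' (w' ++ (child v i).2.2) `<=` cyl a' (w' ++ v.2.2).
  move=> Iv iN; have [[p1 _] [p2 _]] := Inv_child v i Iv iN.
  by rewrite /= !catA in p1 p2 *; split; exact: cyl_sub.
have degree v i : Inv v -> (i < N)%N ->
    (\sum_(0 <= g < G) \sum_(0 <= j < N) coll g v i j <= Cd * G)%N.
  move=> Iv iN; have [nd1 nd2] := Iv; have [c1 _ k1] := Hch1 _ _ nd1; have [c2 _ k2] := Hch2 _ _ nd2.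
  set k := v.1 in nd1 nd2 c1 k1 c2 k2.
  pose u j := lo_w a (w ++ v.2.1 ++ ch1 k v.2.1 j) / X k.+1.
  pose t j := lo_w a' (w' ++ v.2.2 ++ ch2 k v.2.2 j) / Y k.+1.
  have p1 j : (j < N1)%N -> path (@tr _ F) a (w ++ v.2.1 ++ ch1 k v.2.1 j) by move=> /c1[].
  have p2 j : (j < N2)%N -> path (@tr _ F') a' (w' ++ v.2.2 ++ ch2 k v.2.2 j) by move=> /c2[].
  have tG (j j' : 'I_N2) : `|t j - t j'| <= G%:R.
    rewrite /t -mulrBl normrM (gtr0_norm (_ : 0 < (Y k.+1)^-1)) ?invr_gt0 // ler_pdivrMr //.
    apply: (@le_trans _ _ (Y k)).
      have [p0 /andP[_ b0]] := nd2; apply: le_trans b0; apply: (cyl_dist p0).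
        by have := p2 _ (ltn_ord j); rewrite catA => pj; apply: (cyl_sub pj); exact: cyl_lo.
      by have := p2 _ (ltn_ord j'); rewrite catA => pj; apply: (cyl_sub pj); exact: cyl_lo.
    (* Use of [rG]: siblings lie in a cylinder of length at most [Y k], which is at most [G] times
       the scale [Y k.+1] of the children. *)
    have gr : 1 <= G%:R * rho by rewrite -ler_pdivrMr // div1r.
    have -> : G%:R * Y k.+1 = G%:R * rho * Y k by rewrite /Y exprS; ring.
    by rewrite ler_peMl ?(ltW (Yp k)).
  have dg := @degree_bound R 'I_N1 'I_N2 (fun j => u j) (fun j => t j) A B su su' G sg A0 B0 su1
    k1 k2 tG (Ordinal (modN i)) (Ordinal (divN i iN)).
  rewrite exchange_big /=.
  rewrite -(ler_nat R) natrM; apply: (@le_trans _ _ (D * G%:R)); last by rewrite ler_wpM2r.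
  apply: le_trans dg.
  pose cb (g j1 j2 : nat) : bool :=
    `|u (i %% N1)%N - u j1 + (-1) ^+ sg * (1 + g%:R / G%:R) * (t (i %/ N1)%N - t j2)| <= 6.
  pose cl (j1 j2 : nat) := (\sum_(0 <= g < G) cb g j1 j2)%N.
  have h1 : (\sum_(0 <= j < N) \sum_(0 <= g < G) coll g v i j <=
      \sum_(0 <= j < N) cl (j %% N1) (j %/ N1))%N.
    rewrite big_nat [leqRHS]big_nat; apply: leq_sum => j /= jN.
    rewrite /cl big_nat [leqRHS]big_nat; apply: leq_sum => g /= gG.
    rewrite /coll; case: asboolP => // - [x1 [x2 [y1 [y2 [cx1 cx2 cy1 cy2 le]]]]].
    rewrite lt0b /cb.
    have [_ /andP[_ b1]] := c1 _ (modN i); have [_ /andP[_ b2]] := c1 _ (modN j).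
    have [_ /andP[_ b3]] := c2 _ (divN i iN); have [_ /andP[_ b4]] := c2 _ (divN j jN).
    have q1' := p1 _ (modN i); have q2 := p1 _ (modN j).
    have q3 := p2 _ (divN i iN); have q4 := p2 _ (divN j jN).
    move/(cylE _ q1')/andP: cx1 => [i1 i2]; move/(cylE _ q2)/andP: cx2 => [i3 i4].
    move/(cylE _ q3)/andP: cy1 => [i5 i6]; move/(cylE _ q4)/andP: cy2 => [i7 i8].
    rewrite /u /t.
    set l1 := lo_w a _ in i1 i2 *; set l2 := lo_w a _ in i3 i4 *.
    set l3 := lo_w a' _ in i5 i6 *; set l4 := lo_w a' _ in i7 i8 *.
    have e1 : `|(x1 - l1) - (x2 - l2)| <= X k.+1 := abs_shift i1 i2 b1 i3 i4 b2.
    have e2 : `|(y1 - l3) - (y2 - l4)| <= Y k.+1 := abs_shift i5 i6 b3 i7 i8 b4.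
    have g01 : 0 <= (g%:R / G%:R : R) <= 1.
      by rewrite divr_ge0 //= ler_pdivrMr ?ltr0n // mul1r ler_nat ltnW.
    apply: (@rescale_collision _ x1 x2 y1 y2 _ _ _ _ _ _ X0 Y0) => //.
    - rewrite /X /Y -mulf_div divff ?mul1r // expf_neq0 // gt_eqF //.
    - by rewrite normr_sign.
  rewrite -(ler_nat R) in h1; apply: le_trans h1 _.
  rewrite sum_divmod // natr_sum; apply: ler_sum => j _.
  rewrite /cl ler_nat sum_nat_card; apply: subset_leq_card; apply/fintype.subsetP => g.
  by rewrite !inE.
have few_bad v : Inv v ->
    (q * (\sum_(0 <= g < G) \sum_(0 <= i < N) bad g v i) <= G * N)%N.
  move=> Iv; rewrite -(@leq_pmul2l Cd) // mulnA [(Cd * q)%N]mulnC.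
  apply: (@leq_trans (\sum_(0 <= i < N) \sum_(0 <= g < G) \sum_(0 <= j < N) coll g v i j)).
    rewrite [leqRHS]exchange_big /= big_distrr /=; apply: leq_sum => g _.
    rewrite big_distrr /=; apply: leq_sum => i _.
    by rewrite /bad; case: (boolP (q * Cd <= _)%N) => h; rewrite ?muln1 ?muln0.
  rewrite mulnA mulnC -[(N * _)%N](_ : (\sum_(0 <= i < N) Cd * G)%N = _).
    by rewrite big_nat [leqRHS]big_nat; apply: leq_sum => i /= iN; exact: degree.
  by rewrite sum_nat_const_nat subn0.
have Inv0 : Inv (0%N, ([::], [::])).
  by rewrite /Inv /node /= !cats0 expr0 !mul1r !lexx !andbT; split; split => //;
    rewrite ler_piMl ?ltW ?c1_lt1.
have [g [L [gG LP LN Lh]]] := select_paths Inv_child few_bad p (q * Cd).-1 Inv0 G0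
  ltac:(by rewrite muln_gt0 N10) q1.
pose fin pi := foldl child (0%N, ([::], [::])) pi.
have finI pi v : {in pi, forall i, (i < N)%N} -> Inv v ->
    Inv (foldl child v pi) /\ (foldl child v pi).1 = (v.1 + size pi)%N.
  elim: pi v => [|i pi IH] v piN Iv /=; first by rewrite addn0.
  have iN : (i < N)%N by apply: piN; rewrite inE eqxx.
  have piN' : {in pi, forall i, (i < N)%N}.
    by move=> j jp; apply: piN; rewrite inE jp orbT.
  have [I1 E1] := IH (child v i) piN' (Inv_child v i Iv iN).
  by split; [|rewrite E1 /= addSnnS].
exists g, (size L), (fun j => (fin (nth [::] L j)).2); split => //.
  move=> j jL; have /paths_lt[sz piN] := LP _ (mem_nth [::] jL).
  have [[n1 n2] E] := finI _ _ piN Inv0.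
  by rewrite E sz add0n in n1 n2.
move=> h hh.
(* Vertices beyond level [n] count as not hit, since the hypothesis on [h] is available only for
   [k < n]. *)
pose hit (v : T) := (v.1 <= n)%N && `[< exists x y, [/\ cyl a (w ++ v.2.1) x,
          cyl a' (w' ++ v.2.2) y & h x y] >].
have hit_nest v i : Inv v -> (i < N)%N -> hit (child v i) -> hit v.
  move=> Iv iN /andP[/ltnW vn /asboolP[x [y [cx cy hxy]]]].
  have [s1 s2] := cyl_child v i Iv iN.
  rewrite /hit vn /=; apply/asboolP; exists x, y; split => //; [exact: s1|exact: s2].
have hit_few v : Inv v ->
    (\sum_(0 <= i < N) (hit (child v i) && ~~ bad g v i) <= (q * Cd).-1)%N.
  move=> Iv.
  have [ex|nex] := pselect (exists2 i, (i < N)%N & hit (child v i) && ~~ bad g v i); last first.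
    rewrite big_nat big1 // => i /= iN; case: (boolP (hit _ && _)) => // hi.
    by case: nex; exists i.
  have [i iN /andP[hi nbi]] := ex.
  (* Once a good child [i] is hit, every other hit child collides with it. *)
  apply: (@leq_trans (\sum_(0 <= j < N) coll g v i j)); last first.
    by move: nbi; rewrite /bad -ltnNge; case: (q * Cd)%N.
  rewrite big_nat [leqRHS]big_nat; apply: leq_sum => j /= jN.
  case: (boolP (hit (child v j))) => //= hj; case: (bad g v j) => //=.
  rewrite lt0b; move: hi hj => /andP[vn /asboolP[x1 [y1 [cx1 cy1 h1]]]].
  move=> /andP[_ /asboolP[x2 [y2 [cx2 cy2 h2]]]].
  apply/asboolP; exists x1, x2, y1, y2; split => //.
  have [s1 s2] := cyl_child v i Iv iN; have [s3 s4] := cyl_child v j Iv jN.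
  have [[p1 /andP[_ b1]] [p2 /andP[_ b2]]] := Iv.
  apply: hh => //.
  - exact: (cyl_sub p1 (s1 _ cx1)).
  - exact: (cyl_sub p1 (s3 _ cx2)).
  - exact: (cyl_sub p2 (s2 _ cy1)).
  - exact: (cyl_sub p2 (s4 _ cy2)).
  - by apply: le_trans (cyl_dist p1 (s1 _ cx1) (s3 _ cx2)) b1.
  - by apply: le_trans (cyl_dist p2 (s2 _ cy1) (s4 _ cy2)) b2.
have := Lh hit hit_nest hit_few.
rewrite prednK ?muln_gt0 ?(ltnW q1) //; apply: leq_trans.
rewrite -sum1_count (big_nth [::]) [leqRHS]big_mkcond /=.
rewrite big_nat [leqRHS]big_nat; apply: leq_sum => j /= jL.
have /paths_lt[sz piN] := LP _ (mem_nth [::] jL).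
have [_ E] := finI _ _ piN Inv0.
by rewrite /hit /fin E sz add0n leqnn /=; case: asboolP.
Qed.

(** * Steering by periodic orbits *)

Section SteeringArithmetic.
Context {R : realType}.

(** Subtracting [k0] copies of [B] makes [t] nonpositive; adding the small positive step [e] enough
    times brings it within [l] of 0. Boundedness of [t] bounds both multiplicities. *)
Lemma steer_bounded (A B e l T : R) (m k : int) : 0 < A -> 0 < B ->
  e = m%:~R * A - k%:~R * B -> 0 < e < l ->
  exists M : nat, forall t, `|t| <= T -> exists i j : nat,
    [/\ (i <= M)%N, (j <= M)%N & `|t + i%:R * A - j%:R * B| <= l].
Proof.
move=> A0 B0 eE /andP[e0 el].
have gen (A' B' e' : R) (m' k' : nat) : 0 < A' -> 0 < B' -> 0 < e' < l ->
  e' = m'%:R * A' - k'%:R * B' -> exists M : nat, forall t, `|t| <= T -> exists i j : nat,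
    [/\ (i <= M)%N, (j <= M)%N & `|t + i%:R * A' - j%:R * B'| <= l].
  move=> A'0 B'0 /andP[e'0 e'l] e'E.
  pose k0 := (Num.truncn (T / B')).+1.
  pose n := Num.truncn ((k0%:R * B' + T) / e').
  exists (n * m' + (n * k' + k0))%N => t tT.
  have T0 : 0 <= T by exact: le_trans (normr_ge0 _) tT.
  move: tT; rewrite ler_norml => /andP[t1 t2].
  have hk0 : T <= k0%:R * B' by rewrite -ler_pdivrMr // ltW // truncnS_gt.
  pose j := Num.truncn ((k0%:R * B' - t) / e').
  have nn : 0 <= (k0%:R * B' - t) / e' by apply: divr_ge0; lra.
  have /andP[j1 j2] := truncn_itv nn; rewrite -/j in j1 j2.
  have jn : (j <= n)%N by apply: le_truncn; rewrite ler_pM2r ?invr_gt0 //; lra.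
  exists (j * m')%N, (j * k' + k0)%N; split.
  - by rewrite (leq_trans _ (leq_addr _ _)) // leq_mul2r jn orbT.
  - by rewrite (leq_trans _ (leq_addl _ _)) // leq_add2r leq_mul2r jn orbT.
  rewrite ler_pdivlMr // in j1; rewrite ltr_pdivrMr // -natr1 in j2.
  have -> : t + (j * m')%:R * A' - (j * k' + k0)%:R * B' = t - k0%:R * B' + j%:R * e'.
    by rewrite natrD !natrM e'E; ring.
  by rewrite ler_norml; apply/andP; split; lra.
have neg (M : nat) : (forall t, `|t| <= T -> exists i j : nat,
    [/\ (i <= M)%N, (j <= M)%N & `|t + i%:R * B - j%:R * A| <= l]) ->
   exists M : nat, forall t, `|t| <= T -> exists i j : nat,
    [/\ (i <= M)%N, (j <= M)%N & `|t + i%:R * A - j%:R * B| <= l].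
  move=> h; exists M => t tT; have [|i [j [iM jM hij]]] := h (- t); first by rewrite normrN.
  exists j, i; split => //; rewrite -normrN; apply: le_trans hij.
  by rewrite le_eqVlt; apply/orP; left; apply/eqP; congr (`|_|); ring.
(* Multiplicities must be natural numbers. With [m >= 0 > k], one of [A] and [B] is at most [e] and
   is itself a small enough step; [m < 0 <= k] contradicts [0 < e]; with both negative the two
   numbers exchange roles. *)
case: m k eE => [m|m] [k|k] eE.
- by apply: (gen A B e m k) => //; rewrite ?e0 // eE !pmulrn.
- have [m0|m0] := eqVneq m 0%N; last first.
    apply: (gen A B A 1%N 0%N) => //; last by rewrite mul1r mul0r subr0.
    rewrite A0 /= (le_lt_trans _ el) // eE NegzE mulrNz mulNr opprK.
    have m1 : 1 <= m%:~R :> R by rewrite -[m%:~R]/(m%:R) ler1n lt0n.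
    have k1 : 0 <= k.+1%:~R :> R by rewrite -[k.+1%:~R]/(k.+1%:R).
    by nra.
  have [M HM] : exists M : nat, forall t, `|t| <= T -> exists i j : nat,
      [/\ (i <= M)%N, (j <= M)%N & `|t + i%:R * B - j%:R * A| <= l].
    apply: (gen B A B 1%N 0%N) => //; last by rewrite mul1r mul0r subr0.
    rewrite B0 /= (le_lt_trans _ el) // eE m0 NegzE mulrNz mulNr opprK mul0r add0r.
    by rewrite -[k.+1%:~R]/(k.+1%:R) ler_peMl ?(ltW B0) // ler1n.
  exact: neg HM.
- exfalso; move: e0; rewrite eE NegzE mulrNz mulNr.
  have m1 : 0 <= m.+1%:~R :> R by rewrite -[m.+1%:~R]/(m.+1%:R).
  have k1 : 0 <= k%:~R :> R by rewrite -[k%:~R]/(k%:R).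
  by nra.
- have [M HM] : exists M : nat, forall t, `|t| <= T -> exists i j : nat,
      [/\ (i <= M)%N, (j <= M)%N & `|t + i%:R * B - j%:R * A| <= l].
    apply: (gen B A e k.+1 m.+1) => //; rewrite ?e0 // eE !NegzE !mulrNz.
    by rewrite -[m.+1%:~R]/(m.+1%:R) -[k.+1%:~R]/(k.+1%:R); ring.
  exact: neg HM.
Qed.

(* Dirichlet: put the remainders of [t * A] modulo [B] into [B / l] bins. *)
Lemma commensurable_or_dense (A B l : R) : 0 < A -> 0 < B -> 0 < l ->
  (exists m k : int, 0 < m%:~R * A - k%:~R * B < l) \/
  (exists i j : nat, [/\ (0 < i)%N, (0 < j)%N, j%:R * A = i%:R * B & j%:R <= B / l + 1]).
Proof.
move=> A0 B0 l0.
pose J := (Num.truncn (B / l)).+1.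
have Bl0 : 0 <= B / l by rewrite divr_ge0 ?ltW.
have J1 : B / l < J%:R by exact: truncnS_gt.
have J2 : J%:R <= B / l + 1.
  by rewrite /J -natr1 lerD2r; have /andP[] := truncn_itv Bl0.
have Jl : B / J%:R < l by rewrite ltr_pdivrMr ?ltr0n // mulrC -ltr_pdivrMr.
pose kk (t : nat) := Num.truncn (t%:R * A / B).
pose rr (t : nat) : R := t%:R * A - (kk t)%:R * B.
have rrP t : 0 <= rr t < B.
  have h : 0 <= t%:R * A / B by rewrite divr_ge0 ?mulr_ge0 ?(ltW A0) ?(ltW B0).
  have /andP[h1 h2] := truncn_itv h; rewrite -/(kk t) in h1 h2.
  rewrite ler_pdivlMr // in h1; rewrite ltr_pdivrMr // -natr1 in h2.
  by rewrite /rr; apply/andP; split; lra.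
pose bin (t : 'I_J.+1) : 'I_J := inord (Num.truncn (rr t / B * J%:R)).
have binP t : 0 <= rr t / B * J%:R < J%:R.
  have /andP[h1 h2] := rrP t.
  rewrite mulr_ge0 ?divr_ge0 ?(ltW B0) //= gtr_pMl ?ltr0n // ltr_pdivrMr // mul1r //.
have binE t : bin t = Num.truncn (rr t / B * J%:R) :> nat.
  rewrite /bin inordK //; have /andP[h1 h2] := binP t.
  by rewrite -(ltr_nat R) (le_lt_trans _ h2) //; have /andP[] := truncn_itv h1.
have ninj : ~~ injectiveb bin.
  apply/negP => /injectiveP inj; have := leq_card _ inj; by rewrite !card_ord ltnn.
have [t1 [t2 [t12 bt]]] : exists t1 t2 : 'I_J.+1, (t1 < t2)%N /\ bin t1 = bin t2.
  have /injectivePn[u [v uv buv]] := ninj.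
  have : (u != v :> nat) by [].
  by rewrite neq_ltn => /orP[] lt; [exists u, v|exists v, u].
have close : `|rr t2 - rr t1| < l.
  have := congr1 (@nat_of_ord _) bt; rewrite !binE => E.
  have /andP[a1 _] := binP t1; have /andP[b1 _] := binP t2.
  have /andP[a2 a3] := truncn_itv a1; have /andP[b2 b3] := truncn_itv b1.
  rewrite E in a2 a3; rewrite -natr1 in a3 b3.
  have J0 : 0 < J%:R :> R by rewrite ltr0n.
  have : `|rr t2 / B * J%:R - rr t1 / B * J%:R| < 1 by rewrite ltr_norml; apply/andP; split; lra.
  have -> : rr t2 / B * J%:R - rr t1 / B * J%:R = (rr t2 - rr t1) * (J%:R / B) by ring.
  have JB : 0 < J%:R / B by rewrite divr_gt0.
  rewrite normrM (gtr0_norm JB) -ltr_pdivlMr // div1r invf_div => h.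
  exact: lt_trans Jl.
have rE : rr t2 - rr t1 = (t2 - t1)%N%:R * A - ((kk t2)%:R - (kk t1)%:R) * B.
  by rewrite /rr natrB 1?ltnW //; ring.
set d := (t2 - t1)%N in rE; have d0 : (0 < d)%N by rewrite subn_gt0.
move: close; rewrite ltr_norml => /andP[cl1 cl2].
have [lt0|gt0|eq0] := ltgtP (rr t2 - rr t1) 0.
- left; exists (- d%:Z), ((kk t1)%:Z - (kk t2)%:Z).
  have -> : (- d%:Z)%:~R * A - ((kk t1)%:Z - (kk t2)%:Z)%:~R * B = - (rr t2 - rr t1).
    by rewrite rE rmorphN rmorphB /= -!pmulrn; ring.
  by apply/andP; split; lra.
- left; exists d%:Z, ((kk t2)%:Z - (kk t1)%:Z).
  have -> : (d%:Z)%:~R * A - ((kk t2)%:Z - (kk t1)%:Z)%:~R * B = rr t2 - rr t1.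
    by rewrite rE rmorphB /= -!pmulrn; ring.
  by rewrite gt0 cl2.
right; rewrite rE in eq0.
have dA : 0 < d%:R * A by rewrite mulr_gt0 ?ltr0n.
have dif : 0 < (kk t2)%:R - (kk t1)%:R :> R by rewrite -(pmulr_lgt0 _ B0); lra.
have kk12 : (kk t1 < kk t2)%N by rewrite -(ltr_nat R); lra.
exists (kk t2 - kk t1)%N, d; split => //; first by rewrite subn_gt0.
  by rewrite (natrB _ (ltnW kk12)); apply/eqP; rewrite -subr_eq0; apply/eqP.
apply: le_trans J2; rewrite ler_nat /d.
by rewrite (leq_trans (leq_subr _ _)) // -ltnS ltn_ord.
Qed.

Lemma near_one (rho u : R) : rho <= 1 -> `|u - 1| <= rho / 3 -> 0 <= u <= 2.
Proof. by rewrite ler_norml => r1 /andP[? ?]; apply/andP; split; lra. Qed.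

Lemma collision_sum (a b c rX : R) : `|a| <= 2 * rX -> `|b| <= rX / 3 -> `|c| <= 2 / 3 * rX ->
  `|a - b - c| <= 3 * rX.
Proof.
move=> ha hb hc; apply: le_trans (ler_normB _ _) _.
apply: le_trans (lerD (ler_normB _ _) (lexx _)) _.
by move: (`|a|) (`|b|) (`|c|) ha hb hc => *; lra.
Qed.

(** Here [dx], [dy] are displacements in the model tree and [dX], [dY] their images under the words
    of the state; [u1], [u2] are distortion errors and [u3] is the alignment error of the slope
    ratio. The diameter of the small set and the linearisation of [H] cost one unit [rho * X] each,
    the factors [u1] and [u2 * u3] cost [1 / 3] and [2 / 3]: together 3. *)
Lemma robust_collision (p q e s1 s2 lam mu u1 u2 u3 c K X rho eta dU H dX dY dx dy : R) :
  p != 0 -> q != 0 -> `|s1| = 1 -> `|s2| = 1 -> `|e| = 1 -> q * s2 = e * (`|q| / `|p|) * (p * s1) ->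
  0 < lam -> 0 < mu -> 0 < K -> 0 < X -> 0 < rho <= 1 -> 0 <= eta -> 0 < u2 -> 0 < u3 ->
  1 <= c <= 2 -> `|u1 - 1| <= rho / 3 -> `|u2 * u3 - 1| <= rho / 3 ->
  `|q| * mu = c * u3 * K * (`|p| * lam) ->
  dX = s1 * (lam * u1) * dx -> dY = s2 * (mu * u2) * dy ->
  `|dx| <= X -> K * `|dy| <= X ->
  `|H - (p * dX + q * dY)| <= eta * (`|dX| + `|dY|) -> `|H| <= dU ->
  dU <= `|p| * lam * (rho * X) -> eta * (2 / `|p| + 8 / `|q|) <= rho ->
  `|dx + e * K * c * dy| <= 3 * (rho * X).
Proof.
move=> p0 q0 hs1 hs2 he sgn l0 m0 K0 X0 /andP[r0 r1] eta0 u20 u30 /andP[c1 c2] hu1 hu2 al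
  EX EY hx hy hH hU hdU heta.
have P0 : 0 < `|p| by rewrite normr_gt0.
have Q0 : 0 < `|q| by rewrite normr_gt0.
have /andP[u10 u12] := near_one r1 hu1; have /andP[v0 v2] := near_one r1 hu2.
have c0 : 0 <= c := le_trans ler01 c1.
have PL : 0 < `|p| * lam by rewrite mulr_gt0.
set v := u2 * u3 in hu2 v0 v2 *.
have EXY : p * dX + q * dY = p * s1 * lam * (u1 * dx + e * c * v * (K * dy)).
  have -> : q * dY = e * (p * s1) / `|p| * (`|q| * mu) * u2 * dy.
    by rewrite EY !mulrA sgn; ring.
  by rewrite al EX /v; field; rewrite normr_eq0.
have nXY : `|p * dX + q * dY| = `|p| * lam * `|u1 * dx + e * c * v * (K * dy)|.
  by rewrite EXY !normrM hs1 mulr1 (gtr0_norm l0).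
have nX : `|dX| <= 2 * lam * X.
  rewrite EX !normrM hs1 mul1r (gtr0_norm l0) (ger0_norm u10).
  rewrite (mulrC lam); apply: ler_pM => //; first by rewrite mulr_ge0 // ltW.
  by rewrite ler_wpM2r // ltW.
have nY : `|dY| <= 8 / `|q| * (`|p| * lam) * X.
  have -> : `|dY| = c * v * (`|p| * lam) / `|q| * (K * `|dy|).
    rewrite EY !normrM hs2 mul1r (gtr0_norm m0) (gtr0_norm u20).
    have -> : mu = c * u3 * K * (`|p| * lam) / `|q| by rewrite -al; field; rewrite normr_eq0.
    rewrite /v; ring.
  have -> : 8 / `|q| * (`|p| * lam) * X = 8 * (`|p| * lam) / `|q| * X by ring.
  apply: ler_pM => //.
  - by rewrite !mulr_ge0 ?invr_ge0 // ltW.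
  - by rewrite mulr_ge0 // ltW.
  - rewrite ler_wpM2r ?invr_ge0 // ler_wpM2r ?(ltW PL) //.
    apply: (@le_trans _ _ (2 * 2)); first exact: ler_pM.
    by rewrite -natrM ler_nat.
have main : `|u1 * dx + e * c * v * (K * dy)| <= 2 * (rho * X).
  rewrite -(ler_pM2l PL) -nXY.
  have h1 : `|p * dX + q * dY| <= dU + eta * (`|dX| + `|dY|).
    have := ler_normB H (H - (p * dX + q * dY)).
    by rewrite opprB addrC subrK => h; apply: le_trans h _; exact: lerD.
  apply: le_trans h1 _.
  have h2 : eta * (`|dX| + `|dY|) <= `|p| * lam * (rho * X).
    apply: (@le_trans _ _ (eta * (2 * lam * X + 8 / `|q| * (`|p| * lam) * X))).
      by rewrite ler_wpM2l // lerD.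
    have -> : eta * (2 * lam * X + 8 / `|q| * (`|p| * lam) * X) =
      `|p| * lam * (eta * (2 / `|p| + 8 / `|q|) * X).
      by field; rewrite !normr_eq0 p0 q0.
    by rewrite ler_wpM2l ?(ltW PL) // ler_wpM2r // ltW.
  have -> : `|p| * lam * (2 * (rho * X)) = `|p| * lam * (rho * X) + `|p| * lam * (rho * X) by ring.
  exact: lerD.
have -> : dx + e * K * c * dy = (u1 * dx + e * c * v * (K * dy)) - (u1 - 1) * dx -
  e * c * (v - 1) * (K * dy) by ring.
apply: collision_sum main _ _.
  by rewrite normrM mulrAC ler_pM.
have -> : 2 / 3 * (rho * X) = 2 * (rho / 3) * X by ring.
rewrite !normrM he mul1r (ger0_norm c0) (gtr0_norm K0).
by apply: ler_pM; rewrite ?mulr_ge0 ?(ltW K0) //; apply: ler_pM.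
Qed.


End SteeringArithmetic.

(** * Periodic words and their multipliers *)

Section Cycles.
Context {R : realType}.
Variable F : markov_ifs R.
Local Notation tr := (@tr R F).
Implicit Types (a b : alph F) (s u w : seq (alph F)).

Definition lslope a s (y z : R) : R := ln (`|fw a s y - fw a s z| / `|y - z|).

Lemma slope_gt0 a s y z : path tr a s -> inI (last a s) y -> inI (last a s) z -> y != z ->
  0 < `|fw a s y - fw a s z| / `|y - z|.
Proof.
move=> ps hy hz yz; rewrite divr_gt0 ?normr_gt0 ?subr_eq0 //.
by apply: contra yz => /eqP/(fw_inj ps hy hz)/eqP.
Qed.

Lemma lslope_cat a s t y z : path tr a (s ++ t) -> inI (last a (s ++ t)) y ->
  inI (last a (s ++ t)) z -> y != z ->
  lslope a (s ++ t) y z =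
    lslope a s (fw (last a s) t y) (fw (last a s) t z) + lslope (last a s) t y z.
Proof.
rewrite cat_path last_cat => /andP[ps pt] hy hz yz.
have yz' : fw (last a s) t y != fw (last a s) t z.
  by apply: contra yz => /eqP/(fw_inj pt hy hz)/eqP.
rewrite /lslope !fw_cat -lnM ?posrE; last first.
- exact: slope_gt0.
- by apply: slope_gt0 => //; exact: fw_in.
by rewrite mulrA divfK // normr_eq0 subr_eq0.
Qed.

Lemma lslope_dist a s (x y u v l : R) : path tr a s ->
  (forall p, p \in [:: x; y; u; v] -> inI (last a s) p) ->
  (forall p q, p \in [:: x; y; u; v] -> q \in [:: x; y; u; v] -> `|p - q| <= l) ->
  x != y -> u != v -> `|lslope a s x y - lslope a s u v| <= Kd F * l `^ bet F.
Proof.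
move=> ps hI hl xy uv.
have perm p : (p \in [:: u; v; x; y]) = (p \in [:: x; y; u; v]).
  by rewrite !inE; case: (p == x); case: (p == y); case: (p == u); case: (p == v).
have h1 := fw_dist ps hI hl xy uv.
have h2 : `|fw a s u - fw a s v| / `|u - v| <=
    expR (Kd F * l `^ bet F) * (`|fw a s x - fw a s y| / `|x - y|).
  apply: fw_dist => // [p|p q]; rewrite perm; first exact: hI.
  by move=> hp; rewrite perm; exact: hl.
have p1 : 0 < `|fw a s x - fw a s y| / `|x - y|.
  by apply: slope_gt0 => //; apply: hI; rewrite !inE eqxx ?orbT.
have p2 : 0 < `|fw a s u - fw a s v| / `|u - v|.
  by apply: slope_gt0 => //; apply: hI; rewrite !inE eqxx ?orbT.
have lnE (X Y e : R) : 0 < X -> 0 < Y -> X <= expR e * Y -> ln X <= e + ln Y.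
  move=> X0 Y0 h; have eY : 0 < expR e * Y by rewrite mulr_gt0 // expR_gt0.
  by rewrite -[e in leRHS]expRK -lnM ?posrE ?expR_gt0 // ler_ln ?posrE.
have {}h1 := lnE _ _ _ p1 p2 h1; have {}h2 := lnE _ _ _ p2 p1 h2.
by rewrite /lslope ler_norml; apply/andP; split; lra.
Qed.

Lemma lslope_le a s y z : path tr a s -> inI (last a s) y -> inI (last a s) z -> y != z ->
  lslope a s y z <= (size s)%:R * ln (kap F).
Proof.
move=> ps hy hz yz; have k0 := kap_gt0 F.
rewrite mulrC mulr_natr -lnXn // ler_ln ?posrE ?exprn_gt0 ?slope_gt0 //.
have /andP[_ h] := fw_le ps hy hz; rewrite ler_pdivrMr //.
by rewrite normr_gt0 subr_eq0.
Qed.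

Definition rep u k : seq (alph F) := flatten (nseq k u).

Lemma repS u k : rep u k.+1 = u ++ rep u k. Proof. by []. Qed.

Lemma repD u j k : rep u (j + k) = rep u j ++ rep u k.
Proof. by rewrite /rep nseqD flatten_cat. Qed.

Lemma rep_path a u k : path tr a u -> last a u = a ->
  path tr a (rep u k) /\ last a (rep u k) = a.
Proof.
move=> pu lu; elim: k => //= k [IH1 IH2].
by rewrite repS cat_path last_cat pu lu IH1.
Qed.

Lemma rep_size u k : u != [::] -> (k <= size (rep u k))%N.
Proof. by case: u => // b u _; elim: k => // k IH; rewrite repS size_cat /= ltnS (leq_trans IH) // leq_addl. Qed.

Definition is_cycle a u (x : R) := [/\ path tr a u, last a u = a, u != [::], inI a x & fw a u x = x].

(* [expR (- A)] is the absolute derivative of [fw a u] at its fixed point [x]. *)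
Definition multiplier a u (x A : R) := [/\ is_cycle a u x, 0 < A &
  exists2 D, 0 <= D & forall d y z, inI a y -> inI a z -> y != z ->
    `|y - x| <= d -> `|z - x| <= d -> `|lslope a u y z + A| <= D * d `^ bet F].

Lemma rep_fix a u x k : is_cycle a u x -> fw a (rep u k) x = x.
Proof.
by move=> [pu lu _ _ fx]; elim: k => //= k IH; rewrite repS fw_cat lu IH.
Qed.

Lemma kapX_lt (e : R) : 0 < e -> exists n, kap F ^+ n < e.
Proof. by move=> e0; apply: exists_expr_lt => //; have := kap_gt0 F; have := kap_lt1 F; lra. Qed.

Lemma kapb_small (C e : R) : 0 < e -> exists n, C * (kap F ^+ n) `^ bet F <= e.
Proof.
move=> e0; have [k0 k1] := andP (kapb_lt1 F).
have [n hn] := @exists_expr_lt R (kap F `^ bet F) (e / (`|C| + 1)) ltac:(lra)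
   (divr_gt0 e0 (ltr_wpDl (normr_ge0 C) ltr01)).
exists n; have -> : (kap F ^+ n) `^ bet F = (kap F `^ bet F) ^+ n.
  by rewrite -powR_mulrn ?(ltW (kap_gt0 F)) // powRAC powR_mulrn // powR_ge0.
rewrite ltr_pdivlMr ?ltr_wpDl // in hn.
have p0 : 0 <= (kap F `^ bet F) ^+ n by rewrite exprn_ge0 // ltW.
have := ler_norm C; set p := _ ^+ n in hn p0 *; nra.
Qed.

(** The cylinders of the powers of [u] shrink to one point, and its image under [fw a u] lies in the
    same cylinders. *)
Lemma cycle_fixpoint a u : path tr a u -> last a u = a -> u != [::] ->
  exists x, is_cycle a u x.
Proof.
move=> pu lu u0.
have rp k := rep_path k pu lu.
have [x xl cx] : exists2 x, limset F x & forall k, cyl a (rep u k) x.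
  apply: (@nested_point _ F a (rep u) (fun=> u)) => // k; last by have [] := rp k.
  by rewrite -addn1 repD /= /rep /= cats0.
exists x; have xI : inI a x by have := cx 0%N; move=> [y yI <-].
split => //; apply/eqP; rewrite -subr_eq0 -normr_le0 leNgt; apply/negP => d0.
have [n hn] := kapX_lt d0.
have [p1 l1] := rp n.
have c2 : cyl a (rep u n) (fw a u x).
  have [p2 l2] := rp n.+1; rewrite -addn1 repD in p2; apply: (cyl_sub p2).
  rewrite -repD addn1 repS; apply/cyl_cat; last by exists x; rewrite ?lu.
  by rewrite -repS -addn1 repD.
have h := le_trans (cyl_dist p1 c2 (cx n)) (len_le_kap p1).
have h2 : kap F ^+ size (rep u n) <= kap F ^+ n.
  by apply: ler_wiXn2l; [exact: ltW (kap_gt0 F)|have := kap_lt1 F; lra|exact: rep_size].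
by have := le_lt_trans (le_trans h h2) hn; rewrite ltxx.
Qed.

(** Only secants are controlled, so the logarithmic derivative at [x] has to be built as the limit
    of [phi y] when [y] tends to [x]. Distortion makes [phi] Hoelder at [x], and the limit is the
    supremum of the lower estimates collected in [S]. *)
Lemma multiplier_exists a u x : is_cycle a u x -> exists A, multiplier a u x A.
Proof.
move=> cyc; have [pu lu u0 xI fx] := cyc.
have b0 := bet_gt0 F; have K0 := Kd_ge0 F.
(* Points within [d] of [x] are within [2 * d] of each other. *)
pose K2 := Kd F * 2 `^ bet F.
have K20 : 0 <= K2 by rewrite mulr_ge0 ?powR_ge0.
have KK (d : R) : 0 <= d -> Kd F * (2 * d) `^ bet F = K2 * d `^ bet F.
  by move=> d0; rewrite powRM // mulrA.
pose phi y := - lslope a u x y.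
have dphi y y' (d : R) : inI a y -> inI a y' -> y != x -> y' != x -> `|y - x| <= d -> `|y' - x| <= d ->
    `|phi y - phi y'| <= K2 * d `^ bet F.
  move=> yI y'I yx y'x yd y'd; have d0 : 0 <= d by exact: le_trans yd.
  rewrite /phi -opprD normrN -KK //; apply: lslope_dist => //; rewrite ?(eq_sym x) //.
  - by move=> p; rewrite !inE => /or4P[] /eqP->; rewrite lu.
  - have dx p : p \in [:: x; y; x; y'] -> `|p - x| <= d.
      by rewrite !inE => /or4P[] /eqP->; rewrite ?subrr ?normr0.
    move=> p q /dx hp /dx hq; apply: le_trans (ler_distD x _ _) _.
    by rewrite (distrC x q) [leRHS](_ : _ = d + d) ?lerD //; ring.
have [y0 y0I y0x] : exists2 y, inI a y & y != x.
  have [e|] := eqVneq (base a) x; last by exists (base a) => //; exact: baseI.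
  exists (base a + 1); first exact: baseI1.
  by rewrite -e -subr_eq0 addrC addKr oner_eq0.
pose S := [set phi y - K2 * `|y - x| `^ bet F | y in [set y | inI a y && (y != x)]].
have S0 : S !=set0 by exists (phi y0 - K2 * `|y0 - x| `^ bet F); exists y0 => //=; rewrite y0I.
have ub y' : inI a y' -> y' != x -> ubound S (phi y' + K2 * `|y' - x| `^ bet F).
  move=> y'I y'x _ [y /andP[yI yx] <-].
  have mono p q : 0 <= p -> p <= q -> K2 * p `^ bet F <= K2 * q `^ bet F.
    by move=> hp pq; rewrite ler_wpM2l // le_powR // ltW.
  have p1 : 0 <= K2 * `|y - x| `^ bet F by rewrite mulr_ge0 ?powR_ge0.
  have p2 : 0 <= K2 * `|y' - x| `^ bet F by rewrite mulr_ge0 ?powR_ge0.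
  have [le|/ltW le] := leP `|y - x| `|y' - x|.
    by have := dphi y y' _ yI y'I yx y'x le (lexx _); rewrite ler_norml => /andP[_]; lra.
  by have := dphi y y' _ yI y'I yx y'x (lexx _) le; rewrite ler_norml => /andP[_]; lra.
have supS : has_sup S by split => //; exists (phi y0 + K2 * `|y0 - x| `^ bet F); exact: ub.
exists (sup S).
have key y : inI a y -> y != x -> `|phi y - sup S| <= K2 * `|y - x| `^ bet F.
  move=> yI yx; rewrite ler_norml; apply/andP; split.
    have := ge_sup S0 (ub y yI yx); lra.
  have : phi y - K2 * `|y - x| `^ bet F <= sup S.
    by apply: ub_le_sup; [case: supS|exists y => //=; rewrite yI].
  lra.
split => //.
  have lk : ln (kap F) < 0 by rewrite ln_lt0 // kap_gt0 /=; have := kap_lt1 F; lra.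
  (* The iterates of [y0] approach [x], where [phi] is close to [sup S]; but contraction keeps [phi]
     at least [- ln (kap F) > 0]. *)
  rewrite ltNge; apply/negP => A0.
  have [n hn] := @kapb_small K2 (- ln (kap F) / 2) ltac:(lra).
  have [pn ln'] := rep_path n pu lu.
  have ynx : fw a (rep u n) y0 != x.
    apply: contra y0x => /eqP e; apply/eqP; apply: (fw_inj pn); rewrite ?ln' //.
    by rewrite e rep_fix.
  have ynI : inI a (fw a (rep u n) y0) by apply: fw_in; rewrite ?ln'.
  have := key _ ynI ynx; rewrite ler_norml => /andP[_ h].
  have hl : lslope a u x (fw a (rep u n) y0) <= ln (kap F).
    apply: le_trans (lslope_le pu _ _ _) _; rewrite ?lu //; first by rewrite eq_sym.
    by rewrite ler_neMl ?(ltW lk) // ler1n lt0n size_eq0.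
  have hd : K2 * `|fw a (rep u n) y0 - x| `^ bet F <= K2 * (kap F ^+ n) `^ bet F.
    rewrite ler_wpM2l // le_powR ?(ltW b0) // -{1}(rep_fix n cyc).
    have := @fw_le _ F a (rep u n) y0 x pn; rewrite ln' => /(_ y0I xI)/andP[_ h1].
    apply: le_trans h1 _.
    have h2 : kap F ^+ size (rep u n) <= kap F ^+ n.
      by apply: ler_wiXn2l; [exact: ltW (kap_gt0 F)|have := kap_lt1 F; lra|exact: rep_size].
    apply: le_trans h2; apply: ler_piMr; last exact: inI_dist y0I xI.
    by rewrite exprn_ge0 // ltW // kap_gt0.
  have fin (l A t v k : R) : - l - A <= t -> l <= k -> t <= v -> v <= - k / 2 ->
    k < 0 -> A <= 0 -> False by lra.
  exact: fin h hl hd hn lk A0.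
exists (2 * K2); first by rewrite mulr_ge0.
move=> d y z yI zI yz yd zd; have d0 : 0 <= d by exact: le_trans yd.
have [v [wI wx wd wyz]] : exists v, [/\ inI a v, v != x, `|v - x| <= d & v \in [:: y; z]].
  have [e|yx] := eqVneq y x; last by exists y; rewrite !inE eqxx.
  by exists z; split; rewrite ?inE ?eqxx ?orbT // -e eq_sym.
have h1 := key v wI wx.
have h1' : `|phi v - sup S| <= K2 * d `^ bet F.
  by apply: le_trans h1 _; rewrite ler_wpM2l // le_powR // ltW.
have h2 : `|lslope a u y z - lslope a u x v| <= K2 * d `^ bet F.
  rewrite -KK //; apply: lslope_dist => //; rewrite ?(eq_sym x) //.
  - by move=> p; rewrite !inE => /or4P[] /eqP->; rewrite lu.
  - have dx p : p \in [:: y; z; x; v] -> `|p - x| <= d.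
      by rewrite !inE => /or4P[] /eqP->; rewrite ?subrr ?normr0.
    move=> p q /dx hp /dx hq; apply: le_trans (ler_distD x _ _) _.
    by rewrite (distrC x q) [leRHS](_ : _ = d + d) ?lerD //; ring.
move: h1' h2; rewrite /phi !ler_norml => /andP[+ +] /andP[]; clear => *.
by apply/andP; split; lra.
Qed.

(** At the [j]-th return the points are within [kap F ^+ j * d] of [x], so the errors sum to a bound
    independent of [j]. *)
Lemma multiplier_power a u x A : multiplier a u x A -> exists2 D, 0 <= D &
  forall j d y z, inI a y -> inI a z -> y != z -> `|y - x| <= d -> `|z - x| <= d ->
    `|lslope a (rep u j) y z + j%:R * A| <= D * d `^ bet F.
Proof.
move=> [cyc A0 [D D0 HD]]; have [pu lu u0 xI fx] := cyc.
have [k0 k1] := andP (kapb_lt1 F); set q := kap F `^ bet F in k0 k1.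
exists (D / (1 - q)); first by rewrite divr_ge0 // subr_ge0 ltW.
move=> j d y z yI zI yz yd zd; have d0 : 0 <= d by exact: le_trans yd.
suff : `|lslope a (rep u j) y z + j%:R * A| <= D / (1 - q) * d `^ bet F * (1 - q ^+ j).
  move=> h; apply: le_trans h _.
  have : 0 <= D / (1 - q) * d `^ bet F by rewrite !mulr_ge0 ?powR_ge0 // invr_ge0 subr_ge0 ltW.
  have : 0 <= q ^+ j by rewrite exprn_ge0 // ltW.
  by set X := D / _ * _; nra.
elim: j => [|j IH].
  rewrite /lslope /= divff ?normr_eq0 ?subr_eq0 // ln1 mul0r addr0 normr0 expr0 subrr mulr0 //.
have [pj lj] := rep_path j pu lu; have [pj1 lj1] := rep_path j.+1 pu lu.
have pj1' : path tr a (u ++ rep u j) := pj1.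
rewrite repS (lslope_cat pj1') ?last_cat ?lu ?lj //.
- rewrite -natr1.
  have ppt p : inI a p -> `|p - x| <= d ->
      inI a (fw a (rep u j) p) /\ `|fw a (rep u j) p - x| <= kap F ^+ j * d.
    move=> pI pd; split; first by apply: fw_in; rewrite ?lj.
    rewrite -{1}(rep_fix j cyc).
    have := @fw_le _ F a (rep u j) p x pj; rewrite lj => /(_ pI xI)/andP[_ h1].
    apply: le_trans h1 _; apply: ler_pM => //; rewrite ?exprn_ge0 ?(ltW (kap_gt0 F)) //.
    by apply: ler_wiXn2l; [exact: ltW (kap_gt0 F)|have := kap_lt1 F; lra|exact: rep_size].
  have [y1 y2] := ppt y yI yd; have [z1 z2] := ppt z zI zd.
  have yz1 : fw a (rep u j) y != fw a (rep u j) z.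
    by apply: contra yz => /eqP e; apply/eqP; apply: (fw_inj pj); rewrite ?lj.
  have := HD _ _ _ y1 z1 yz1 y2 z2.
  rewrite powRM ?exprn_ge0 ?(ltW (kap_gt0 F)) //.
  have -> : (kap F ^+ j) `^ bet F = q ^+ j.
    by rewrite -powR_mulrn ?(ltW (kap_gt0 F)) // powRAC powR_mulrn // powR_ge0.
  have E : D = D / (1 - q) * (1 - q) by rewrite divfK // gt_eqF // subr_gt0.
  rewrite {1}E; set X := D / (1 - q) in IH *; set Z := d `^ bet F in IH *.
  move: IH; rewrite !ler_norml exprS => /andP[+ +] /andP[]; clear => *.
  by apply/andP; split; lra.
Qed.

(** On the cylinder of [m0] repetitions every prefix [P] has almost constant logarithmic slope, by
    distortion, and each further repetition lowers it by [A]. The number [m0] depends neither on [P]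
    nor on [m], so words of any length are controlled with the same precision. *)
Lemma steer_word a u x A (e : R) : multiplier a u x A -> 0 < e -> exists m0 : nat,
  forall b P, path tr b P -> last b P = a -> exists L : R,
  forall m y z, cyl a (rep u m0) y -> cyl a (rep u m0) z -> y != z ->
    `|lslope b (P ++ rep u m) y z - (L - m%:R * A)| <= e.
Proof.
move=> mul e0; have [cyc A0 _] := mul; have [pu lu u0 xI fx] := cyc.
have [D D0 HD] := multiplier_power mul.
have [m0 hm0] := kapb_small (Kd F + D) e0.
exists m0 => b P pP lP; set w := rep u m0.
have [pw lw] : path tr a w /\ last a w = a by exact: rep_path.
exists (lslope b P (lo_w a w) (lo_w a w + len_w a w)) => m y z cy cz yz.
have [pm lm] := rep_path m pu lu.
have lenw : len_w a w <= kap F ^+ m0.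
  apply: le_trans (len_le_kap pw) _.
  by apply: ler_wiXn2l; [exact: ltW (kap_gt0 F)|have := kap_lt1 F; lra|exact: rep_size].
have clo := cyl_lo pw; have l0 := len_w_gt0 pw.
have chi : cyl a w (lo_w a w + len_w a w) by apply/(cylE _ pw); rewrite lexx lerDl ltW.
have cx : cyl a w x by exists x => /=; rewrite ?lw // rep_fix.
have step p : cyl a w p -> cyl a w (fw a (rep u m) p).
  move=> cp; have pmw : path tr a (w ++ rep u m) by rewrite -repD; have [] := rep_path (m0 + m) pu lu.
  apply: (cyl_sub pmw); rewrite -repD addnC repD; apply/cyl_cat; last by exists p; rewrite ?lm.
  by rewrite -repD; have [] := rep_path (m + m0) pu lu.
have yI := cyl_inI pw cy; have zI := cyl_inI pw cz.
rewrite lslope_cat ?last_cat ?cat_path ?pP ?lP ?lm //.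
have cy' := step y cy; have cz' := step z cz.
have yz' : fw a (rep u m) y != fw a (rep u m) z.
  by apply: contra yz => /eqP e1; apply/eqP; apply: (fw_inj pm); rewrite ?lm.
have h1 : `|lslope b P (fw a (rep u m) y) (fw a (rep u m) z) -
    lslope b P (lo_w a w) (lo_w a w + len_w a w)| <= Kd F * (kap F ^+ m0) `^ bet F.
  have inw p : p \in [:: fw a (rep u m) y; fw a (rep u m) z; lo_w a w; lo_w a w + len_w a w] ->
      cyl a w p by rewrite !inE => /or4P[] /eqP->.
  apply: lslope_dist => //.
  - by move=> p /inw/(cyl_inI pw); rewrite lP.
  - by move=> p q /inw hp /inw hq; exact: le_trans (cyl_dist pw hp hq) lenw.
  - by rewrite -subr_eq0 opprD addrA subrr sub0r oppr_eq0 gt_eqF.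
have h2 := HD m (kap F ^+ m0) y z yI zI yz
  (le_trans (cyl_dist pw cy cx) lenw) (le_trans (cyl_dist pw cz cx) lenw).
rewrite mulrDl in hm0.
move: hm0 h1 h2; rewrite !ler_norml => + /andP[+ +] /andP[]; clear => *.
by apply/andP; split; lra.
Qed.

End Cycles.

(** * Depth of a block, and slopes of extended words *)

Section MacroStep.
Context {R : realType}.

(** Path selection keeps the exponent of [(q - 2) * p] levels out of [q * p] and loses a factor
    [q * Cd] per level. A large [q] makes the remaining exponent exceed [sigma], a small [rho] beats
    [q * Cd], and the surplus factor 2 per unit of [p] beats any prescribed loss [Gam]. *)
Lemma choose_parameters (s0 sigma : R) (Cd : nat) : 0 < sigma < s0 -> (0 < Cd)%N ->
  exists (q : nat) (rho1 : R), [/\ (1 < q)%N, 0 < rho1 &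
    forall rho (N : nat) (Gam : R), 0 < rho <= rho1 -> rho `^ (- s0) <= N%:R -> 1 <= Gam ->
    exists p : nat, (0 < p)%N /\ forall M : nat, (N ^ (q * p) <= 2 * M)%N ->
      (N ^ (2 * p) * (q * Cd) ^ (q * p))%:R <= M%:R * (rho ^+ (q * p) / Gam) `^ sigma].
Proof.
move=> /andP[sig0 sigs] Cd0.
pose q := (Num.truncn (2 * s0 / (s0 - sigma))).+3.
have d0 : 0 < s0 - sigma by lra.
have hq : 2 * s0 / (s0 - sigma) < q%:R.
  by apply: lt_le_trans (truncnS_gt _) _; rewrite ler_nat; exact: leqW (leqnSn _).
(* Exponent of [1 / rho] left over in [q] levels; it is positive exactly when [q] exceeds
   [2 * s0 / (s0 - sigma)]. *)
pose zeta := s0 * (q - 2)%:R - sigma * q%:R.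
have zeta0 : 0 < zeta.
  rewrite /zeta natrB; last by [].
  by rewrite ltr_pdivrMr // in hq; lra.
pose B := ((q * Cd) ^ q)%:R : R.
have B1 : 1 <= B by rewrite ler1n expn_gt0 muln_gt0 Cd0.
exists q, ((2 * B) `^ (- zeta^-1)); split; first by [].
  by rewrite powR_gt0 // mulr_gt0 //; lra.
move=> rho N Gam /andP[rho0 rho1] hN Gam1.
have r0 : 0 <= rho by exact: ltW.
have hz : 2 * B <= rho `^ (- zeta).
  have B20 : 0 <= 2 * B by lra.
  have := le_powR (ltW zeta0) r0 rho1.
  rewrite -powRrM mulNr mulVf ?gt_eqF // powR_inv1 // => h.
  rewrite powRN -[leLHS]invrK lef_pV2 ?posrE ?powR_gt0 // invr_gt0; lra.
pose rs := (rho ^+ q) `^ sigma.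
have rs0 : 0 < rs by rewrite powR_gt0 // exprn_gt0.
have Z2 : 2 * B <= (N ^ (q - 2))%:R * rs.
  apply: (le_trans hz); have -> : rho `^ (- zeta) = (rho `^ (- s0)) ^+ (q - 2) * rs.
    rewrite /rs -powR_mulrn ?powR_ge0 // -powRrM -(powR_mulrn q r0) -powRrM -powRD; last first.
      by rewrite (gt_eqF rho0) implybT.
    by congr (_ `^ _); rewrite /zeta; ring.
  rewrite natrX ler_wpM2r ?(ltW rs0) //; apply: lerXn2r => //; rewrite nnegrE ?powR_ge0 //.
(* The factor 2 in front of [Gam] accounts for the half of the paths that selection may discard. *)
have [p hp] : exists p : nat, 2 * Gam `^ sigma <= 2 ^+ p.
  exists (Num.truncn (2 * Gam `^ sigma)).+1.
  apply: le_trans (ltW (truncnS_gt _)) _; rewrite -natrX ler_nat.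
  exact: ltnW (ltn_expl _ _).
have G0 : 0 < Gam `^ sigma by rewrite powR_gt0 //; lra.
exists p.+1; split => // M hM.
have E1 : (rho ^+ (q * p.+1) / Gam) `^ sigma = rs ^+ p.+1 / Gam `^ sigma.
  have -> : (rho ^+ (q * p.+1) / Gam) `^ sigma = (rho ^+ (q * p.+1)) `^ sigma * Gam^-1 `^ sigma.
    by rewrite powRM ?exprn_ge0 // invr_ge0; lra.
  rewrite -(@powR_inv1 _ Gam); last by lra.
  rewrite -powRrM mulN1r powRN; congr (_ * _).
  by rewrite /rs exprM -[RHS]powR_mulrn ?powR_ge0 // [RHS]powRAC powR_mulrn ?exprn_ge0.
rewrite E1 mulrA ler_pdivlMr //.
have M2 : (N ^ (q * p.+1))%:R <= 2 * M%:R :> R by rewrite -natrM ler_nat.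
have q2 : (2 <= q)%N by [].
have E2 : (N ^ (q * p.+1))%:R = (N ^ (2 * p.+1))%:R * ((N ^ (q - 2))%:R) ^+ p.+1 :> R.
  rewrite -natrX -natrM -expnM -expnD; congr (_%:R); congr (_ ^ _)%N.
  by rewrite -mulnDl subnKC.
have h1 : (2 * B) ^+ p.+1 <= ((N ^ (q - 2))%:R * rs) ^+ p.+1.
  apply: lerXn2r => //; rewrite nnegrE; first by lra.
  by rewrite mulr_ge0 // ltW.
rewrite !exprMn in h1.
have -> : (N ^ (2 * p.+1) * (q * Cd) ^ (q * p.+1))%:R = (N ^ (2 * p.+1))%:R * B ^+ p.+1 :> R.
  by rewrite natrM /B -natrX -expnM.
have Bp : 0 < B ^+ p.+1 by rewrite exprn_gt0 //; lra.
have hp1 : 2 * Gam `^ sigma <= 2 ^+ p.+1.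
  by apply: le_trans hp _; rewrite exprS ler_peMl ?exprn_ge0 // ler1n.
have rsp : 0 < rs ^+ p.+1 by rewrite exprn_gt0.
set a := (N ^ (2 * p.+1))%:R in E2 *; set c := _ ^+ p.+1 in E2 h1.
have a0 : 0 <= a by rewrite /a.
rewrite -(ler_pM2l (_ : 0 < 2 :> R)) // [leRHS]mulrA.
apply: (@le_trans _ _ (a * c * rs ^+ p.+1)); last first.
  by rewrite -E2 ler_wpM2r // ltW.
rewrite -mulrA; have -> : 2 * (a * B ^+ p.+1 * Gam `^ sigma) = a * ((2 * Gam `^ sigma) * B ^+ p.+1) by ring.
rewrite ler_wpM2l //; apply: le_trans h1.
by rewrite ler_wpM2r // ltW.
Qed.

Variable F : markov_ifs R.

(** Even powers of the periodic word preserve the orientation, so steering does not move the target,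
    which depends on it. *)
Lemma sgw_even a u i : path (@tr _ F) a u -> last a u = a -> sgw a (rep u (2 * i)) = false.
Proof.
move=> pu lu; elim: i => // i IH.
have -> : (2 * i.+1 = 2 + 2 * i)%N by lia.
rewrite repD sgw_cat (rep_path 2 pu lu).2 IH addbF /rep /= cats0 sgw_cat lu.
by rewrite addbb.
Qed.

Definition good_slope (w : seq (alph F)) (eps : R) a b P (L : R) :=
  [/\ path (@tr _ F) b P, last b P = a & forall y z, cyl a w y -> cyl a w z -> y != z ->
    `|lslope b P y z - L| <= eps].

(** Logarithmic error made when the slope of a block followed by a connector is replaced by the
    nominal length of the block. *)
Definition E0 : R := ln (Q F / (c1 F * connector_slope F)).

(** The slope of the extended word is estimated in two ways. Adding the length of the block to the
    old slope locates it up to [2 * eps + E0], whatever [n] is; the steering property at the new end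
    gives back precision [eps], so errors do not accumulate over blocks. *)
Lemma extend_slope a u x A m0 (eps : R) : multiplier a u x A ->
  (forall b P, path (@tr _ F) b P -> last b P = a -> exists L : R,
    forall m y z, cyl a (rep u m0) y -> cyl a (rep u m0) z -> y != z ->
    `|lslope b (P ++ rep u m) y z - (L - m%:R * A)| <= eps) ->
  forall b P (L rho : R) n s, 0 < rho -> good_slope (rep u m0) eps a b P L ->
    node rho a (rep u m0) n s ->
  exists t (L1 : R), [/\ t != [::],
     `|L1 - (L + ln (rho ^+ n * len_w a (rep u m0)))| <= 2 * eps + E0 &
     forall m, good_slope (rep u m0) eps a b ((P ++ rep u m0 ++ s ++ t) ++ rep u m) (L1 - m%:R * A)].
Proof.
move=> [[pu lu u0 xI fx] A0 _] Hst b P L rho n s rho0 [pP lP slP] [pws /andP[ls1 ls2]].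
set w := rep u m0 in Hst slP pws ls1 ls2 *.
have [pw lw] : path (@tr _ F) a w /\ last a w = a by exact: rep_path.
pose e := last a (w ++ s); have [pt lt t0] := connectorP e a; set t := connector e a in pt lt t0.
have pwst : path (@tr _ F) a (w ++ s ++ t) by rewrite catA cat_path pws.
have lwst : last a (w ++ s ++ t) = a by rewrite catA last_cat.
have pP1 : path (@tr _ F) b (P ++ w ++ s ++ t) by rewrite cat_path pP lP.
have lP1 : last b (P ++ w ++ s ++ t) = a by rewrite last_cat lP.
have [L1 HL1] := Hst b _ pP1 lP1.
exists t, L1; split => //; last first.
  move=> m; have [pm lm] := rep_path m pu lu; split.
  - by rewrite cat_path pP1 lP1.
  - by rewrite last_cat lP1.
  - by move=> y z; exact: HL1.
have clo := cyl_lo pw; have l0 := len_w_gt0 pw.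
set y := lo_w a w in clo; set z := lo_w a w + len_w a w.
have chi : cyl a w z by apply/(cylE _ pw); rewrite lexx lerDl ltW.
have yz : y != z by rewrite -subr_eq0 opprD addrA subrr sub0r oppr_eq0 gt_eqF.
have h0 := HL1 0%N y z clo chi yz; rewrite mul0r subr0 cats0 in h0.
have yI := cyl_inI pw clo; have zI := cyl_inI pw chi.
have sub p : inI a p -> cyl a w (fw a (w ++ s ++ t) p).
  by move=> pI; apply: (cyl_sub pwst); exists p; rewrite ?lwst.
have yz' : fw a (w ++ s ++ t) y != fw a (w ++ s ++ t) z.
  by apply: contra yz => /eqP e1; apply/eqP; apply: (fw_inj pwst); rewrite ?lwst.
have h1 := slP _ _ (sub y yI) (sub z zI) yz'.
have E1 := @lslope_cat _ F b P (w ++ s ++ t) y z pP1.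
rewrite lP1 lP in E1; have {}E1 := E1 yI zI yz.
have l1 : 0 < len_w a (w ++ s) by exact: len_w_gt0.
have X0 : 0 < rho ^+ n * len_w a w by rewrite mulr_gt0 ?exprn_gt0.
have c10 := c1_gt0 F; have cc0 := connector_slope_gt0 F; have Q0 := Q_gt0 F.
have yz0 : 0 < `|y - z| by rewrite normr_gt0 subr_eq0.
have hyz : `|fw e t y - fw e t z| <= `|y - z|.
  have := @fw_le _ F e t y z pt; rewrite lt => /(_ yI zI)/andP[_ h].
  apply: le_trans h _; apply: ler_piMl => //; apply: exprn_ile1; first exact: ltW (kap_gt0 F).
  by case/andP: (kap_lt1 F) => _ /ltW.
have hyz' : connector_slope F * `|y - z| <= `|fw e t y - fw e t z| by exact: connector_slope_le.
have yt : inI (last a (w ++ s)) (fw e t y) by apply: fw_in; rewrite ?lt.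
have zt : inI (last a (w ++ s)) (fw e t z) by apply: fw_in; rewrite ?lt.
have /andP[g1 g2] := fw_len pws yt zt.
rewrite -!fw_cat -catA in g1 g2.
have S1 : `|fw a (w ++ s ++ t) y - fw a (w ++ s ++ t) z| / `|y - z| <=
    (rho ^+ n * len_w a w) * (Q F / (c1 F * connector_slope F)).
  rewrite ler_pdivrMr //; apply: le_trans g2 _.
  apply: (@le_trans _ _ (Q F * (rho ^+ n * len_w a w) * `|y - z|)).
    by apply: ler_pM; rewrite ?mulr_ge0 ?(ltW Q0) ?(ltW l1) // ler_wpM2l // ltW.
  rewrite ler_wpM2r // mulrC ler_wpM2l ?(ltW X0) //.
  have cp : 0 < c1 F * connector_slope F by exact: mulr_gt0.
  have cl : c1 F * connector_slope F <= 1.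
    by apply: mulr_ile1; [exact: ltW|exact: ltW|exact: ltW (c1_lt1 F)|exact: connector_slope_le1].
  by rewrite (ler_pdivlMr _ _ cp); apply: ler_piMr => //; exact: ltW.
have S2 : (rho ^+ n * len_w a w) * (Q F / (c1 F * connector_slope F))^-1 <=
    `|fw a (w ++ s ++ t) y - fw a (w ++ s ++ t) z| / `|y - z|.
  rewrite ler_pdivlMr //; apply: le_trans g1.
  apply: (@le_trans _ _ ((Q F)^-1 * (c1 F * (rho ^+ n * len_w a w)) * (connector_slope F * `|y - z|))).
    by rewrite invf_div le_eqVlt; apply/orP; left; apply/eqP; ring.
  have iQ0 : 0 <= (Q F)^-1 by rewrite invr_ge0 ltW.
  apply: ler_pM.
  - by apply: mulr_ge0 => //; apply: mulr_ge0; exact: ltW.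
  - by apply: mulr_ge0 => //; exact: ltW.
  - exact: ler_wpM2l.
  - exact: hyz'.
have W0 : 0 < Q F / (c1 F * connector_slope F) by apply: divr_gt0 => //; exact: mulr_gt0.
have sl0 : 0 < `|fw a (w ++ s ++ t) y - fw a (w ++ s ++ t) z| / `|y - z|.
  by apply: slope_gt0; rewrite ?lwst.
have k1 : lslope a (w ++ s ++ t) y z <= ln (rho ^+ n * len_w a w) + E0.
  by rewrite /lslope /E0 -lnM ?posrE // ler_ln ?posrE // mulr_gt0.
have k2 : ln (rho ^+ n * len_w a w) - E0 <= lslope a (w ++ s ++ t) y z.
  rewrite /lslope /E0 -lnV ?posrE // -lnM ?posrE ?invr_gt0 // ler_ln ?posrE // mulr_gt0 //.
  by rewrite invr_gt0.
rewrite E1 in h0.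
move: h0 h1 k1 k2; set v1 := lslope b P _ _; set v2 := lslope a _ _ _; set v3 := ln _.
clear; rewrite !ler_norml => /andP[? ?] /andP[? ?] ? ?.
by apply/andP; split; lra.
Qed.

End MacroStep.

(** * The macroscopic tree *)

(** The contribution [r = n * ln rho] of a block is common to both factors and cancels, so the
    misalignment after a block is bounded independently of the depth [n]. *)
Lemma aligned_range (R : realType) (r e e' lx ly v1 v2 L1 L1' c0 w1 w2 l : R) :
  `|c0 + v2 - v1 - w2| <= l -> `|L1 - (v1 + (r + lx))| <= e ->
  `|L1' - (v2 + (r + ly))| <= e' -> 0 <= w1 <= 1 -> 0 <= w2 <= 1 ->
  `|c0 + L1' - L1 - w1| <= `|l| + `|ly| + `|lx| + `|e| + `|e'| + 1.
Proof.
have := ler_norm l; have := ler_norm ly; have := ler_norm (- ly).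
have := ler_norm lx; have := ler_norm (- lx); have := ler_norm e; have := ler_norm e'.
rewrite !normrN.
move: (`|l|) (`|ly|) (`|lx|) (`|e|) (`|e'|) => n1 n2 n3 n4 n5.
rewrite !ler_norml => ? ? ? ? ? ? ? /andP[? ?] /andP[? ?] /andP[? ?] /andP[? ?] /andP[? ?].
by apply/andP; split; lra.
Qed.

Lemma steered_lower (R : realType) (r e lx v1 L1 i M ex : R) :
  `|L1 - (v1 + (r + lx))| <= e -> i <= M -> 0 <= ex ->
  v1 + r - (`|e| + `|lx| + M + ex) <= L1 - i.
Proof.
have := ler_norm (- lx); have := ler_norm e; rewrite normrN.
move: (`|e|) (`|lx|) => n1 n2; rewrite ler_norml => ? ? /andP[? ?] ? ?; lra.
Qed.

Section Steering.
Context {R : realType}.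
Variables F F' : markov_ifs R.

Definition steerable (a : alph F) (u : seq (alph F)) (A eps : R) (m0 : nat) :=
  forall b P, path (@tr _ F) b P -> last b P = a -> exists L : R,
    forall m y z, cyl a (rep u m0) y -> cyl a (rep u m0) z -> y != z ->
    `|lslope b (P ++ rep u m) y z - (L - m%:R * A)| <= eps.

End Steering.

Section MacroState.
Context {R : realType}.
Variables F F' : markov_ifs R.
Variables (a : alph F) (u : seq (alph F)) (x A : R) (m0 : nat).
Variables (a' : alph F') (u' : seq (alph F')) (x' B : R) (m0' : nat).
Variables (eps l c0 : R) (sg0 : bool) (b : alph F) (b' : alph F').
Hypothesis mulA : multiplier a u x A.
Hypothesis mulB : multiplier a' u' x' B.
Hypothesis stA : steerable a u A eps m0.
Hypothesis stB : steerable a' u' B eps m0'.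
(** The logarithms are doubled because the periodic words are inserted an even number of times. *)
Hypothesis dens : exists m k : int, 0 < m%:~R * (2 * A) - k%:~R * (2 * B) < l.

Definition state := ((seq (alph F) * seq (alph F')) * (R * R))%type.

Definition sg_state (v : state) : bool := sg0 (+) (sgw b v.1.1 (+) sgw b' v.1.2).

(* A state [((P, P'), (L, L'))] is a pair of words with approximate logarithmic
   slopes.  It is good when the ratio of its slopes is close to the parameter
   [tgt] at which the projections of the model tree have few collisions; the
   target depends on the relative orientation of the two words. *)
Definition good_state (tgt : bool -> R) (v : state) :=
  [/\ good_slope (rep u m0) eps a b v.1.1 v.2.1,
      good_slope (rep u' m0') eps a' b' v.1.2 v.2.2 &
      `|c0 + v.2.2 - v.2.1 - tgt (sg_state v)| <= l].

Let lX := ln (len_w a (rep u m0)).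
Let lY := ln (len_w a' (rep u' m0')).

Lemma steer_state (T : R) : exists Mst : nat, forall tgt P P' L1 L1',
  (forall m, good_slope (rep u m0) eps a b (P ++ rep u m) (L1 - m%:R * A)) ->
  (forall m, good_slope (rep u' m0') eps a' b' (P' ++ rep u' m) (L1' - m%:R * B)) ->
  (forall tau, `|c0 + L1' - L1 - tgt tau| <= T) ->
  exists i j : nat, [/\ (i <= Mst)%N, (j <= Mst)%N & good_state tgt
    ((P ++ rep u (2 * i), P' ++ rep u' (2 * j)), (L1 - (2 * i)%:R * A, L1' - (2 * j)%:R * B))].
Proof.
have [cycA A0 _] := mulA; have [cycB B0 _] := mulB.
have [m [k mk]] := dens.
have A20 : 0 < 2 * A by rewrite mulr_gt0.
have B20 : 0 < 2 * B by rewrite mulr_gt0.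
have [Mst HM] := @steer_bounded R (2 * A) (2 * B) _ l T m k A20 B20 erefl mk.
exists Mst => tgt P P' L1 L1' g1 g2 hT.
set tau := sg0 (+) (sgw b P (+) sgw b' P').
have [i [j [iM jM hij]]] := HM _ (hT tau).
exists i, j; split => //; split => //=.
have [_ lP _] := g1 0%N; rewrite cats0 in lP.
have [_ lP' _] := g2 0%N; rewrite cats0 in lP'.
have [pu lu _ _ _] := cycA; have [pu' lu' _ _ _] := cycB.
rewrite /sg_state /= !sgw_cat lP lP' !sgw_even // !addbF -/tau.
apply: le_trans hij; rewrite le_eqVlt; apply/orP; left; apply/eqP; congr (`|_|).
by rewrite !natrM; ring.
Qed.

Lemma init_state tgt P P' : (forall tau, 0 <= tgt tau <= 1) ->
  path (@tr _ F) b P -> path (@tr _ F') b' P' ->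
  exists v : state, good_state tgt v /\
    (exists t, v.1.1 = P ++ t) /\ (exists t, v.1.2 = P' ++ t).
Proof.
move=> tgt01 pP pP'.
have [cycA A0 _] := mulA; have [cycB B0 _] := mulB.
have [pu lu _ _ _] := cycA; have [pu' lu' _ _ _] := cycB.
have [p1 l1 _] := connectorP (last b P) a; have [p2 l2 _] := connectorP (last b' P') a'.
pose P1 := P ++ connector (last b P) a; pose P1' := P' ++ connector (last b' P') a'.
have pP1 : path (@tr _ F) b P1 by rewrite cat_path pP.
have lP1 : last b P1 = a by rewrite last_cat.
have pP1' : path (@tr _ F') b' P1' by rewrite cat_path pP'.
have lP1' : last b' P1' = a' by rewrite last_cat.
have [L1 H1] := stA pP1 lP1; have [L1' H1'] := stB pP1' lP1'.
have [Mst HM] := steer_state (`|c0 + L1' - L1| + 1).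
have [|||i [j [_ _ g]]] := HM tgt P1 P1' L1 L1'.
- move=> m; have [pm lm] := rep_path m pu lu.
  by split; [rewrite cat_path pP1 lP1|rewrite last_cat lP1|exact: H1].
- move=> m; have [pm lm] := rep_path m pu' lu'.
  by split; [rewrite cat_path pP1' lP1'|rewrite last_cat lP1'|exact: H1'].
- move=> tau; apply: le_trans (ler_normB _ _) _; rewrite lerD2l ger0_norm; have := tgt01 tau; lra.
eexists; split; first exact: g.
split; rewrite /= -catA; eexists; reflexivity.
Qed.

(** The loss [gam] comes before the depth [n] and the target in the order of quantifiers: both are
    chosen afterwards, in terms of [gam]. *)
Lemma step_state : exists2 gam : R, 0 <= gam & forall tgt (v : state) (rho : R) n s s',
  (forall tau, 0 <= tgt tau <= 1) -> 0 < rho -> good_state tgt v ->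
  node rho a (rep u m0) n s -> node rho a' (rep u' m0') n s' ->
  exists v' : state, [/\ good_state tgt v',
    exists2 t, t != [::] & v'.1.1 = v.1.1 ++ rep u m0 ++ s ++ t,
    exists2 t, t != [::] & v'.1.2 = v.1.2 ++ rep u' m0' ++ s' ++ t,
    v.2.1 + n%:R * ln rho - gam <= v'.2.1 &
    v.2.2 + n%:R * ln rho - gam <= v'.2.2].
Proof.
have [cycA A0 _] := mulA; have [cycB B0 _] := mulB.
have [pu lu _ _ _] := cycA; have [pu' lu' _ _ _] := cycB.
have pw : path (@tr _ F) a (rep u m0) by have [] := rep_path m0 pu lu.
have pw' : path (@tr _ F') a' (rep u' m0') by have [] := rep_path m0' pu' lu'.
have X0 := len_w_gt0 pw; have Y0 := len_w_gt0 pw'.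
pose E := 2 * eps + E0 F; pose E' := 2 * eps + E0 F'.
pose T := `|l| + `|lY| + `|lX| + `|E| + `|E'| + 1.
have [Mst HM] := steer_state T.
pose gam := `|E| + `|E'| + `|lX| + `|lY| + (2 * Mst)%:R * A + (2 * Mst)%:R * B.
have MA : 0 <= (2 * Mst)%:R * A by rewrite mulr_ge0 // ltW.
have MB : 0 <= (2 * Mst)%:R * B by rewrite mulr_ge0 // ltW.
exists gam; first by rewrite !addr_ge0.
move=> tgt v rho n s s' tgt01 rho0 [g1 g2 g3] nd nd'.
have [t [L1 [t0 h1 G1]]] := extend_slope mulA stA rho0 g1 nd.
have [t' [L1' [t0' h2 G2]]] := extend_slope mulB stB rho0 g2 nd'.
have lnE (X : R) : 0 < X -> ln (rho ^+ n * X) = n%:R * ln rho + ln X.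
  by move=> Xp; rewrite lnM ?posrE ?exprn_gt0 // lnXn // mulr_natl.
rewrite lnE // -/lX in h1; rewrite lnE // -/lY in h2.
have hT tau : `|c0 + L1' - L1 - tgt tau| <= T.
  exact: (aligned_range g3 h1 h2 (tgt01 _) (tgt01 _)).
have [i [j [iM jM g]]] := HM tgt _ _ L1 L1' G1 G2 hT.
have iA : (2 * i)%:R * A <= (2 * Mst)%:R * A by rewrite ler_pM2r // ler_nat leq_mul2l iM orbT.
have jB : (2 * j)%:R * B <= (2 * Mst)%:R * B by rewrite ler_pM2r // ler_nat leq_mul2l jM orbT.
eexists; split; first exact: g.
- exists (t ++ rep u (2 * i)); last by rewrite /= -!catA.
  by case: (t) t0.
- exists (t' ++ rep u' (2 * j)); last by rewrite /= -!catA.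
  by case: (t') t0'.
- have ex : 0 <= `|E'| + `|lY| + (2 * Mst)%:R * B by rewrite !addr_ge0.
  apply: le_trans (steered_lower h1 iA ex); rewrite /gam -/E; lra.
- have ex : 0 <= `|E| + `|lX| + (2 * Mst)%:R * A by rewrite !addr_ge0.
  apply: le_trans (steered_lower h2 jB ex); rewrite /gam -/E'; lra.
Qed.

End MacroState.

(** * Collisions seen through a good state *)

Section StateCollision.
Context {R : realType}.

Lemma expR_near1 (t : R) : `|t| <= 2^-1 -> `|expR t - 1| <= 2 * `|t|.
Proof.
move=> h; have h1 := expR_ge1Dx t; have h2 := expR_ge1Dx (- t).
have e0 := expR_gt0 t; rewrite expRN in h2.
have h3 : (1 - t) * expR t <= 1 by rewrite -ler_pdivlMr // div1r.
have := ler_norm t; have := ler_norm (- t); rewrite normrN => t1 t2.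
have n0 := normr_ge0 t.
rewrite ler_norml; apply/andP; split; first by lra.
have [t0|t0] := leP 0 t; last by nra.
by rewrite ger0_norm // in h *; nra.
Qed.

Lemma slope_factor (F : markov_ifs R) (a b : alph F) w P (L eps x1 x2 : R) :
  path (@tr _ F) a w -> last a w = a -> good_slope w eps a b P L ->
  cyl a w x1 -> cyl a w x2 -> 0 <= eps ->
  exists u, [/\ `|ln u| <= eps, 0 < u &
    fw b P x1 - fw b P x2 = (-1) ^+ sgw b P * (expR L * u) * (x1 - x2)].
Proof.
move=> pw lw [pP lP sl] c1 c2 e0.
have [->|ne] := eqVneq x1 x2.
  by exists 1; rewrite ln1 normr0 !subrr mulr0.
have h := sl _ _ c1 c2 ne.
have I1 := cyl_inI pw c1; have I2 := cyl_inI pw c2.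
exists (expR (lslope b P x1 x2 - L)); rewrite expRK expR_gt0; split => //.
rewrite -expRD (_ : L + (lslope b P x1 x2 - L) = lslope b P x1 x2); last by ring.
rewrite /lslope lnK ?posrE.
  by apply: fw_diff; rewrite ?lP.
by apply: slope_gt0; rewrite ?lP.
Qed.

Lemma near_one_of_ln (rho u e : R) : rho <= 1 -> 0 < u -> `|ln u| <= e -> e <= rho / 6 ->
  `|u - 1| <= rho / 3.
Proof.
move=> r1 up h he; rewrite -{1}(@lnK _ u) ?posrE //.
have h2 : `|ln u| <= 2^-1 by lra.
by apply: le_trans (expR_near1 h2) _; lra.
Qed.

Variables F F' : markov_ifs R.

(** Translates a good state into the data of [robust_collision]: the secant factors of the two words
    give the distortion errors, and the alignment condition of the state gives [u3]. *)
Lemma state_collision (a b : alph F) w P (a' b' : alph F') w' P' (L L' : R)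
    (p q c X0 Y0 X rho eta dU H x1 x2 y1 y2 : R) :
  p != 0 -> q != 0 -> 0 < rho <= 1 -> 0 <= eta -> 1 <= c <= 2 -> 0 < X0 -> 0 < Y0 -> 0 < X ->
  path (@tr _ F) a w -> last a w = a -> path (@tr _ F') a' w' -> last a' w' = a' ->
  good_slope w (rho / 12) a b P L -> good_slope w' (rho / 12) a' b' P' L' ->
  `|ln `|q| - ln `|p| + ln Y0 - ln X0 + L' - L - ln c| <= rho / 12 ->
  cyl a w x1 -> cyl a w x2 -> cyl a' w' y1 -> cyl a' w' y2 ->
  `|x1 - x2| <= X -> X0 / Y0 * `|y1 - y2| <= X ->
  `|H - (p * (fw b P x1 - fw b P x2) + q * (fw b' P' y1 - fw b' P' y2))| <=
     eta * (`|fw b P x1 - fw b P x2| + `|fw b' P' y1 - fw b' P' y2|) ->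
  `|H| <= dU -> dU <= `|p| * expR L * (rho * X) -> eta * (2 / `|p| + 8 / `|q|) <= rho ->
  `|x1 - x2 + (-1) ^+ ((q < 0)%R (+) (p < 0)%R (+) (sgw b P (+) sgw b' P')) *
      (X0 / Y0) * c * (y1 - y2)| <= 3 * (rho * X).
Proof.
move=> p0 q0 /andP[r0 r1] eta0 c12 X00 Y00 Xp pw lw pw' lw' g1 g2 al cx1 cx2 cy1 cy2 hx hy hH hU hdU heta.
have rho12 : 0 <= rho / 12 by lra.
have [u1 [lu1 u10 E1]] := slope_factor pw lw g1 cx1 cx2 rho12.
have [u2 [lu2 u20 E2]] := slope_factor pw' lw' g2 cy1 cy2 rho12.
have P0 : 0 < `|p| by rewrite normr_gt0.
have Q0 : 0 < `|q| by rewrite normr_gt0.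
have cp : 0 < c by case/andP: c12 => h _; exact: lt_le_trans h.
(* The alignment error is [u3 = expR t3]. It adds to that of [u2], which makes [rho / 6] in
   logarithmic terms; [expR_near1] doubles this to the admissible [rho / 3]. Hence the precision
   [rho / 12]. *)
set t3 := ln `|q| - ln `|p| + ln Y0 - ln X0 + L' - L - ln c in al.
have rho6 : rho / 12 <= rho / 6 by clear -r0; lra.
have rho66 : rho / 12 + rho / 12 <= rho / 6 by clear; lra.
apply: (@robust_collision _ p q _ ((-1) ^+ sgw b P) ((-1) ^+ sgw b' P') (expR L) (expR L') u1 u2
  (expR t3) c (X0 / Y0) X rho eta dU H _ _ (x1 - x2) (y1 - y2) p0 q0 _ _ _ _ _ _ _ _ _ _ _ _
  c12 _ _ _ E1 E2) => //.
- by rewrite normr_sign.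
- by rewrite normr_sign.
- by rewrite normr_sign.
- have sgnE (z : R) : z = (-1) ^+ (z < 0)%R * `|z| by rewrite -numEsign.
  rewrite {1}(sgnE q) {3}(sgnE p) !signr_addb.
  have e2 (t : bool) : (-1) ^+ t * (-1) ^+ t = 1 :> R by rewrite -expr2 sqrr_sign.
  set sq := (-1) ^+ (q < 0)%R; set sp := (-1) ^+ (p < 0)%R; set sb := (-1) ^+ sgw b P.
  set sb' := (-1) ^+ sgw b' P'.
  transitivity ((sp * sp) * (sb * sb) * (sq * `|q| * sb' * (`|p| / `|p|))).
    by rewrite /sp /sb !e2 divff ?normr_eq0 // !mul1r mulr1.
  by ring.
- exact: expR_gt0.
- exact: expR_gt0.
- by rewrite divr_gt0.
- by rewrite r0.
- exact: expR_gt0.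
- exact: near_one_of_ln r1 u10 lu1 rho6.
- apply: (near_one_of_ln r1 _ _ rho66); first by rewrite mulr_gt0 ?expR_gt0.
  rewrite lnM ?posrE ?expR_gt0 // expRK; apply: le_trans (ler_normD _ _) _.
  exact: lerD.
- have -> : expR t3 = `|q| / `|p| * (Y0 / X0) * (expR L' / expR L) / c.
    rewrite /t3 !expRD !expRN !lnK ?posrE //; ring.
  by field; rewrite !gt_eqF ?expR_gt0.
Qed.

End StateCollision.

(** * Lower bound for the dimension of the image *)

Section LowerBound.
Context {R : realType}.
Variables F F' : markov_ifs R.

Definition dense_multipliers := forall l : R, 0 < l ->
  exists a u x A a' u' x' B, [/\ @multiplier R F a u x A, @multiplier R F' a' u' x' B &
    exists m k : int, 0 < m%:~R * A - k%:~R * B < l].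

Lemma dense_double (l : R) : dense_multipliers -> 0 < l ->
  exists a u x A a' u' x' B, [/\ @multiplier R F a u x A, @multiplier R F' a' u' x' B &
    exists m k : int, 0 < m%:~R * (2 * A) - k%:~R * (2 * B) < l].
Proof.
move=> dm l0; have [|a [u [x [A [a' [u' [x' [B [h1 h2 [m [k /andP[h3 h4]]]]]]]]]]]] := dm (l / 2).
  by rewrite divr_gt0.
exists a, u, x, A, a', u', x', B; split => //; exists m, k.
have -> : m%:~R * (2 * A) - k%:~R * (2 * B) = 2 * (m%:~R * A - k%:~R * B) by ring.
by apply/andP; split; lra.
Qed.

Definition image_set (h : R -> R -> R) : set R :=
  [set z | exists x y, [/\ limset F x, limset F' y & h x y = z]].

Lemma exponents_between (d d' sigma : R) : sigma < d + d' -> d + d' < 1 ->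
  exists s su s' su', [/\ s < d < su, s' < d' < su', su + su' < 1 & sigma < s + s'].
Proof.
move=> h1 h2; pose e := (d + d' - sigma) / 3; pose f := (1 - (d + d')) / 3.
exists (d - e), (d + f), (d' - e), (d' + f); rewrite /e /f.
by split; [apply/andP; split|apply/andP; split| |]; lra.
Qed.

Lemma small_cylinder (E : markov_ifs R) z (del : R) : 0 < del -> limset E z -> exists b i,
  path (@tr _ E) b i /\ forall z', cyl b i z' -> `|z' - z| <= del.
Proof.
move=> del0 zl; have [n hn] := kapX_lt E del0.
have [b [i [ni pi ci]]] := zl n; exists b, i; split => // z' cz'.
apply: le_trans (cyl_dist pi cz' ci) _; apply: le_trans (len_le_kap pi) _.
by apply: le_trans (ltW hn); apply: ler_wiXn2l => //; have := kap_gt0 E; have := kap_lt1 E; lra.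
Qed.

Lemma ln_grid (g G : nat) : (g < G)%N ->
  1 <= (1 + g%:R / G%:R : R) <= 2 /\ 0 <= ln (1 + g%:R / G%:R : R) <= 1.
Proof.
move=> gG; have G0 : 0 < G%:R :> R by rewrite ltr0n (leq_ltn_trans _ gG).
have g0 : 0 <= g%:R / G%:R :> R by rewrite divr_ge0.
have g1 : g%:R / G%:R <= 1 :> R by rewrite ler_pdivrMr // mul1r ler_nat ltnW.
split; first by lra.
rewrite ln_ge0 /=; last by lra.
by apply: le_trans g1; apply: le_ln1Dx; lra.
Qed.

Lemma step_bound (Lm lnr v v' nl gam : R) (k : nat) : lnr = nl - gam ->
  Lm + k%:R * lnr <= v -> v + nl - gam <= v' -> Lm + k.+1%:R * lnr <= v'.
Proof. by move=> E h1 h2; rewrite -addn1 natrD mulrDl mul1r; lra. Qed.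

(** A set that is small at the scale of the next block is small at each inner level [k1 < n] of the
    present one, since [r <= rho ^+ n]. *)
Lemma collision_scale (p Lm L X0 r rho : R) (k k1 n : nat) : 0 < p -> 0 < X0 ->
  0 < r -> r <= rho ^+ n -> 0 < rho <= 1 -> (k1 < n)%N -> Lm + k%:R * ln r <= L ->
  p * expR Lm * X0 * r ^+ k.+1 <= p * expR L * (rho * (rho ^+ k1 * X0)).
Proof.
move=> p0 X00 r0 rrho /andP[rho0 rho1] k1n hL.
have e1 : expR Lm * r ^+ k <= expR L.
  by rewrite -[r in r ^+ k](@lnK R) ?posrE // -expRM_natl -expRD ler_expR.
have e2 : r <= rho * rho ^+ k1.
  by rewrite -exprS; apply: le_trans rrho _; apply: ler_wiXn2l => //; exact: ltW.
rewrite [leLHS](_ : _ = p * X0 * ((expR Lm * r ^+ k) * r)); last by rewrite exprS; ring.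
rewrite [leRHS](_ : _ = p * X0 * (expR L * (rho * rho ^+ k1))); last by ring.
rewrite ler_pM2l ?mulr_gt0 //; apply: ler_pM e1 e2; rewrite ?(ltW r0) //.
by rewrite mulr_ge0 ?expR_ge0 // exprn_ge0 // ltW.
Qed.

Lemma leq_sum_widen (f : nat -> nat) (m n : nat) : (m <= n)%N ->
  (\sum_(0 <= i < m) f i <= \sum_(0 <= i < n) f i)%N.
Proof. by move=> mn; rewrite (@big_cat_nat _ _ _ m 0 n) //= leq_addr. Qed.

(** The tree bound is applied to the tree of good states, where one level is a whole block of the
    model tree. A vertex stands for the image under [h] of a pair of cylinders; a small set hits few
    children because its preimage in model coordinates satisfies the collision condition on the
    relation in [model_tree]. *)
Lemma lower_bound_lt (h : R -> R -> R) (p q x0 y0 sigma : R) :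
  limset F x0 -> limset F' y0 -> p != 0 -> q != 0 ->
  (forall eta, 0 < eta -> exists2 del, 0 < del & forall x1 x2 y1 y2,
     `|x1 - x0| <= del -> `|x2 - x0| <= del -> `|y1 - y0| <= del -> `|y2 - y0| <= del ->
     `|h x1 y1 - h x2 y2 - (p * (x1 - x2) + q * (y1 - y2))| <=
       eta * (`|x1 - x2| + `|y1 - y2|)) ->
  (exists m M, forall z, image_set h z -> m <= z <= M) ->
  dense_multipliers -> HD (limset F) + HD (limset F') < 1 ->
  0 < sigma < HD (limset F) + HD (limset F') -> sigma <= HD (image_set h).
Proof.
move=> Kx Ky p0 q0 hdiff hbnd dense HD1 /andP[sig0 sigHD].
set d := HD (limset F) in HD1 sigHD; set d' := HD (limset F') in HD1 sigHD.
have [s [su [s' [su' [sd sd' su1 sg]]]]] : exists s su s' su',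
    [/\ s < d < su, s' < d' < su', su + su' < 1 & sigma < s + s'].
  exact: exponents_between.
have neF : limset F !=set0 by exists x0.
have neF' : limset F' !=set0 by exists y0.
have [rho0 [Cd [/andP[rho00 rho01] Cd0 Hmod]]] := model_tree neF neF' sd sd' su1.
have [qq [rho1 [qq1 rho10 Hpar]]] := @choose_parameters R (s + s') sigma Cd ltac:(lra) Cd0.
pose rho := Num.min rho0 rho1.
have rhop : 0 < rho by rewrite lt_min rho00.
have rhole0 : rho <= rho0 by rewrite ge_min lexx.
have rhole1 : rho <= rho1 by rewrite ge_min lexx orbT.
have rho1' : 0 < rho <= 1 by rewrite rhop (le_trans rhole0) // ltW.
have [N [N0 Ns HN]] := Hmod rho ltac:(by rewrite rhop).
pose G := (Num.truncn (rho^-1)).+1.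
have rG : rho^-1 <= G%:R by rewrite ltW // truncnS_gt.
pose eps := rho / 12.
have eps0 : 0 < eps by rewrite divr_gt0.
have [a [u [x [A [a' [u' [x' [B [mulA mulB dens]]]]]]]]] := dense_double dense eps0.
have [m0 stA] := steer_word mulA eps0; have [m0' stB] := steer_word mulB eps0.
have [cycA A0 _] := mulA; have [cycB B0 _] := mulB.
have [pu lu _ _ _] := cycA; have [pu' lu' _ _ _] := cycB.
set w := rep u m0 in stA; set w' := rep u' m0' in stB.
have [pw lw] : path (@tr _ F) a w /\ last a w = a by exact: rep_path.
have [pw' lw'] : path (@tr _ F') a' w' /\ last a' w' = a' by exact: rep_path.
set X0 := len_w a w; set Y0 := len_w a' w'.
have X0p : 0 < X0 by exact: len_w_gt0.
have Y0p : 0 < Y0 by exact: len_w_gt0.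
have P0 : 0 < `|p| by rewrite normr_gt0.
have Q0 : 0 < `|q| by rewrite normr_gt0.
have W0 : 0 < 2 / `|p| + 8 / `|q| by rewrite addr_gt0 // divr_gt0.
(* With this [eta], linearising [h] costs no more than the diameter allowed for the small set. *)
pose eta := rho / (2 / `|p| + 8 / `|q|).
have eta0 : 0 < eta by rewrite divr_gt0.
have heta : eta * (2 / `|p| + 8 / `|q|) <= rho by rewrite /eta divfK ?gt_eqF.
have [del del0 Hdel] := hdiff eta eta0.
have [b [i0 [pi0 Hi0]]] := small_cylinder del0 Kx.
have [b' [i0' [pi0' Hi0']]] := small_cylinder del0 Ky.
pose c0 := ln `|q| - ln `|p| + ln Y0 - ln X0.
pose sg0 := (q < 0)%R (+) (p < 0)%R.
have [gam gam0 Hstep] := @step_state R F F' a u x A m0 a' u' x' B m0' eps eps c0 sg0 b b'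
   mulA mulB stA stB dens.
have Gam1 : 1 <= expR gam by rewrite -expR0 ler_expR.
have [pp [pp0 Hpp]] := Hpar rho N (expR gam) ltac:(by rewrite rhop) Ns Gam1.
set n := (qq * pp)%N in Hpp.
have n0 : (0 < n)%N by rewrite muln_gt0 (ltnW qq1).
have [g Hg] := choice (fun sg : bool => HN G a w a' w' sg qq pp rG pw pw' qq1).
have [M HM] := choice Hg; have [L HL] := choice HM.
(* The model tree provides a good parameter for each relative orientation; its logarithm is the
   target to which states are steered. *)
pose tgt tau : R := ln (1 + (g tau)%:R / G%:R).
have gG tau : (g tau < G)%N by have [] := HL tau.
have tgt01 tau : 0 <= tgt tau <= 1 by have [_] := ln_grid (gG tau).
(* The two orientations may keep different numbers of branches; half of all branches is a common
   arity. *)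
pose NT := uphalf (N ^ n).
have NTM tau : (NT <= M tau)%N by have [_ hM _ _] := HL tau; rewrite /NT leq_uphalf_double -mul2n.
have NT2 : (N ^ n <= 2 * NT)%N by rewrite mul2n -leq_uphalf_double.
have NT0 : (0 < NT)%N by rewrite -(@ltn_pmul2l 2) // muln0 (leq_trans _ NT2) // expn_gt0 N0.
have [v0 [gv0 [ext0 ext0']]] := init_state c0 sg0 mulA mulB stA stB dens tgt01 pi0 pi0'.
have step (vj : state F F' * nat) : exists v' : state F F',
    good_state a u m0 a' u' m0' eps eps c0 sg0 b b' tgt vj.1 -> (vj.2 < NT)%N ->
    let Lj := L (sg_state sg0 b b' vj.1) vj.2 in
    [/\ good_state a u m0 a' u' m0' eps eps c0 sg0 b b' tgt v',
    exists2 t, t != [::] & v'.1.1 = vj.1.1.1 ++ w ++ Lj.1 ++ t,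
    exists2 t, t != [::] & v'.1.2 = vj.1.1.2 ++ w' ++ Lj.2 ++ t,
    vj.1.2.1 + n%:R * ln rho - gam <= v'.2.1 &
    vj.1.2.2 + n%:R * ln rho - gam <= v'.2.2].
  case: vj => v j /=.
  have [[gv jN]|no] := pselect (good_state a u m0 a' u' m0' eps eps c0 sg0 b b' tgt v /\ (j < NT)%N);
    last by exists v => gv jN; case: no.
  have [_ _ nd _] := HL (sg_state sg0 b b' v).
  have [nd1 nd2] := nd j (leq_trans jN (NTM _)).
  by have [v' Hv'] := Hstep tgt v rho n _ _ tgt01 rhop gv nd1 nd2; exists v'.
have [ch Hch] := choice step.
pose child v j := ch (v, j).
(* Lower bound for the contraction of one block, including connectors and inserted periodic
   words. *)
pose r := rho ^+ n / expR gam.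
have rn0 : 0 < rho ^+ n by rewrite exprn_gt0.
have eg0 := expR_gt0 gam.
have r0 : 0 < r by rewrite divr_gt0.
have rrho : r <= rho ^+ n by rewrite ler_pdivrMr // ler_peMr // ltW.
have lnr : ln r = n%:R * ln rho - gam.
  by rewrite /r lnM ?posrE ?invr_gt0 // lnV ?posrE // expRK lnXn // mulr_natl.
(* Reference for the slopes: after [k] blocks both logarithmic slopes are at least
   [Lm + k * ln r]. *)
pose Lm := Num.min v0.2.1 v0.2.2.
pose Inv k (v : state F F') := [/\ good_state a u m0 a' u' m0' eps eps c0 sg0 b b' tgt v,
  exists t, v.1.1 = i0 ++ t, exists t, v.1.2 = i0' ++ t,
  Lm + k%:R * ln r <= v.2.1 & Lm + k%:R * ln r <= v.2.2].
pose img (v : state F F') := [set z | exists X Y, [/\ cyl b (v.1.1 ++ w) X,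
  cyl b' (v.1.2 ++ w') Y & h X Y = z]].
have Inv0 : Inv 0%N v0.
  by split => //; rewrite mul0r addr0 /Lm ge_min lexx ?orbT.
have Inv_child k v j : Inv k v -> (j < NT)%N -> Inv k.+1 (child v j).
  move=> [gv [t0 et0] [t0' et0'] l1 l2] jN.
  have [gc [t _ et] [t' _ et'] h1 h2] := Hch (v, j) gv jN.
  split => //.
  - by exists (t0 ++ w ++ (L (sg_state sg0 b b' v) j).1 ++ t); rewrite /child et /= et0 -!catA.
  - by exists (t0' ++ w' ++ (L (sg_state sg0 b b' v) j).2 ++ t'); rewrite /child et' /= et0' -!catA.
  - exact: step_bound lnr l1 h1.
  - exact: step_bound lnr l2 h2.
have good_path v : good_state a u m0 a' u' m0' eps eps c0 sg0 b b' tgt v ->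
    path (@tr _ F) b (v.1.1 ++ w) /\ path (@tr _ F') b' (v.1.2 ++ w').
  by move=> [[p1 l1 _] [p2 l2 _] _]; rewrite !cat_path p1 p2 l1 l2.
have sub_child k v j : Inv k v -> (j < NT)%N ->
    cyl b (child v j).1.1 `<=` cyl b (v.1.1 ++ w ++ (L (sg_state sg0 b b' v) j).1) /\
    cyl b' (child v j).1.2 `<=` cyl b' (v.1.2 ++ w' ++ (L (sg_state sg0 b b' v) j).2).
  move=> Iv jN; have [gc _ _ _ _] := Inv_child k v j Iv jN.
  have [gv _ _ _ _] := Iv.
  have [[p1 _ _] [p2 _ _] _] := gc.
  have [_ [t _ et] [t' _ et'] _ _] := Hch (v, j) gv jN.
  move: p1 p2; rewrite -/(child v j) in et et' *; rewrite et et' /=.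
  by rewrite !catA => p1 p2; split; exact: cyl_sub.
have sub_child' k v j : Inv k v -> (j < NT)%N ->
    cyl b ((child v j).1.1 ++ w) `<=` cyl b (child v j).1.1 /\
    cyl b' ((child v j).1.2 ++ w') `<=` cyl b' (child v j).1.2.
  move=> Iv jN; have [gc _ _ _ _] := Inv_child k v j Iv jN.
  by have [p1 p2] := good_path _ gc; split; exact: cyl_sub.
have img_child k v j : Inv k v -> (j < NT)%N -> img (child v j) `<=` img v.
  move=> Iv jN z [X [Y [cX cY <-]]]; exists X, Y.
  have [s1 s2] := sub_child k v j Iv jN; have [s3 s4] := sub_child' k v j Iv jN.
  have [gc _ _ _ _] := Inv_child k v j Iv jN; have [gv _ _ _ _] := Iv.
  have [[p1 _ _] [p2 _ _] _] := gc.
  have [_ [t _ et] [t' _ et'] _ _] := Hch (v, j) gv jN.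
  move: p1 p2; rewrite -/(child v j) in et et'; rewrite et et' /= => p1 p2.
  have := s1 _ (s3 _ cX); have := s2 _ (s4 _ cY); rewrite !catA => cY' cX'.
  split=> //; [apply: cyl_sub cX'|apply: cyl_sub cY'].
  - by move: p1; rewrite !catA cat_path => /andP[].
  - by move: p2; rewrite !catA cat_path => /andP[].
have r1 : r < 1.
  apply: le_lt_trans rrho _; apply: le_lt_trans (le_lt_trans rhole0 rho01).
  by rewrite -[leRHS]expr1; apply: ler_wiXn2l => //; [exact: ltW|exact: le_trans rhole0 (ltW rho01)].
apply: (@tree_HD_ge R _ child NT img Inv Inv_child img_child
  (N ^ (2 * pp) * (qq * Cd) ^ n)%N r (`|p| * expR Lm * X0) _ _ _ (image_set h) v0 Inv0 _
  sigma NT0 sig0 _ hbnd).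
- by rewrite r0.
- by rewrite mulr_gt0 // mulr_gt0 // expR_gt0.
- move=> k v U Iv hU; have [gv [t0 et0] [t0' et0'] Lk1 _] := Iv.
  set tau := sg_state sg0 b b' v.
  (* Preimage of the small set in the coordinates of the model tree, through the words of the state
     [v]. *)
  pose hp X Y := U (h (fw b v.1.1 X) (fw b' v.1.2 Y)).
  have [gs1 gs2 al] := gv.
  have [pP lP _] := gs1; have [pP' lP' _] := gs2.
  have [pPw pPw'] := good_path _ gv.
  apply: leq_trans; last first.
    have [_ _ _] := HL tau; apply; move=> k1 x1 x2 y1 y2 k1n cx1 cx2 cy1 cy2 dx dy.
    move=> U1 U2.
    have inb z : cyl a w z -> `|fw b v.1.1 z - x0| <= del.
      move=> cz; apply: Hi0.
      have cz' : cyl b (v.1.1 ++ w) (fw b v.1.1 z).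
        by apply/(cyl_cat _ pPw); exists z; rewrite ?lP.
      have : path (@tr _ F) b (i0 ++ t0 ++ w) by rewrite catA -et0.
      by move/cyl_sub; apply; rewrite catA -et0.
    have inb' z : cyl a' w' z -> `|fw b' v.1.2 z - y0| <= del.
      move=> cz; apply: Hi0'.
      have cz' : cyl b' (v.1.2 ++ w') (fw b' v.1.2 z).
        by apply/(cyl_cat _ pPw'); exists z; rewrite ?lP'.
      have : path (@tr _ F') b' (i0' ++ t0' ++ w') by rewrite catA -et0'.
      by move/cyl_sub; apply; rewrite catA -et0'.
    rewrite [rho ^+ k1.+1]exprS -(mulrA rho).
    have [c12 _] := ln_grid (gG tau).
    have Xk : 0 < rho ^+ k1 * X0 by rewrite mulr_gt0 // exprn_gt0.
    have dy' : X0 / Y0 * `|y1 - y2| <= rho ^+ k1 * X0.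
      by rewrite mulrAC ler_pdivrMr // mulrAC [leRHS]mulrC ler_pM2l.
    have hsc : `|p| * expR Lm * X0 * r ^+ k.+1 <= `|p| * expR v.2.1 * (rho * (rho ^+ k1 * X0)).
      exact: (collision_scale P0 X0p r0 rrho rho1' k1n Lk1).
    have HH := @state_collision R F F' a b w v.1.1 a' b' w' v.1.2 v.2.1 v.2.2 p q
      (1 + (g tau)%:R / G%:R) X0 Y0 (rho ^+ k1 * X0) rho eta
      (`|p| * expR Lm * X0 * r ^+ k.+1) _ x1 x2 y1 y2 p0 q0 rho1' (ltW eta0) c12 X0p Y0p Xk
      pw lw pw' lw' gs1 gs2 al cx1 cx2 cy1 cy2 dx dy'
      (Hdel _ _ _ _ (inb _ cx1) (inb _ cx2) (inb' _ cy1) (inb' _ cy2)) (hU _ _ U1 U2) hsc heta.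
    exact: HH.
  apply: leq_trans (leq_sum_widen _ (NTM tau)).
  rewrite big_nat_cond [leqRHS]big_nat_cond; apply: leq_sum => j /andP[/andP[_ jN] _].
  rewrite /hit; case: asboolP => // -[z [[X [Y [cX cY hz]]] Uz]].
  rewrite lt0b; apply/asboolP.
  have [s1 s2] := sub_child k v j Iv jN; have [s3 s4] := sub_child' k v j Iv jN.
  have [gc _ _ _ _] := Inv_child k v j Iv jN.
  have [[p1 _ _] [p2 _ _] _] := gc.
  have [_ [t _ et] [t' _ et'] _ _] := Hch (v, j) gv jN.
  move: p1 p2; rewrite -/(child v j) in et et'; rewrite et et' /= => p1 p2.
  have q1 : path (@tr _ F) b (v.1.1 ++ w ++ (L tau j).1).
    by move: p1; rewrite !catA cat_path => /andP[].
  have q2 : path (@tr _ F') b' (v.1.2 ++ w' ++ (L tau j).2).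
    by move: p2; rewrite !catA cat_path => /andP[].
  have [x1 cx1 ex1] := (cyl_cat _ q1).1 (s1 _ (s3 _ cX)).
  have [y1 cy1 ey1] := (cyl_cat _ q2).1 (s2 _ (s4 _ cY)).
  rewrite lP in cx1; rewrite lP' in cy1.
  by exists x1, y1; split=> //; rewrite /hp ex1 ey1 hz.
- move=> iota hiota.
  pose z k := walk child v0 iota k.
  have Iz k : Inv k (z k) by elim: k => [//|k IH]; apply: Inv_child.
  have Hz k : exists V V', [/\ w ++ V != [::], w' ++ V' != [::],
      (z k.+1).1.1 = (z k).1.1 ++ w ++ V & (z k.+1).1.2 = (z k).1.2 ++ w' ++ V'].
    have [gv _ _ _ _] := Iz k.
    have [_ [t t0 et] [t' t0' et'] _ _] := Hch (z k, iota k) gv (hiota k).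
    exists ((L (sg_state sg0 b b' (z k)) (iota k)).1 ++ t),
      ((L (sg_state sg0 b b' (z k)) (iota k)).2 ++ t'); split.
    - by rewrite -size_eq0 !size_cat -lt0n; case: t t0 {et} => //= *; rewrite !addnS.
    - by rewrite -size_eq0 !size_cat -lt0n; case: t' t0' {et'} => //= *; rewrite !addnS.
    - exact: et.
    - exact: et'.
  have [V1 hV1] := choice Hz; have [V2 hV2] := choice hV1.
  have [x1 x1l x1c] : exists2 x, limset F x & forall k, cyl b (z k).1.1 x.
    apply: (@nested_point R F b (fun k => (z k).1.1) (fun k => w ++ V1 k)) => k.
    - by have [_ _ ? _] := hV2 k.
    - by have [? _ _ _] := hV2 k.
    - by have [[[? _ _] _ _] _ _ _ _] := Iz k.
  have [y1 y1l y1c] : exists2 x, limset F' x & forall k, cyl b' (z k).1.2 x.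
    apply: (@nested_point R F' b' (fun k => (z k).1.2) (fun k => w' ++ V2 k)) => k.
    - by have [_ _ _ ?] := hV2 k.
    - by have [_ ? _ _] := hV2 k.
    - by have [[_ [? _ _] _] _ _ _ _] := Iz k.
  exists (h x1 y1); first by exists x1, y1.
  move=> k; exists x1, y1; rewrite -/(z k).
  have [_ _ e1 e2] := hV2 k.
  have [[[q1 _ _] [q2 _ _] _] _ _ _ _] := Iz k.+1.
  split=> //.
  - have := x1c k.+1; rewrite e1 catA; apply: cyl_sub.
    by move: q1; rewrite e1 catA.
  - have := y1c k.+1; rewrite e2 catA; apply: cyl_sub.
    by move: q2; rewrite e2 catA.
- exact: Hpp.
Qed.

Lemma lower_bound (h : R -> R -> R) (p q x0 y0 : R) :
  limset F x0 -> limset F' y0 -> p != 0 -> q != 0 ->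
  (forall eta, 0 < eta -> exists2 del, 0 < del & forall x1 x2 y1 y2,
     `|x1 - x0| <= del -> `|x2 - x0| <= del -> `|y1 - y0| <= del -> `|y2 - y0| <= del ->
     `|h x1 y1 - h x2 y2 - (p * (x1 - x2) + q * (y1 - y2))| <=
       eta * (`|x1 - x2| + `|y1 - y2|)) ->
  (exists m M, forall z, image_set h z -> m <= z <= M) ->
  dense_multipliers -> HD (limset F) + HD (limset F') < 1 ->
  HD (limset F) + HD (limset F') <= HD (image_set h).
Proof.
move=> Kx Ky p0 q0 hdiff hbnd dense HD1.
rewrite leNgt; apply/negP => lt.
have H0 : 0 <= HD (image_set h) by exact: HD_ge0.
pose d := HD (image_set h); pose dd := HD (limset F) + HD (limset F').
have /andP[sig0 sig1] : d < (d + dd) / 2 < dd by rewrite !midf_lt.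
have := @lower_bound_lt h p q x0 y0 ((d + dd) / 2) Kx Ky p0 q0 hdiff hbnd dense HD1.
by rewrite sig1 (le_lt_trans H0 sig0) leNgt sig0; move/(_ isT).
Qed.

End LowerBound.

(** * From expanding maps to Markov systems *)

Section DerivativeWithin.
Context {R : realType}.
Variables (l m : R) (f : R -> R).
Local Notation S := `[l, m]%classic.
Implicit Types (x y c e d : R).

Lemma slope_inP (A : set R) (x D : R) : slope_in A f x --> D <->
  forall e, 0 < e -> exists2 d, 0 < d & forall y, A y -> y != x -> `|y - x| < d ->
    `|(f y - f x) / (y - x) - D| < e.
Proof.
split=> [cv e e0|H].
  have /cvgrPdist_lt/(_ _ e0) := cv.
  rewrite /prop_near1 /= /nbhs /= /within /= => /nbhs_ballP[d /= d0 Hd].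
  exists d => // y Ay yx yd; rewrite distrC; apply: Hd => //.
  by rewrite /ball /= distrC.
apply/cvgrPdist_lt => e e0; have [d d0 Hd] := H e e0.
rewrite /prop_near1 /= /nbhs /= /within /=; apply/nbhs_ballP; exists d => //= y.
by rewrite /ball /= => yd yx Ay; rewrite distrC; apply: Hd => //; rewrite distrC.
Qed.

Lemma derivable_inP x : derivable_in S f x ->
  forall e, 0 < e -> exists2 d, 0 < d & forall y, S y -> y != x -> `|y - x| < d ->
    `|(f y - f x) / (y - x) - derive_in S f x| < e.
Proof. by move=> dx; apply/slope_inP; exact: dx. Qed.

Lemma derivable_in_lip x : derivable_in S f x -> exists C d, [/\ 0 < C, 0 < d &
  forall y, S y -> `|y - x| < d -> `|f y - f x| <= C * `|y - x|].
Proof.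
move=> dx; have [d d0 Hd] := derivable_inP dx ltr01.
exists (`|derive_in S f x| + 1), d; split; [exact: ltr_wpDl|exact: d0|].
move=> y Sy yd; have [->|yx] := eqVneq y x; first by rewrite !subrr normr0 mulr0.
have y0 : 0 < `|y - x| by rewrite normr_gt0 subr_eq0.
rewrite -ler_pdivrMr // -normf_div.
have := Hd y Sy yx yd => /ltW h; rewrite -[X in `|X|](subrK (derive_in S f x)).
by apply: le_trans (ler_normD _ _) _; rewrite addrC lerD2l.
Qed.

Lemma within_continuousP x0 y0 (k : R -> R) : {within `[x0, y0], continuous k} <->
  (forall x, x0 <= x <= y0 -> forall e, 0 < e -> exists2 d, 0 < d & forall y, x0 <= y <= y0 ->
     `|y - x| < d -> `|k y - k x| < e).
Proof.
split=> [/subspace_continuousP H x xI e e0|H]; last first.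
  apply/subspace_continuousP => x; rewrite /= in_itv /= => xI.
  apply/cvgrPdist_lt => e e0; have [d d0 Hd] := H x xI e e0.
  rewrite /prop_near1 /= /nbhs /= /within /=; apply/nbhs_ballP; exists d => //= y.
  by rewrite /ball /= in_itv /= => yd yI; rewrite distrC; apply: Hd => //; rewrite distrC.
have /cvgrPdist_lt/(_ _ e0) := H x ltac:(by rewrite /= in_itv).
rewrite /prop_near1 /= /nbhs /= /within /= => /nbhs_ballP[d /= d0 Hd].
by exists d => // y yI yd; rewrite distrC; apply: Hd; rewrite /ball /= ?in_itv // distrC.
Qed.

Lemma derivable_in_continuous x0 y0 : l <= x0 -> y0 <= m ->
  (forall x, S x -> derivable_in S f x) -> {within `[x0, y0], continuous f}.
Proof.
move=> lx ym der; apply/within_continuousP => x /andP[x0x xy0] e e0.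
have Sx : S x by rewrite /= in_itv /= (le_trans lx) //= (le_trans xy0).
have [C [d [C0 d0 Hd]]] := derivable_in_lip (der x Sx).
exists (Num.min d (e / C)); first by rewrite lt_min d0 divr_gt0.
move=> y /andP[x0y yy0]; rewrite lt_min => /andP[yd ye].
have Sy : S y by rewrite /= in_itv /= (le_trans lx) //= (le_trans yy0).
by apply: le_lt_trans (Hd y Sy yd) _; rewrite mulrC -ltr_pdivlMr.
Qed.

Lemma mean_value_in x y : (forall x, S x -> derivable_in S f x) -> S x -> S y -> x < y ->
  exists2 c, x < c < y & f y - f x = derive_in S f c * (y - x).
Proof.
move=> der; rewrite /= !in_itv /= => /andP[lx xm] /andP[ly ym] xy.
have [||c] := @MVT R f (derive_in S f) x y xy; last by rewrite in_itv /=; exists c.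
  move=> c; rewrite in_itv /= => /andP[xc cy].
  have Sc : S c by rewrite /= in_itv /= (le_trans lx (ltW xc)) (le_trans (ltW cy) ym).
  (* At an interior point the derivative relative to the interval is the ordinary two-sided one. *)
  suff cv : h^-1 *: ((f \o shift c) (h *: 1) - f c) @[h --> 0^'] --> derive_in S f c.
    by split; [apply/cvg_ex; eexists; exact: cv|exact: cvg_lim cv].
  apply/cvgrPdist_lt => e e0; have [d d0 Hd] := derivable_inP (der c Sc) e0.
  rewrite /prop_near1 /= /nbhs /= /dnbhs /within /=; apply/nbhs_ballP.
  exists (Num.min d (Num.min (c - x) (y - c))); first by rewrite /= !lt_min d0 !subr_gt0 xc.
  move=> h; rewrite /ball /= sub0r normrN !lt_min => /and3P[hd hx hy] h0.
  have -> : h *: (1 : R) = h by rewrite /GRing.scale /= mulr1.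
  have hc : h + c - c = h by ring.
  have Sh : S (h + c).
    rewrite /= in_itv /=; move: hx hy; rewrite !ltr_norml => /andP[? ?] /andP[? ?].
    by apply/andP; split; lra.
  have := Hd (h + c) Sh; rewrite hc => /(_ _ hd); rewrite distrC => hh.
  rewrite /GRing.scale /= mulrC; apply: hh.
  by apply: contra h0 => /eqP hh; apply/eqP; lra.
by apply: derivable_in_continuous.
Qed.

End DerivativeWithin.

(** The second derivative is bounded on the compact interval: its continuity is part of [Ck_in] for
    [k = 2] and follows from derivability for larger [k]. *)
Lemma Ck_in_lipschitz (R : realType) (l m : R) (f : R -> R) (k : nat) : l < m -> (2 <= k)%N ->
  Ck_in `[l, m]%classic k f ->
  exists H, forall x y, l <= x <= m -> l <= y <= m ->
    `|derive_in `[l, m]%classic f x - derive_in `[l, m]%classic f y| <= H * `|x - y|.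
Proof.
move=> lm k2 [der cont]; set S := `[l, m]%classic; set f1 := derive_in S f.
pose f2 := derive_in S f1.
have SE x : S x = (l <= x <= m) by rewrite /S /= in_itv.
have der1 x : S x -> derivable_in S f1 x by move=> Sx; exact: (der 1%N).
have cf2 : {within `[l, m], continuous f2}.
  case: (ltngtP k 2%N) => [|k3|ek]; first by rewrite ltnNge k2.
    have der2 x : S x -> derivable_in S f2 x by exact: (der 2%N).
    exact: (@derivable_in_continuous R l m f2 l m (lexx _) (lexx _) der2).
  by move: cont; rewrite ek.
have cf2a : {within `[l, m], continuous (fun x => `|f2 x|)}.
  move/within_continuousP : cf2 => cf2; apply/within_continuousP => x xI e e0.
  have [d d0 Hd] := cf2 x xI e e0; exists d => // y yI yd.
  by apply: le_lt_trans (Hd y yI yd); exact: ler_dist_dist.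
have [c cI Hc] := EVT_max (ltW lm) cf2a.
exists `|f2 c|.
suff H x y : l <= x <= m -> l <= y <= m -> x < y -> `|f1 x - f1 y| <= `|f2 c| * `|x - y|.
  move=> x y xI yI; case: (ltgtP x y) => [xy|yx|->]; first exact: H.
    by rewrite distrC (distrC x); exact: H.
  by rewrite !subrr normr0 mulr0.
move=> xI yI xy; have Sx : S x by rewrite SE.
have Sy : S y by rewrite SE.
have [z /andP[xz zy] E] := mean_value_in der1 Sx Sy xy.
rewrite distrC E normrM (distrC x) ler_wpM2r //; apply: Hc; rewrite in_itv /=.
by case/andP: xI => ? ?; case/andP: yI => ? ?; apply/andP; split; lra.
Qed.

(** If the integer part of [r] is 1 the exponent is [r - 1 > 0]; otherwise the derivative is
    Lipschitz and the exponent is 1. *)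
Lemma Cr_in_holder (R : realType) (r : \bar R) : (1%:E < r)%E -> exists2 bet : R, 0 < bet &
  forall l m f, l < m -> Cr_in `[l, m]%classic r f ->
    (forall x, l <= x <= m -> derivable_in `[l, m]%classic f x) /\
    exists2 H, 0 <= H & forall x y, l <= x <= m -> l <= y <= m ->
      `|derive_in `[l, m]%classic f x - derive_in `[l, m]%classic f y| <= H * `|x - y| `^ bet.
Proof.
move=> r1.
have lip l m f k : l < m -> (2 <= k)%N -> Ck_in `[l, m]%classic k f ->
    (forall x, l <= x <= m -> derivable_in `[l, m]%classic f x) /\
    exists2 H, 0 <= H & forall x y, l <= x <= m -> l <= y <= m ->
      `|derive_in `[l, m]%classic f x - derive_in `[l, m]%classic f y| <= H * `|x - y| `^ 1.
  move=> lm k2 Ck; split.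
    by move=> x xI; apply: (proj1 Ck 0%N (ltnW k2)); rewrite /= in_itv.
  have [H HH] := Ck_in_lipschitz lm k2 Ck; exists `|H| => // x y xI yI.
  by rewrite powRr1 //; apply: le_trans (HH x y xI yI) _; rewrite ler_wpM2r // ler_norm.
case: r r1 => [r||] // r1; last by exists 1 => // l m f lm /(_ 2%N) Ck; exact: lip Ck.
have [k1|k2] := leqP (Num.truncn r) 1; last first.
  by exists 1 => // l m f lm [Ck _]; exact: lip Ck.
rewrite lte_fin in r1.
have r0 : 0 <= r by apply: le_trans (ltW r1).
have k1' : Num.truncn r = 1%N.
  apply/eqP; rewrite eqn_leq k1 /=.
  by rewrite truncn_ge_nat // ltW.
exists (r - 1) => [|l m f lm]; first by rewrite subr_gt0.
rewrite /Cr_in k1' => -[[der _] [H HH]]; split.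
  by move=> x xI; apply: (der 0%N) => //; rewrite /= in_itv.
exists `|H| => // x y xI yI.
have := HH x y; rewrite /= !in_itv /= => /(_ xI yI) h; apply: le_trans h _.
by rewrite ler_wpM2r ?powR_ge0 // ler_norm.
Qed.

Lemma between_in (R : realType) (l m x y c : R) : l <= x <= m -> l <= y <= m ->
  Num.min x y < c < Num.max x y -> l <= c <= m.
Proof.
by case: (leP x y) => _ /andP[? ?] /andP[? ?] /andP[? ?]; apply/andP; split; lra.
Qed.

Lemma between_dist (R : realType) (x y u v c c' d : R) : `|x - u| <= d -> `|x - v| <= d ->
  `|y - u| <= d -> `|y - v| <= d -> Num.min x y < c < Num.max x y ->
  Num.min u v < c' < Num.max u v -> `|c - c'| <= d.
Proof.
rewrite !ler_norml => /andP[? ?] /andP[? ?] /andP[? ?] /andP[? ?].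
by case: (leP x y) => _ /andP[? ?]; case: (leP u v) => _ /andP[? ?]; apply/andP; split; lra.
Qed.

(** * Secants of an expanding branch *)

Section Branch.
Context {R : realType}.

(** One constant [C] bounds the slope from above, its excess over 1 from below and the distortion.
    All conditions weaken as [C] grows, so finitely many branches share a common constant. *)
Definition branch_spec (bet : R) (o : bool) (l m : R) (f : R -> R) (C : R) :=
  [/\ 2 <= C, forall x y, l <= x <= m -> l <= y <= m -> x < y ->
     (1 + C^-1) * (y - x) <= (-1) ^+ o * (f y - f x) <= C * (y - x) &
  forall x y u v d, (forall p, p \in [:: x; y; u; v] -> l <= p <= m) ->
     (forall p q, p \in [:: x; y; u; v] -> q \in [:: x; y; u; v] -> `|p - q| <= d) ->
     x != y -> u != v ->
     `|f x - f y| / `|x - y| <= expR (C * d `^ bet) * (`|f u - f v| / `|u - v|)].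

Lemma branch_spec_mono bet o l m f C C' : C <= C' ->
  branch_spec bet o l m f C -> branch_spec bet o l m f C'.
Proof.
move=> CC [C2 h1 h2]; split; first exact: le_trans CC.
- move=> x y xI yI xy; have /andP[a b] := h1 x y xI yI xy.
  have xy0 : 0 <= y - x by rewrite subr_ge0 ltW.
  apply/andP; split; last by apply: le_trans b _; rewrite ler_wpM2r.
  apply: le_trans a; rewrite ler_wpM2r // lerD2l lef_pV2 ?posrE //; lra.
- move=> x y u v d pI pd xy uv; apply: le_trans (h2 x y u v d pI pd xy uv) _.
  rewrite ler_wpM2r ?divr_ge0 // ler_expR ler_wpM2r // powR_ge0 //.
Qed.

Variables (l m bet H : R) (f : R -> R).
Hypotheses (lm : l < m) (bet0 : 0 < bet) (Hge0 : 0 <= H).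
Local Notation S := `[l, m]%classic.
Local Notation f1 := (derive_in S f).
Hypothesis der : forall x, l <= x <= m -> derivable_in S f x.
Hypothesis hol : forall x y, l <= x <= m -> l <= y <= m -> `|f1 x - f1 y| <= H * `|x - y| `^ bet.
Hypothesis exp : forall x, l <= x <= m -> 1 < `|f1 x|.

Let cont : {within `[l, m], continuous f1}.
Proof.
apply/within_continuousP => x xI e e0.
have H1 : 0 < H + 1 by exact: ltr_wpDl.
have eH : 0 < e / (H + 1) by rewrite divr_gt0.
exists ((e / (H + 1)) `^ bet^-1); first by rewrite powR_gt0.
move=> y yI yd; apply: le_lt_trans (hol yI xI) _.
have : `|y - x| `^ bet < e / (H + 1).
  have <- : ((e / (H + 1)) `^ bet^-1) `^ bet = e / (H + 1).
    by rewrite -powRrM mulVf ?gt_eqF // powRr1 // ltW.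
  by apply: gt0_ltr_powR; rewrite ?nnegrE ?powR_ge0.
rewrite ltr_pdivlMr // mulrDr mulr1 => h.
have := powR_ge0 `|y - x| bet; rewrite mulrC.
by move: h; set A := _ * H; set B := _ `^ _; lra.
Qed.

Let o : bool := f1 l < 0.

(** A change of sign of the derivative would produce a zero by the intermediate value theorem,
    against expansion. *)
Lemma branch_sign x : l <= x <= m -> (-1) ^+ o * f1 x = `|f1 x|.
Proof.
move=> xI; have lI : l <= l <= m by rewrite lexx ltW.
have /andP[lx xm] := xI.
have cx : {within `[l, x], continuous f1}.
  by apply: continuous_subspaceW cont => y; rewrite /= !in_itv /= => /andP[-> /le_trans->].
(* The arbitrary boolean [v] expresses absurdity; it is used at [true]. *)
have no v : Num.min (f1 l) (f1 x) <= 0 <= Num.max (f1 l) (f1 x) -> v = false.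
  move=> h; have [c] := IVT lx cx h; rewrite in_itv /= => /andP[lc cxx] c0.
  have := exp (x := c); rewrite c0 normr0 lc (le_trans cxx xm) => /(_ isT); lra.
have := exp lI; have := exp xI; rewrite /o => ex el.
case: ltP => s; rewrite ?expr1 ?expr0 ?mulN1r ?mul1r.
- rewrite ltr0_norm // ltNge; apply/negP => x0.
  by have := no true; rewrite ge_min le_max (ltW s) x0 orbT => /(_ isT).
- rewrite ger0_norm // leNgt; apply/negP => x0.
  by have := no true; rewrite ge_min le_max (ltW x0) s orbT => /(_ isT).
Qed.

Lemma branch_mean x y : l <= x <= m -> l <= y <= m -> x < y ->
  exists2 c, x < c < y & (-1) ^+ o * (f y - f x) = `|f1 c| * (y - x).
Proof.
move=> xI yI xy.
have derS z : S z -> derivable_in S f z by rewrite /= in_itv /=; exact: der.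
have [||c cI E] := mean_value_in derS (x := x) (y := y) _ _ xy; rewrite /= ?in_itv //.
exists c => //; rewrite E mulrA branch_sign //.
by case/andP: xI => ? ?; case/andP: yI => ? ?; case/andP: cI => ? ?; apply/andP; split; lra.
Qed.

Lemma branch_slope x y : l <= x <= m -> l <= y <= m -> x != y ->
  exists2 c, Num.min x y < c < Num.max x y & `|f x - f y| / `|x - y| = `|f1 c|.
Proof.
suff K u v : l <= u <= m -> l <= v <= m -> u < v ->
  exists2 c, u < c < v & `|f u - f v| / `|u - v| = `|f1 c|.
  move=> xI yI; case: (ltgtP x y) => // [xy|yx] _; first exact: K.
  by rewrite distrC (distrC x); exact: K.
move=> uI vI uv; have [c cI E] := branch_mean uI vI uv.
exists c => //; have vu : 0 < v - u by rewrite subr_gt0.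
rewrite distrC (distrC u) (gtr0_norm vu).
have -> : `|f v - f u| = `|f1 c| * (v - u).
  by rewrite -[`|f1 c|]ger0_norm // -[X in _ * X](gtr0_norm vu) -normrM -E normrM normrX normrN1 expr1n mul1r.
by rewrite mulfK // gt_eqF.
Qed.

Lemma branch_constants : exists C, branch_spec bet o l m f C.
Proof.
have cabs : {within `[l, m], continuous (fun x => `|f1 x|)}.
  move/within_continuousP : cont => c1; apply/within_continuousP => x xI e e0.
  have [d d0 Hd] := c1 x xI e e0; exists d => // y yI yd.
  by apply: le_lt_trans (Hd y yI yd); exact: ler_dist_dist.
have [xM xMI HM] := EVT_max (ltW lm) cabs.
have [xm xmI Hm] := EVT_min (ltW lm) cabs.
have m1 : 1 < `|f1 xm| by apply: exp; move: xmI; rewrite in_itv.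
pose k := `|f1 xm| - 1; have k0 : 0 < k by rewrite subr_gt0.
pose K := `|f1 xM|; have K0 : 0 <= K by exact: normr_ge0.
pose C := 2 + K + H + k^-1.
have ki : 0 < k^-1 by rewrite invr_gt0.
have [C2 CK CH Ck] : [/\ 2 <= C, K <= C, H <= C & k^-1 <= C].
  by move: K0 Hge0 ki; rewrite /C; move: (k^-1) (K) (H) => z1 z2 z3 ? ? ?; split; lra.
have C0 : 0 < C by apply: lt_le_trans C2.
exists C; split; first exact: C2.
- move=> x y xI yI xy; have [c cI ->] := branch_mean xI yI xy.
  have cI' : l <= c <= m.
    by case/andP: xI => ? ?; case/andP: yI => ? ?; case/andP: cI => ? ?; apply/andP; split; lra.
  have xy0 : 0 < y - x by rewrite subr_gt0.
  rewrite !ler_pM2r //; apply/andP; split.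
    apply: le_trans (Hm c _); last by rewrite in_itv.
    by rewrite -lerBrDl -/k -[leRHS]invrK lef_pV2 ?posrE.
  by apply: le_trans (HM c _) _; rewrite ?in_itv.
- move=> x y u v d pI pd xy uv.
  have xI : l <= x <= m by apply: pI; rewrite !inE eqxx.
  have yI : l <= y <= m by apply: pI; rewrite !inE eqxx !orbT.
  have uI : l <= u <= m by apply: pI; rewrite !inE eqxx !orbT.
  have vI : l <= v <= m by apply: pI; rewrite !inE eqxx !orbT.
  have [c cI ->] := branch_slope xI yI xy; have [c' cI' ->] := branch_slope uI vI uv.
  have cS := between_in xI yI cI; have cS' := between_in uI vI cI'.
  have cd : `|c - c'| <= d.
    by apply: between_dist cI cI'; apply: pd; rewrite !inE eqxx ?orbT.
  have h1 : `|f1 c| <= `|f1 c'| + C * d `^ bet.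
    rewrite -lerBlDl; apply: le_trans (ler_norm _) _; apply: le_trans (ler_dist_dist _ _) _.
    apply: le_trans (hol cS cS') _; apply: ler_pM; rewrite ?powR_ge0 //.
    by apply: ge0_ler_powR; rewrite ?nnegrE ?(ltW bet0) // (le_trans _ cd).
  apply: le_trans h1 _.
  have e1 := expR_ge1Dx (C * d `^ bet); have c1 := exp cS'.
  have e0 : 0 <= C * d `^ bet by rewrite mulr_ge0 ?powR_ge0 // ltW.
  apply: (@le_trans _ _ ((1 + C * d `^ bet) * `|f1 c'|)); last first.
    by apply: ler_wpM2r; [exact: normr_ge0|exact: e1].
  rewrite [leRHS](_ : _ = `|f1 c'| + C * d `^ bet * `|f1 c'|); last by ring.
  by rewrite lerD2l; exact: ler_peMr e0 (ltW c1).
Qed.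

End Branch.

Lemma Cr_branch (R : realType) (r : \bar R) : (1%:E < r)%E -> exists2 bet : R, 0 < bet &
  forall l m f, l < m -> Cr_in `[l, m]%classic r f ->
    (forall x, `[l, m]%classic x -> 1 < `|derive_in `[l, m]%classic f x|) ->
    exists o C, branch_spec bet o l m f C.
Proof.
move=> r1; have [bet bet0 Hb] := Cr_in_holder r1; exists bet => // l m f lm Cr ex.
have [der [H Hge0 hol]] := Hb l m f lm Cr.
have ex' x : l <= x <= m -> 1 < `|derive_in `[l, m]%classic f x|.
  by move=> xI; apply: ex; rewrite /= in_itv.
by exists (derive_in `[l, m]%classic f l < 0); exact: (branch_constants lm bet0 Hge0 der hol ex').
Qed.

Lemma uniform_bound (R : realType) (T : finType) (P : T -> R -> Prop) :
  (forall t c c', c <= c' -> P t c -> P t c') -> (forall t, exists c, P t c) ->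
  exists c, forall t, P t c.
Proof.
move=> mono ex; have [c Pc] := choice ex; exists (\sum_t `|c t|) => t.
apply: mono (Pc t); apply: le_trans (ler_norm _) _.
by rewrite (bigD1 t) //= lerDl sumr_ge0.
Qed.

(** Mixing is applied to two points of the subshift translated so that [a] and [b] stand at index
    0. *)
Lemma mixing_connectable (Sigma : subshift) (a b : Sigma) :
  exists s, [/\ path (@trans Sigma) a s, last a s = b & s != [::]].
Proof.
have [x0 Bx0 [i xi]] := trans_letters a; have [y0 By0 [j yj]] := trans_letters b.
have sh (z : int -> Sigma) (k : int) : biinfinite (@trans Sigma) z ->
    biinfinite (@trans Sigma) (fun l => z (l + k)).
  by move=> Bz l; rewrite addrAC; exact: Bz.
have [N HN] := trans_mixing (sh x0 i Bx0) (sh y0 j By0) 0%N.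
(* The maximum with 1 makes the connecting word nonempty. *)
have [z [Bz zx zy]] := HN (maxn N 1) (leq_maxl _ _).
exists [seq z (Posz k) | k <- iota 1 (maxn N 1)].
have z0 : z 0 = a by rewrite zx // add0r.
have pth n k : path (@trans Sigma) (z (Posz k)) [seq z (Posz l) | l <- iota k.+1 n] /\
    last (z (Posz k)) [seq z (Posz l) | l <- iota k.+1 n] = z (Posz (k + n)).
  elim: n k => [|n IH] k /=; first by rewrite addn0.
  have [p1 l1] := IH k.+1; rewrite p1 l1 addSnnS; split => //.
  by rewrite andbT -addn1 PoszD; exact: Bz.
have [p1 l1] := pth (maxn N 1) 0%N; rewrite -z0; split => //.
- by rewrite l1 add0n; have := zy 0; rewrite normr0 add0r => ->; rewrite // add0r.
- by rewrite -size_eq0 size_map size_iota -lt0n leq_max orbT.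
Qed.

Lemma inverse_slope (R : realType) (l m C : R) (o : bool) (f : R -> R) (u w x y : R) :
  (forall x y, l <= x <= m -> l <= y <= m -> x < y ->
     (1 + C^-1) * (y - x) <= (-1) ^+ o * (f y - f x) <= C * (y - x)) ->
  l <= u <= m -> l <= w <= m -> f u = x -> f w = y -> 2 <= C -> x < y ->
  C^-1 * (y - x) <= (-1) ^+ o * (w - u) <= (1 + C^-1)^-1 * (y - x).
Proof.
move=> sl uI wI fu fw C2 xy; have C0 : 0 < C by lra.
have Ci : 0 < C^-1 by rewrite invr_gt0.
have k0 : 0 < 1 + C^-1 by lra.
have fin t : (1 + C^-1) * t <= y - x <= C * t -> C^-1 * (y - x) <= t <= (1 + C^-1)^-1 * (y - x).
  by rewrite (mulrC C^-1) (mulrC (_^-1)) ler_pdivrMr // ler_pdivlMr // (mulrC t) (mulrC t) andbC.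
apply: fin; case: (ltgtP u w) => [uw|wu|uw]; last by move: xy; rewrite -fu -fw uw ltxx.
- have := sl u w uI wI uw; rewrite fu fw; case: o {sl}; rewrite ?expr1 ?expr0 ?mulN1r ?mul1r //.
  move=> /andP[h _]; have : 0 < (1 + C^-1) * (w - u) by rewrite mulr_gt0 // subr_gt0.
  move: h; set z := _ * (w - u); lra.
- have := sl w u wI uI wu; rewrite fu fw; case: o {sl}; rewrite ?expr1 ?expr0 ?mulN1r ?mul1r ?opprB //.
  move=> /andP[h _]; have : 0 < (1 + C^-1) * (u - w) by rewrite mulr_gt0 // subr_gt0.
  move: h; set z := _ * (u - w); lra.
Qed.

Lemma between_closed (R : realType) (l m x y c : R) : Num.min x y <= c -> c <= Num.max x y ->
  l <= x <= m -> l <= y <= m -> l <= c <= m.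
Proof.
by case: (leP x y) => _ ? ? /andP[? ?] /andP[? ?]; apply/andP; split; lra.
Qed.

Lemma invert_ratio (R : realType) (A B C D E : R) : 0 < A -> 0 < B -> 0 < C -> 0 < D ->
  D / C <= E * (B / A) -> A / B <= E * (C / D).
Proof.
move=> A0 B0 C0 D0; rewrite !mulrA !ler_pdivrMr //.
rewrite (mulrAC _ A^-1) ler_pdivlMr // (mulrAC _ D^-1) ler_pdivlMr //.
by rewrite (mulrC A) (mulrAC E B).
Qed.

(** A neighbourhood of a point outside the interval contains no point of it, so any [P] follows. The
    radius is an inverse [D^-1], so that the condition weakens as [D] grows, as [uniform_bound]
    requires. *)
Lemma away_from (R : realType) (l m x : R) (P : Prop) : ~~ (l <= x <= m) ->
  exists D, 0 < D /\ forall y, true -> l <= y <= m -> `|y - x| < D^-1 -> P.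
Proof.
rewrite negb_and -!ltNge => /orP[xl|mx].
- exists (l - x)^-1; split; first by rewrite invr_gt0 subr_gt0.
  move=> y _ /andP[ly _]; rewrite invrK ltr_norml => /andP[_ ?]; exfalso; lra.
- exists (x - m)^-1; split; first by rewrite invr_gt0 subr_gt0.
  move=> y _ /andP[_ ym]; rewrite invrK ltr_norml => /andP[? _]; exfalso; lra.
Qed.

(** * Inverse branches of an expanding map *)

Section InverseSystem.
Context {R : realType} {Sigma : subshift} {r : \bar R}.
Variable g : expanding_map Sigma r.
Hypothesis r1 : (1%:E < r)%E.

Lemma branch_bij a b : trans a b -> [/\ lo g a b < hi g a b,
  forall x, lo g a b <= x <= hi g a b -> pos g b <= g x <= pos g b + 1,
  forall x y, lo g a b <= x <= hi g a b -> lo g a b <= y <= hi g a b -> g x = g y -> x = y &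
  forall y, pos g b <= y <= pos g b + 1 -> exists2 x, lo g a b <= x <= hi g a b & g x = y].
Proof.
move=> ab; have [[g1 g2 g3] _ _] := branch_diffeo g ab.
have surj y : pos g b <= y <= pos g b + 1 -> exists2 x, lo g a b <= x <= hi g a b & g x = y.
  move=> yI; have [|x xI E] := g3 y; first by rewrite /= in_itv.
  by exists x => //; move: xI; rewrite /= in_itv.
split => //.
- have [|x /andP[x1 x2] Ex] := surj (pos g b); first by rewrite lexx lerDl ler01.
  have [|y /andP[y1 y2] Ey] := surj (pos g b + 1); first by rewrite lexx lerDl ler01.
  rewrite ltNge; apply/negP => h.
  have xy : x = y.
    by apply/eqP; rewrite eq_le (le_trans x2 (le_trans h y1)) (le_trans y2 (le_trans h x1)).
  by move: Ex; rewrite xy Ey => /eqP; rewrite -subr_eq0 addrC addKr oner_eq0.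
- by move=> x y xI yI; apply: g2; rewrite inE /= in_itv.
Qed.

(** The last clause says that near a point of one branch interval the domain of [g] consists of that
    interval alone; it is what relates derivatives relative to the domain to a single inverse
    branch. *)
Lemma inverse_system : exists F : markov_ifs R, [/\
  forall a b x, @tr _ F a b -> inI b x -> dom_map g (br a b x) /\ g (br a b x) = x,
  forall y, dom_map g y -> exists a b x, [/\ @tr _ F a b, inI b x & y = br a b x] &
  forall a b x, @tr _ F a b -> inI b x -> exists2 d, 0 < d & forall y, dom_map g y ->
    `|y - br a b x| < d -> exists2 z, inI b z & y = br a b z].
Proof.
have [bet bet0 Hbet] := Cr_branch r1.
have spec (e : Sigma * Sigma) : exists oC : bool * R, trans e.1 e.2 ->
    branch_spec bet oC.1 (lo g e.1 e.2) (hi g e.1 e.2) g oC.2.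
  have [ab|nab] := boolP (trans e.1 e.2); last by exists (false, 0).
  have [lh _ _ _] := branch_bij ab.
  have [_ Cr _] := branch_diffeo g ab.
  by have [s [C HC]] := Hbet _ _ g lh Cr (branch_expanding ab); exists (s, C).
have [oC HoC] := choice spec.
have [C HC] : exists C, forall e : Sigma * Sigma, trans e.1 e.2 ->
    branch_spec bet (oC e).1 (lo g e.1 e.2) (hi g e.1 e.2) g C.
  apply: (@uniform_bound R _ (fun (e : Sigma * Sigma) C => trans e.1 e.2 ->
    branch_spec bet (oC e).1 (lo g e.1 e.2) (hi g e.1 e.2) g C)).
    by move=> e c c' cc H ab; exact: branch_spec_mono cc (H ab).
  by move=> e; exists (oC e).2; exact: HoC.
pose C2 := Num.max C 2; have C22 : 2 <= C2 by rewrite le_max lexx orbT.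
pose o a b := (oC (a, b)).1.
have Hspec a b : trans a b -> branch_spec bet (o a b) (lo g a b) (hi g a b) g C2.
  by move=> ab; apply: branch_spec_mono (HC (a, b) ab); rewrite le_max lexx.
have inverse (e : Sigma * Sigma * R) : exists x, trans e.1.1 e.1.2 -> pos g e.1.2 <= e.2 <= pos g e.1.2 + 1 ->
    lo g e.1.1 e.1.2 <= x <= hi g e.1.1 e.1.2 /\ g x = e.2.
  have [ab|nab] := boolP (trans e.1.1 e.1.2); last by exists 0.
  have [eI|neI] := boolP (pos g e.1.2 <= e.2 <= pos g e.1.2 + 1); last by exists 0.
  by have [_ _ _ surj] := branch_bij ab; have [x xI E] := surj _ eI; exists x.
have [bb Hbb] := choice inverse; pose B a b x := bb (a, b, x).
have HB a b x : trans a b -> pos g b <= x <= pos g b + 1 ->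
   lo g a b <= B a b x <= hi g a b /\ g (B a b x) = x by exact: (Hbb (a, b, x)).
have BK a b y : trans a b -> lo g a b <= y <= hi g a b -> B a b (g y) = y.
  move=> ab yI; have [_ g1 g2 _] := branch_bij ab.
  by have [h1 h2] := HB a b (g y) ab (g1 y yI); apply: g2 => //.
have kC0 : 0 < C2^-1 by rewrite invr_gt0; lra.
pose K := (1 + C2^-1)^-1.
have K0 : 0 < K by rewrite invr_gt0; lra.
have K1 : K < 1 by rewrite invf_lt1 //; lra.
have CK : C2^-1 <= K.
  rewrite lef_pV2 ?posrE; try lra.
  apply: le_trans (C22); have : C2^-1 <= 1 by rewrite invf_le1 //; lra.
  lra.
have Bslope a b x y : trans a b -> pos g b <= x -> x < y -> y <= pos g b + 1 ->
    C2^-1 * (y - x) <= (-1) ^+ o a b * (B a b y - B a b x) <= K * (y - x).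
  move=> ab bx xy yb.
  have xI : pos g b <= x <= pos g b + 1 by rewrite bx (le_trans (ltW xy)).
  have yI : pos g b <= y <= pos g b + 1 by rewrite yb (le_trans bx (ltW xy)).
  have [xS gx] := HB a b x ab xI; have [yS gy] := HB a b y ab yI.
  have [_ sl _] := Hspec a b ab.
  exact: inverse_slope sl xS yS gx gy C22 xy.
have Blip a b x y : trans a b -> pos g b <= x <= pos g b + 1 -> pos g b <= y <= pos g b + 1 ->
    `|B a b x - B a b y| <= `|x - y|.
  suff L u v : trans a b -> pos g b <= u <= pos g b + 1 -> pos g b <= v <= pos g b + 1 -> u < v ->
      `|B a b v - B a b u| <= `|v - u|.
    move=> ab xI yI; case: (ltgtP x y) => [xy|yx|->]; [|exact: L|by rewrite !subrr].
    by rewrite distrC (distrC x); exact: L.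
  move=> ab /andP[u1 u2] /andP[v1 v2] uv; have /andP[s1 s2] := Bslope a b u v ab u1 uv v2.
  have vu : 0 < v - u by rewrite subr_gt0.
  rewrite (gtr0_norm vu) -[leLHS](mul1r) -(expr1n _ (o a b)) -(normrN1 R) -normrX -normrM.
  rewrite ger0_norm; last by apply: le_trans s1; rewrite mulr_ge0 // ltW.
  by apply: le_trans s2 _; rewrite ler_piMl // ltW.
have posI a b x y : lo g a b <= y <= hi g a b -> trans a b -> pos g a <= y <= pos g a + 1.
  move=> yI ab; have Sy : `[lo g a b, hi g a b]%classic y by rewrite /= in_itv.
  by have := branch_sub ab Sy; rewrite /= in_itv.
have disjE (e e' : Sigma * Sigma) y : trans e.1 e.2 -> trans e'.1 e'.2 ->
    lo g e.1 e.2 <= y <= hi g e.1 e.2 -> lo g e'.1 e'.2 <= y <= hi g e'.1 e'.2 -> e = e'.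
  move=> t1 t2 y1 y2; apply: (@branch_disjoint _ _ _ g e e' t1 t2).
  by exists y; split; rewrite /= in_itv.
have base_disj a b x : pos g a <= x <= pos g a + 1 -> pos g b <= x <= pos g b + 1 -> a = b.
  by move=> x1 x2; apply: (@pos_disjoint _ _ _ g a b I I); exists x; split; rewrite /= in_itv.
have [B1 B2 B3 B4] : [/\
    forall a b x, trans a b -> pos g b <= x <= pos g b + 1 -> pos g a <= B a b x <= pos g a + 1,
    forall a b x y u v l, trans a b ->
      (forall p, p \in [:: x; y; u; v] -> pos g b <= p <= pos g b + 1) ->
      (forall p q, p \in [:: x; y; u; v] -> q \in [:: x; y; u; v] -> `|p - q| <= l) ->
      x != y -> u != v ->
      `|B a b x - B a b y| / `|x - y| <=
        expR (C2 * l `^ bet) * (`|B a b u - B a b v| / `|u - v|),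
    forall a b y, trans a b ->
      Num.min (B a b (pos g b)) (B a b (pos g b + 1)) <= y <=
        Num.max (B a b (pos g b)) (B a b (pos g b + 1)) ->
      exists2 x, pos g b <= x <= pos g b + 1 & B a b x = y &
    forall a b b' x x', trans a b -> trans a b' ->
      pos g b <= x <= pos g b + 1 -> pos g b' <= x' <= pos g b' + 1 ->
      B a b x = B a b' x' -> b = b'].
  split.
  - by move=> a b x ab xI; have [h _] := HB a b x ab xI; exact: posI h ab.
  - move=> a b x y u v l ab pI pd xy uv.
    have inp p : p \in [:: x; y; u; v] -> lo g a b <= B a b p <= hi g a b /\ g (B a b p) = p.
      by move=> pp; apply: HB => //; exact: pI.
    have [mx my mu mv] : [/\ x \in [:: x; y; u; v], y \in [:: x; y; u; v],
        u \in [:: x; y; u; v] & v \in [:: x; y; u; v]] by rewrite !inE !eqxx !orbT.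
    have [x1 x2] := inp x mx; have [y1 y2] := inp y my; have [u1 u2] := inp u mu.
    have [v1 v2] := inp v mv.
    have inB p : p \in [:: B a b u; B a b v; B a b x; B a b y] ->
        exists2 p', p' \in [:: x; y; u; v] & p = B a b p'.
      by rewrite 4!in_cons in_nil orbF => /or4P[] /eqP ->; [exists u|exists v|exists x|exists y].
    have bxy : B a b x != B a b y by apply: contra xy => /eqP E; rewrite -x2 -y2 E.
    have buv : B a b u != B a b v by apply: contra uv => /eqP E; rewrite -u2 -v2 E.
    have [_ _ sp] := Hspec a b ab.
    (* The distortion of an inverse branch is that of [g] at the image points with the two pairs
       exchanged; inverse branches do not increase distances, so the bound [l] persists. *)
    have := sp (B a b u) (B a b v) (B a b x) (B a b y) l _ _ buv bxy; rewrite x2 y2 u2 v2 => h.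
    apply: invert_ratio; rewrite ?normr_gt0 ?subr_eq0 ?expR_gt0 //; apply: h.
    + by move=> p /inB[p' pp ->]; have [] := inp p' pp.
    + move=> p q /inB[p' pp ->] /inB[q' qq ->].
      by apply: le_trans (pd p' q' pp qq); apply: Blip => //; exact: pI.
  - move=> a b y ab yI.
    have [|p1 _] := HB a b (pos g b) ab; first by rewrite lexx lerDl ler01.
    have [|p2 _] := HB a b (pos g b + 1) ab; first by rewrite lexx lerDl ler01.
    have yS : lo g a b <= y <= hi g a b.
      by case/andP: yI p1 p2; exact: between_closed.
    have [_ g1 _ _] := branch_bij ab.
    by exists (g y); [exact: g1|exact: BK].
  - move=> a b b' x x' ab ab' xI xI' E.
    have [h1 _] := HB a b x ab xI; have [h2 _] := HB a b' x' ab' xI'.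
    by rewrite -E in h2; have [] := disjE (a, b) (a, b') _ ab ab' h1 h2.
have CKK : C2^-1 <= K < 1 by rewrite CK K1.
have C20 : 0 <= C2 by lra.
pose F := @MarkovIfs R Sigma (@trans Sigma) (pos g) B o C2^-1 K C2 bet kC0 CKK C20 bet0
  base_disj B1 Bslope B2 B3 B4 (@mixing_connectable Sigma).
exists F; split.
- move=> a b x ab xI; have [h1 h2] := HB a b x ab xI; split => //.
  by exists (a, b) => //; rewrite /itvI2 /= in_itv.
- move=> y [[a b] /= ab]; rewrite /itvI2 /= in_itv /= => yI.
  have [_ g1 _ _] := branch_bij ab.
  by exists a, b, (g y); split; [exact: ab|exact: g1|rewrite /= BK].
- move=> a b x ab xI; have [xS gx] := HB a b x ab xI.
  have [D HD] : exists D : R, forall e : Sigma * Sigma, 0 < D /\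
      (forall y, trans e.1 e.2 -> lo g e.1 e.2 <= y <= hi g e.1 e.2 ->
       `|y - B a b x| < D^-1 -> e = (a, b)).
    apply: (@uniform_bound R _ (fun (e : Sigma * Sigma) D => 0 < D /\
      (forall y, trans e.1 e.2 -> lo g e.1 e.2 <= y <= hi g e.1 e.2 ->
       `|y - B a b x| < D^-1 -> e = (a, b)))).
      move=> e c c' cc [c0 H]; split; first exact: lt_le_trans cc.
      move=> y t yI yd; apply: H t yI _; apply: lt_le_trans yd _.
      by rewrite lef_pV2 ?posrE // (lt_le_trans c0).
    move=> e; have [xe|nxe] := boolP (trans e.1 e.2 && (lo g e.1 e.2 <= B a b x <= hi g e.1 e.2)).
      exists 1; split=> // y _ _ _; case/andP: xe => t h.
      exact: disjE e (a, b) _ t ab h xS.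
    have [te|nte] := boolP (trans e.1 e.2); last by exists 1; split=> // y t; rewrite t in nte.
    rewrite te /= in nxe.
    exact: (@away_from R (lo g e.1 e.2) (hi g e.1 e.2) (B a b x) (e = (a, b)) nxe).
  have [D0 _] := HD (a, b).
  exists D^-1; first by rewrite invr_gt0.
  move=> y [e te]; rewrite /itvI2 /= in_itv /= => yI yd.
  have [_ h] := HD e; have E := h y te yI yd; rewrite E /= in yI.
  have [_ g1 _ _] := branch_bij ab.
  by exists (g y); [exact: g1|rewrite /= BK].
Qed.

End InverseSystem.

(** * Limit set and eigenvalues in terms of the map *)

Section Dynamics.
Context {R : realType}.
Variables (F : markov_ifs R) (T : R -> R) (D : set R).
Hypothesis T_br : forall a b x, @tr _ F a b -> inI b x -> D (br a b x) /\ T (br a b x) = x.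
Hypothesis D_br : forall y, D y -> exists a b x, [/\ @tr _ F a b, inI b x & y = br a b x].
Hypothesis D_sep : forall a b x, @tr _ F a b -> inI b x -> exists2 d, 0 < d & forall y, D y ->
  `|y - br a b x| < d -> exists2 z, inI b z & y = br a b z.
Local Notation dom n := [set x | forall i, (i < n)%N -> D (iter i T x)].

Lemma iter_fw (a : alph F) s z : path (@tr _ F) a s -> inI (last a s) z ->
  iter (size s) T (fw a s z) = z /\ dom (size s) (fw a s z).
Proof.
elim: s a => [|b s IH] a //= /andP[ab ps] zI.
have [h1 h2] := IH b ps zI; have [Db Tb] := T_br ab (fw_in ps zI).
split; first by rewrite -iterS iterSr Tb.
by move=> [|i] // iS; rewrite iterSr Tb; exact: h2.
Qed.

Lemma coding n x : dom n.+1 x -> exists a s,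
  [/\ size s = n.+1, path (@tr _ F) a s & cyl a s x].
Proof.
elim: n x => [|n IH] x Dx; have [a [b [y [ab yI /= xE]]]] := D_br (Dx 0%N isT).
  exists a, [:: b]; split; rewrite //= ?ab //.
  by exists y.
have [_ Ty] := T_br ab yI; rewrite -xE in Ty.
have [|a' [s [sn ps [z zI zE]]]] := IH y.
  by move=> i iN; rewrite -Ty -iterSr; exact: Dx.
have E : b = a'.
  by apply: base_disj yI _; rewrite -zE; exact: fw_in.
exists a, (b :: s); split; first by rewrite /= sn.
  by rewrite /= ab E.
by exists z; rewrite /= E // zE xE E.
Qed.

Lemma limset_dynamics : limset F = \bigcap_n (iter n T @^-1` D).
Proof.
apply/seteqP; split=> x xl.
  move=> n _; have [a [s [ns ps [z zI <-]]]] := xl n.+1.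
  by have [_] := iter_fw ps zI; apply.
move=> n; have [|a [s [sn ps cx]]] := @coding n x; first by move=> i _; exact: xl.
by exists a, s; split=> //; rewrite sn.
Qed.

(** Close to a point of a cylinder, the domain of the iterate is contained in that cylinder. The
    clause for [s = [::]] is needed because the domain of the zeroth iterate is the whole line. *)
Lemma local_coding (a : alph F) s z : path (@tr _ F) a s -> inI (last a s) z ->
  exists2 d, 0 < d & forall y, (s = [::] -> inI a y) -> dom (size s) y ->
    `|y - fw a s z| < d -> cyl a s y.
Proof.
elim: s a z => [|b s IH] a z /=.
  by move=> _ zI; exists 1 => // y yI _ _; exists y => //=; exact: yI.
move=> /andP[ab ps] zI; have [d2 d20 H2] := IH b z ps zI.
have xI := fw_in ps zI; have [d1 d10 H1] := D_sep ab xI.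
have c0 := cmin_gt0 F.
exists (Num.min d1 (cmin F * d2)); first by rewrite lt_min d10 mulr_gt0.
move=> y _ Dy; rewrite lt_min => /andP[y1 y2].
have [w wI wE] := H1 y (Dy 0%N isT) y1.
have [_ Tw] := T_br ab wI; rewrite -wE in Tw.
have wd : `|w - fw b s z| < d2.
  have pab : path (@tr _ F) a [:: b] by rewrite /= ab.
  have /andP[h _] := fw_le pab wI xI.
  rewrite -(ltr_pM2l c0); apply: le_lt_trans y2.
  by move: h; rewrite /= expr1 wE.
have Dw : dom (size s) w by move=> i iN; rewrite -Tw -iterSr; exact: Dy.
have [z' zI' zE'] := H2 w (fun=> wI) Dw wd.
by exists z' => //=; rewrite zE' wE.
Qed.

Lemma periodic_cycle n x : (0 < n)%N -> dom n x -> iter n T x = x ->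
  exists a s, size s = n /\ @is_cycle R F a s x.
Proof.
case: n => // n _ Dx xn; have [a [s [sn ps cx]]] := coding Dx.
have xI := cyl_inI ps cx; case: cx => z zI zE.
have [zx _] := iter_fw ps zI; rewrite zE sn xn in zx; rewrite -zx in zI zE.
exists a, s; split=> //; split=> //; last by rewrite -size_eq0 sn.
exact: base_disj zI xI.
Qed.

Lemma cycle_nearby a s x d : @is_cycle R F a s x -> 0 < d ->
  exists2 w, inI a w & 0 < `|w - x| < d.
Proof.
move=> [_ _ _ /andP[xI1 xI2] _] d0; pose t := Num.min d 1 / 2.
have [t0 td t1] : [/\ 0 < t, t < d & t <= 1 / 2].
  by rewrite /t; case: (leP d 1) => h; split; lra.
have [h|h] := leP x (@base _ F a + 1 / 2).
- exists (x + t); first by apply/andP; split; lra.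
  by rewrite (addrC x) addrK gtr0_norm // t0 td.
- exists (x - t); first by apply/andP; split; lra.
  by rewrite addrAC subrr sub0r normrN gtr0_norm // t0 td.
Qed.

Lemma expR_near (A e : R) : 0 < e -> exists2 d, 0 < d & forall t, `|t - A| <= d ->
  `|expR t - expR A| < e.
Proof.
move=> e0; have /cvgrPdist_lt/(_ _ e0) := @continuous_expR R A.
move=> /nbhs_ballP[d /= d0 Hd]; exists (d / 2); first by rewrite divr_gt0.
move=> t td; rewrite distrC; apply: Hd; rewrite /ball /= distrC.
by apply: le_lt_trans td _; rewrite ltr_pdivrMr // ltr_pMr // ltr1n.
Qed.

(** Locally the iterate inverts [fw a s], so its difference quotients are the inverses of secant
    slopes whose logarithms tend to [- A]. *)
Lemma multiplier_derivative a s x A : @multiplier R F a s x A ->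
  derive_in (dom (size s)) (iter (size s) T) x = (-1) ^+ sgw a s * expR A.
Proof.
move=> [cyc A0 [E E0 HE]]; have [ps ls s0 xI fx] := cyc.
have c0 : 0 < cmin F ^+ size s by rewrite exprn_gt0 // cmin_gt0.
have b0 := bet_gt0 F.
have fxI : inI (last a s) x by rewrite ls.
have [d1 d10 H1] := local_coding ps fxI; rewrite fx in H1.
have [xn _] := iter_fw ps fxI; rewrite fx in xn.
apply: cvg_lim => //; last first.
  apply/slope_inP => e e0; have [d2 d20 H2] := expR_near A e0.
  have dE : 0 < d2 / (E + 1) by rewrite divr_gt0 // ltr_wpDl.
  pose d3 := (d2 / (E + 1)) `^ (bet F)^-1; have d30 : 0 < d3 by rewrite powR_gt0.
  exists (Num.min d1 (cmin F ^+ size s * d3)); first by rewrite lt_min d10 mulr_gt0.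
  move=> y Dy yx; rewrite lt_min => /andP[yd1 yd2].
  have [|w wI wE] := H1 y _ Dy yd1; first by move=> sE; rewrite sE in s0.
  have [yn _] := iter_fw ps wI; rewrite wE in yn; rewrite yn xn.
  have wx : w != x by apply: contra yx => /eqP wx; rewrite -wE wx fx.
  have wd : `|w - x| < d3.
    rewrite -(ltr_pM2l c0); apply: le_lt_trans yd2; rewrite -wE -{2}fx.
    by have /andP[] := fw_le ps wI fxI.
  have eq1 : (w - x) / (y - x) = (-1) ^+ sgw a s * expR (- lslope a s w x).
    have h := fw_diff ps wI fxI wx; have h0 := slope_gt0 ps wI fxI wx.
    rewrite /lslope expRN lnK ?posrE //.
    move: h; rewrite fx wE; move: (`|y - x| / `|w - x|) => S ->; rewrite invfM mulrCA mulfV ?subr_eq0 // mulr1.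
    by rewrite invfM invr_sign.
  rewrite eq1 -mulrBr normrM normrX normrN1 expr1n mul1r; apply: H2.
  rewrite -opprD normrN; rewrite ls in wI.
  have := HE `|w - x| w x wI xI wx (lexx _); rewrite subrr normr0 => /(_ (normr_ge0 _)) h.
  apply: le_trans h _.
  have : `|w - x| `^ bet F <= d2 / (E + 1).
    have <- : d3 `^ bet F = d2 / (E + 1).
      by rewrite /d3 -powRrM mulVf ?gt_eqF // powRr1 // ltW.
    by apply: ge0_ler_powR; rewrite ?nnegrE ?(ltW b0) ?(ltW d30) // ltW.
  rewrite ler_pdivlMr ?ltr_wpDl // mulrDr mulr1 mulrC; apply: le_trans.
  by rewrite lerDl powR_ge0.
(* Uniqueness of the limit requires that [x] be an accumulation point of the domain of the iterate;
   images under [fw a s] of nearby points show this. *)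
apply: Build_ProperFilter.
rewrite /within /= => /nbhs_ballP[d /= d0 Hd].
have [w wI /andP[w0 wd]] := cycle_nearby cyc d0; rewrite -ls in wI.
have [yn Dy] := iter_fw ps wI.
have le := fw_le ps wI fxI; rewrite fx in le.
apply: (Hd (fw a s w) _ _ Dy).
  rewrite /ball /= distrC; case/andP: le => _ h; apply: le_lt_trans h _.
  apply: le_lt_trans wd; rewrite ler_piMl // exprn_ile1 //.
    exact: ltW (kap_gt0 F).
  by have := kap_lt1 F; lra.
apply/eqP => E1; case/andP: le; rewrite E1 subrr normr0 pmulr_rle0 //.
by rewrite leNgt w0.
Qed.

End Dynamics.

(** All that the dimension argument needs from an expanding map: its Cantor set as a limit set, and
    the logarithms of its eigenvalues as multipliers. *)
Lemma ifs_of_map (R : realType) (Sigma : subshift) (r : \bar R) (g : expanding_map Sigma r) :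
  (1%:E < r)%E -> exists F : markov_ifs R, limset F = cantor_set g /\
  forall x mu, periodic_eigenvalue g x mu ->
    exists (a : alph F) s A, multiplier a s x A /\ ln `|mu| = A.
Proof.
move=> r1; have [F [h1 h2 h3]] := inverse_system g r1.
exists F; split; first exact: limset_dynamics h1 h2.
move=> x mu [xK [n [n0 xn _ ->]]].
have [a [s [sn cyc]]] := periodic_cycle h1 h2 n0 (fun i _ => xK i I) xn.
have [A mul] := multiplier_exists cyc.
exists a, s, A; split=> //.
have := multiplier_derivative h1 h3 mul; rewrite sn => ->.
by rewrite normrM normrX normrN1 expr1n mul1r gtr0_norm ?expR_gt0 // expRK.
Qed.

(** * Differentiable images *)

Section Compactness.
Context {R : realType}.
Variable F : markov_ifs R.

Lemma limset_words n : limset F `<=`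
  \bigcup_(e in [set e : alph F * n.-tuple (alph F) | path (@tr _ F) e.1 e.2]) cyl e.1 e.2.
Proof.
move=> x /(_ n)[a [s [ns ps cx]]].
have st : size (take n s) == n by rewrite size_take_min (minn_idPl ns).
exists (a, Tuple st); first by move: ps; rewrite -{1}(cat_take_drop n s) cat_path => /andP[].
by apply: (@cyl_sub _ _ _ _ (drop n s)); rewrite cat_take_drop.
Qed.

Lemma cyl_closed (a : alph F) s : path (@tr _ F) a s -> closed (cyl a s).
Proof.
move=> ps; rewrite (_ : cyl a s = `[lo_w a s, lo_w a s + len_w a s]%classic).
  exact: interval_closed.
by apply/seteqP; split=> x; rewrite /= in_itv /= => /(cylE _ ps).
Qed.

Lemma limset_compact : compact (limset F).
Proof.
have [m [M HM]] := limset_bounded F.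
apply: (@subclosed_compact _ (limset F) `[m, M]%classic).
- rewrite (_ : limset F = \bigcap_n \bigcup_(e in [set e : alph F * n.-tuple (alph F) |
      path (@tr _ F) e.1 e.2]) cyl e.1 e.2).
    apply: closed_bigI => n _; apply: closed_bigcup => [|e pe].
      exact: finite_finset.
    exact: cyl_closed.
  apply/seteqP; split=> x; first by move=> xl n _; exact: limset_words.
  by move=> H n; have [[a s] /= ps cx] := H n I; exists a, s; rewrite size_tuple.
- exact: segment_compact.
- by move=> x /HM; rewrite /= in_itv.
Qed.

End Compactness.

Lemma partial_fst (R : realType) (h : R * R -> R) x y : differentiable h (x, y) ->
  is_derive x 1 (fun t => h (t, y)) ('D_(1, 0) h (x, y)).
Proof.
move=> /diff_derivable dh.
have E : (fun k : R => k^-1 *: (((fun t => h (t, y)) \o shift x) (k *: 1) - h (x, y))) =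
         (fun k : R => k^-1 *: ((h \o shift (x, y)) (k *: (1, 0)) - h (x, y))).
  apply/funext => k /=; congr (_ *: (h _ - _)).
  by apply: injective_projections; rewrite /= ?scaler0 ?add0r.
by split; rewrite /derivable /derive E //; exact: dh.
Qed.

Lemma partial_snd (R : realType) (h : R * R -> R) x y : differentiable h (x, y) ->
  is_derive y 1 (fun t => h (x, t)) ('D_(0, 1) h (x, y)).
Proof.
move=> /diff_derivable dh.
have E : (fun k : R => k^-1 *: (((fun t => h (x, t)) \o shift y) (k *: 1) - h (x, y))) =
         (fun k : R => k^-1 *: ((h \o shift (x, y)) (k *: (0, 1)) - h (x, y))).
  apply/funext => k /=; congr (_ *: (h _ - _)).
  by apply: injective_projections; rewrite /= ?scaler0 ?add0r.
by split; rewrite /derivable /derive E //; exact: dh.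
Qed.

Section LocalStructure.
Context {R : realType}.
Variables (U : set (R * R)) (h D1 D2 : R * R -> R).
Hypothesis U_open : open U.
Hypothesis hU : forall x y, U (x, y) ->
  [/\ is_derive x 1 (fun t => h (t, y)) (D1 (x, y)),
      is_derive y 1 (fun t => h (x, t)) (D2 (x, y)),
      {for (x, y), continuous D1} & {for (x, y), continuous D2}].

Lemma mean_value_bound (f df : R -> R) (p eta lo hi u v : R) : 0 <= eta ->
  (forall t, lo <= t <= hi -> is_derive t 1 f (df t) /\ `|df t - p| <= eta) ->
  lo <= u <= hi -> lo <= v <= hi -> `|f u - f v - p * (u - v)| <= eta * `|u - v|.
Proof.
move=> eta0 H.
suff K a b : lo <= a <= hi -> lo <= b <= hi -> a < b ->
    `|f b - f a - p * (b - a)| <= eta * `|b - a|.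
  move=> uI vI; case: (ltgtP u v) => [uv|vu|->]; [|exact: K|by rewrite !subrr mulr0 subrr !normr0 mulr0].
  rewrite (distrC u) -[leLHS]normrN.
  have -> : - (f u - f v - p * (u - v)) = f v - f u - p * (v - u) by ring.
  exact: K.
move=> /andP[a1 a2] /andP[b1 b2] ab.
have inI t : a <= t <= b -> lo <= t <= hi.
  by move=> /andP[ta tb]; rewrite (le_trans a1) // (le_trans tb).
have [||c] := @MVT R f df a b ab.
- by move=> t; rewrite in_itv /= => /andP[ta tb]; have [] := H t (inI t _); rewrite ?(ltW ta) ?(ltW tb).
- apply: derivable_within_continuous => t; rewrite in_itv /= => tI.
  by have [[]] := H t (inI t tI).
rewrite in_itv /= => /andP[ca cb] ->; rewrite -mulrBl normrM ler_wpM2r //.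
by have [] := H c (inI c _); rewrite ?(ltW ca) ?(ltW cb).
Qed.

(** Moving one coordinate at a time inside a box where both partial derivatives are nearly constant
    linearises differences between any two nearby points, not only differences with [(x, y)]. *)
Lemma strict_differentiability x y eta : U (x, y) -> 0 < eta ->
  exists2 del, 0 < del & forall x1 x2 y1 y2,
     `|x1 - x| <= del -> `|x2 - x| <= del -> `|y1 - y| <= del -> `|y2 - y| <= del ->
     `|h (x1, y1) - h (x2, y2) -
        (D1 (x, y) * (x1 - x2) + D2 (x, y) * (y1 - y2))| <=
       eta * (`|x1 - x2| + `|y1 - y2|).
Proof.
move=> Uz eta0; have [_ _ /cvgrPdist_lt/(_ _ eta0) c1 /cvgrPdist_lt/(_ _ eta0) c2] := hU Uz.
have nU : nbhs (x, y) U by apply: open_nbhs_nbhs.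
have : nbhs (x, y) (U `&` ([set z | `|D1 (x, y) - D1 z| < eta] `&`
    [set z | `|D2 (x, y) - D2 z| < eta])) by apply: filterI => //; apply: filterI.
move=> /nbhs_ballP[d /= d0 Hd].
have d20 : 0 < d / 2 by rewrite divr_gt0.
exists (d / 2) => // x1 x2 y1 y2 hx1 hx2 hy1 hy2.
have box u v : x - d / 2 <= u <= x + d / 2 -> y - d / 2 <= v <= y + d / 2 ->
    [/\ U (u, v), `|D1 (u, v) - D1 (x, y)| <= eta &
      `|D2 (u, v) - D2 (x, y)| <= eta].
  move=> /andP[u1 u2] /andP[v1 v2]; have [] := Hd (u, v).
    by split; rewrite /ball /= ltr_norml; apply/andP; split; lra.
  by move=> Uuv [e1 e2]; split; rewrite // distrC ltW.
have rg (t z : R) : `|t - z| <= d / 2 -> z - d / 2 <= t <= z + d / 2.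
  by rewrite ler_norml => /andP[? ?]; apply/andP; split; lra.
move/rg in hx1; move/rg in hx2; move/rg in hy1; move/rg in hy2.
have m1 : `|h (x1, y1) - h (x2, y1) - D1 (x, y) * (x1 - x2)| <= eta * `|x1 - x2|.
  apply: (@mean_value_bound (fun t => h (t, y1)) (fun t => D1 (t, y1)) _ _
    _ _ _ _ (ltW eta0) _ hx1 hx2) => t tI.
  by have [Ut e1 _] := box t y1 tI hy1; have [dt _ _ _] := hU Ut.
have m2 : `|h (x2, y1) - h (x2, y2) - D2 (x, y) * (y1 - y2)| <= eta * `|y1 - y2|.
  apply: (@mean_value_bound (fun t => h (x2, t)) (fun t => D2 (x2, t)) _ _
    _ _ _ _ (ltW eta0) _ hy1 hy2) => t tI.
  by have [Ut _ e1] := box x2 t hx2 tI; have [_ dt _ _] := hU Ut.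
rewrite [leRHS]mulrDr; apply: (le_trans _ (lerD m1 m2)); apply: (le_trans _ (ler_normD _ _)).
by rewrite le_eqVlt; apply/orP; left; apply/eqP; congr (`|_|); ring.
Qed.

Lemma local_lipschitz x y : U (x, y) -> exists C del, [/\ 0 < C, 0 < del &
  forall x1 x2 y1 y2,
     `|x1 - x| <= del -> `|x2 - x| <= del -> `|y1 - y| <= del -> `|y2 - y| <= del ->
     `|h (x1, y1) - h (x2, y2)| <= C * (`|x1 - x2| + `|y1 - y2|)].
Proof.
move=> Uz; have [del del0 H] := strict_differentiability Uz ltr01.
set p := D1 (x, y) in H; set q := D2 (x, y) in H.
exists (`|p| + `|q| + 1), del; split; [by apply: ltr_wpDl => //; apply: addr_ge0|exact: del0|].
move=> x1 x2 y1 y2 hx1 hx2 hy1 hy2; have := H x1 x2 y1 y2 hx1 hx2 hy1 hy2; rewrite mul1r => h1.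
have n1 := normrM p (x1 - x2); have n2 := normrM q (y1 - y2).
have n3 := ler_normD (p * (x1 - x2)) (q * (y1 - y2)).
have n4 := lerB_dist (h (x1, y1) - h (x2, y2)) (p * (x1 - x2) + q * (y1 - y2)).
have n5 := normr_ge0 (x1 - x2); have n6 := normr_ge0 (y1 - y2).
have n7 : 0 <= `|p| * `|y1 - y2| by rewrite mulr_ge0.
have n8 : 0 <= `|q| * `|x1 - x2| by rewrite mulr_ge0.
rewrite n1 n2 in n3; rewrite !mulrDl !mulrDr !mul1r.
move: (`|p| * `|x1 - x2|) (`|q| * `|y1 - y2|) (`|p * _ + _|) (`|p| * _) (`|q| * _) n3 n4 n7 n8 h1.
move: (`|h (x1, y1) - h (x2, y2) - _|) (`|_ - _|) (`|x1 - x2|) (`|y1 - y2|) n5 n6.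
clear; move=> *; lra.
Qed.

(** A single integer [n] encodes both the Lipschitz constant and the inverse radius, so the property
    holds for all large [n] locally and compactness makes it uniform. *)
Lemma uniform_lipschitz (K : set (R * R)) : compact K -> K `<=` U -> exists n : nat,
  forall x y x1 x2 y1 y2, K (x, y) ->
     `|x1 - x| <= n.+1%:R^-1 -> `|x2 - x| <= n.+1%:R^-1 ->
     `|y1 - y| <= n.+1%:R^-1 -> `|y2 - y| <= n.+1%:R^-1 ->
     `|h (x1, y1) - h (x2, y2)| <= n.+1%:R * (`|x1 - x2| + `|y1 - y2|).
Proof.
move=> /compact_near_coveringP cK KU.
pose P (n : nat) (z : R * R) := forall x1 x2 y1 y2,
  `|x1 - z.1| <= n.+1%:R^-1 -> `|x2 - z.1| <= n.+1%:R^-1 ->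
     `|y1 - z.2| <= n.+1%:R^-1 -> `|y2 - z.2| <= n.+1%:R^-1 ->
     `|h (x1, y1) - h (x2, y2)| <= n.+1%:R * (`|x1 - x2| + `|y1 - y2|).
have [|N _ HN] := cK nat \oo P _; last first.
  exists N => x y x1 x2 y1 y2 Kz; exact: (HN N (leqnn N) (x, y) Kz).
move=> [x y] Kz; have [C [del [C0 del0 H]]] := local_lipschitz (KU _ Kz).
pose N := Num.truncn (C + 2 / del).
exists (ball (x, y) (del / 2), [set n | (N <= n)%N]).
  by split; [apply: nbhsx_ballx; rewrite divr_gt0|exists N].
move=> [[x' y'] n] [/= [bx by_] Nn] x1 x2 y1 y2 /=.
have hn : C + 2 / del <= n.+1%:R.
  by apply: le_trans (ltW (truncnS_gt _)) _; rewrite ler_nat.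
have d20 : 0 < 2 / del by rewrite divr_gt0.
have n0 : 0 < n.+1%:R :> R by rewrite ltr0n.
have ni : n.+1%:R^-1 <= del / 2.
  rewrite -[del / 2]invrK lef_pV2 ?posrE ?invr_gt0 ?divr_gt0 // invf_div; lra.
have tri (u v w : R) : ball u (del / 2) v -> `|w - v| <= n.+1%:R^-1 -> `|w - u| <= del.
  rewrite /ball /= => b1 b2; rewrite (splitr del) -(subrK v w) -addrA.
  apply: le_trans (ler_normD _ _) _; apply: lerD; first exact: le_trans ni.
  by rewrite distrC ltW.
move=> hx1 hx2 hy1 hy2.
apply: le_trans (H x1 x2 y1 y2 (tri _ _ _ bx hx1) (tri _ _ _ bx hx2) (tri _ _ _ by_ hy1) (tri _ _ _ by_ hy2)) _.
by rewrite ler_wpM2r ?addr_ge0 //; lra.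
Qed.

Lemma image_bounded (K : set (R * R)) : compact K -> K `<=` U ->
  exists m M, forall z, K z -> m <= h z <= M.
Proof.
move=> /compact_near_coveringP cK KU.
have [|N _ HN] := cK nat \oo (fun n z => `|h z| <= n%:R) _; last first.
  by exists (- N%:R), N%:R => z Kz; rewrite -ler_norml; exact: (HN N (leqnn N)).
move=> [x y] Kz; have [C [del [C0 del0 H]]] := local_lipschitz (KU _ Kz).
pose N := (Num.truncn (`|h (x, y)| + C * (del + del))).+1.
exists (ball (x, y) del, [set n | (N <= n)%N]).
  by split; [exact: nbhsx_ballx|exists N].
move=> [[x' y'] n] [/= [bx by_] Nn] /=.
apply: le_trans (_ : N%:R <= _); last by rewrite ler_nat.
apply: le_trans (ltW (truncnS_gt _)).
rewrite -(subrK (h (x, y)) (h (x', y'))) addrC; apply: le_trans (ler_normD _ _) _.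
rewrite lerD2l; move: bx by_; rewrite /ball /= distrC (distrC y) => bx by_.
apply: le_trans (H x' x y' y _ _ _ _) _; rewrite ?subrr ?normr0 ?(ltW del0) ?(ltW bx) ?(ltW by_) //.
by rewrite ler_pM2l // lerD // ltW.
Qed.

End LocalStructure.

Lemma small_scale (R : realType) (A N del e s : R) : 0 <= A -> 0 < N -> 0 < del -> 0 < e -> 0 < s ->
  exists rho, [/\ 0 < rho, rho < 1, rho <= N^-1, N * (rho + rho) <= del & A * rho `^ s <= e].
Proof.
move=> A0 N0 del0 e0 s0; have A1 : 0 < A + 1 by rewrite ltr_wpDl.
pose r1 := (e / (A + 1)) `^ s^-1; have r10 : 0 < r1 by rewrite powR_gt0 // divr_gt0.
have hdel : 0 < del / (N * 2) by rewrite divr_gt0 // mulr_gt0.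
pose rho := Num.min (Num.min (1 / 2) N^-1) (Num.min (del / (N * 2)) r1).
have rho0 : 0 < rho by rewrite !lt_min divr_gt0 // invr_gt0 N0 hdel.
have [h1 h2 h3 h4] : [/\ rho <= 1 / 2, rho <= N^-1, rho <= del / (N * 2) & rho <= r1].
  by rewrite /rho !ge_min !lexx ?orbT.
exists rho; split=> //; first by lra.
- by rewrite (_ : N * (rho + rho) = rho * (N * 2)); [rewrite -ler_pdivlMr ?mulr_gt0|ring].
- apply: (@le_trans _ _ (A * (e / (A + 1)))).
    rewrite ler_wpM2l //; apply: (@le_trans _ _ (r1 `^ s)).
      by apply: ge0_ler_powR; rewrite ?nnegrE ?(ltW s0) ?(ltW rho0) ?(ltW r10).
    by rewrite /r1 -powRrM mulVf ?gt_eqF // powRr1 // ltW // divr_gt0.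
  by rewrite mulrCA ler_piMr ?(ltW e0) // ler_pdivrMr // mul1r lerDl.
Qed.

Lemma ler_pM3 (R : realType) (A A' B B' Z : R) : 0 <= A -> 0 <= A' -> A <= B -> A' <= B' -> 0 <= Z ->
  A * A' * Z <= B * B' * Z.
Proof. by move=> ? ? ? ? ?; apply: ler_wpM2r => //; exact: ler_pM. Qed.

Lemma powR_collect (R : realType) (rho N s s' t C C' : R) : 0 < rho ->
  C * rho `^ (- s) * (C' * rho `^ (- s')) * (N * rho `^ t) = C * C' * N * rho `^ (- s + - s' + t).
Proof.
move=> rho0; rewrite !powRD ?(gt_eqF rho0) ?implybT //.
by move: (rho `^ (- s)) (rho `^ (- s')) (rho `^ t) => x y z; ring.
Qed.

Section UpperBound.
Context {R : realType}.
Variables (F F' : markov_ifs R) (h : R * R -> R) (n : nat).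
Hypothesis lip : forall x y x1 x2 y1 y2, (limset F `*` limset F') (x, y) ->
     `|x1 - x| <= n.+1%:R^-1 -> `|x2 - x| <= n.+1%:R^-1 ->
     `|y1 - y| <= n.+1%:R^-1 -> `|y2 - y| <= n.+1%:R^-1 ->
     `|h (x1, y1) - h (x2, y2)| <= n.+1%:R * (`|x1 - x2| + `|y1 - y2|).

Lemma upper_bound : limset F !=set0 -> limset F' !=set0 ->
  HD (h @` (limset F `*` limset F')) <= HD (limset F) + HD (limset F').
Proof.
move=> ne ne'; set d := HD (limset F); set d' := HD (limset F').
have d0 : 0 <= d by exact: HD_ge0. have d'0 : 0 <= d' by exact: HD_ge0.
apply/ler_addgt0Pr => e0 e00.
(* A slack of [e0 / 4] in each box count leaves the power [e0 / 2] of [rho], which tends to 0. *)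
pose s := d + e0 / 4; pose s' := d' + e0 / 4.
have t0 : 0 <= d + d' + e0 by rewrite !addr_ge0 // ltW.
have [C C0 HC] : exists2 C, 0 <= C & forall rho, 0 < rho < 1 -> exists M W,
    [/\ M%:R <= C * rho `^ (- s), forall i, (i < M)%N -> path (@tr _ F) (W i).1 (W i).2 /\
    len_w (W i).1 (W i).2 <= rho & forall x, limset F x ->
    exists2 i, (i < M)%N & cyl (W i).1 (W i).2 x].
  by apply: box_cover => //; rewrite ltrDl divr_gt0.
have [C' C'0 HC'] : exists2 C, 0 <= C & forall rho, 0 < rho < 1 -> exists M W,
    [/\ M%:R <= C * rho `^ (- s'), forall i, (i < M)%N -> path (@tr _ F') (W i).1 (W i).2 /\
    len_w (W i).1 (W i).2 <= rho & forall x, limset F' x ->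
    exists2 i, (i < M)%N & cyl (W i).1 (W i).2 x].
  by apply: box_cover => //; rewrite ltrDl divr_gt0.
apply: HD_le => //; apply: null_of_covers => // e del e1 del0.
set N := n.+1%:R : R; have N0 : 0 < N by rewrite ltr0n.
pose t := d + d' + e0.
have e20 : 0 < e0 / 2 by rewrite divr_gt0.
have [rho [rho0 rho1 rhoN rhod rhoe]] : exists rho, [/\ 0 < rho, rho < 1, rho <= N^-1,
    N * (rho + rho) <= del & C * C' * (N * 2) `^ t * rho `^ (e0 / 2) <= e].
  by apply: small_scale => //; rewrite !mulr_ge0 ?powR_ge0.
have [M [W [hM hW cW]]] := HC rho ltac:(by rewrite rho0).
have [M' [W' [hM' hW' cW']]] := HC' rho ltac:(by rewrite rho0).
(* The pieces are images of points of the limit sets only, where the Lipschitz bound is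
   available. *)
exists (M * M')%N, (fun i => [set z | exists x y, [/\ limset F x, limset F' y,
   cyl (W (i %/ M')%N).1 (W (i %/ M')%N).2 x, cyl (W' (i %% M')%N).1 (W' (i %% M')%N).2 y &
   h (x, y) = z]]), (N * (rho + rho)); split.
- by rewrite rhod mulr_gt0 // addr_gt0.
- move=> _ [[x y] [/= xK yK] <-].
  have [i iM cx] := cW x xK; have [j jM cy] := cW' y yK.
  have M0 : (0 < M')%N by exact: leq_ltn_trans jM.
  exists (i * M' + j)%N; first by rewrite -ltn_divLR // divnMDl // divn_small // addn0.
  by exists x, y; rewrite divnMDl // divn_small // addn0 modnMDl modn_small.
- move=> i z1 z2 iM [x1 [y1 [Kx1 Ky1 cx1 cy1 <-]]] [x2 [y2 [Kx2 Ky2 cx2 cy2 <-]]].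
  have M0 : (0 < M')%N by case: (M') iM => //; rewrite muln0.
  have iM1 : (i %/ M' < M)%N by rewrite ltn_divLR.
  have iM2 : (i %% M' < M')%N by rewrite ltn_pmod.
  have [p1 l1] := hW _ iM1; have [p2 l2] := hW' _ iM2.
  have dx := le_trans (cyl_dist p1 cx1 cx2) l1; have dy := le_trans (cyl_dist p2 cy1 cy2) l2.
  apply: le_trans (@lip x2 y2 x1 x2 y1 y2 _ _ _ _ _) _; rewrite ?subrr ?normr0 ?invr_ge0 //.
  + exact: le_trans rhoN.
  + exact: le_trans rhoN.
  + by rewrite ler_pM2l // lerD.
- rewrite natrM -/t.
  have -> : N * (rho + rho) = (N * 2) * rho by ring.
  rewrite powRM ?(ltW rho0) ?mulr_ge0 ?(ltW N0) //.
  have es : e0 / 2 = - s + - s' + t by rewrite /s /s' /t; clear; field.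
  apply: le_trans rhoe; rewrite es -powR_collect //.
  apply: ler_pM3 hM hM' _; [exact: ler0n|exact: ler0n|].
  by apply: mulr_ge0; exact: powR_ge0.
Qed.

End UpperBound.

(** * The dimension formula *)

Section DimensionFormula.
Context {R : realType}.
Variables F F' : markov_ifs R.

Lemma dimension_formula (h : R * R -> R) : dense_multipliers F F' ->
  HD (limset F) + HD (limset F') < 1 -> admissible (limset F `*` limset F') h ->
  HD (h @` (limset F `*` limset F')) = HD (limset F) + HD (limset F').
Proof.
move=> dense HD1 [[U [Uo KU HU]] [[x0 y0] [/= x0K y0K] [p0 q0]]].
pose D1 : R * R -> R := 'D_(1, 0) h; pose D2 : R * R -> R := 'D_(0, 1) h.
have HU' x y : U (x, y) -> [/\ is_derive x 1 (fun t => h (t, y)) (D1 (x, y)),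
      is_derive y 1 (fun t => h (x, t)) (D2 (x, y)),
      {for (x, y), continuous D1} & {for (x, y), continuous D2}].
  by move=> /HU[dh c1 c2]; split; [exact: partial_fst|exact: partial_snd|exact: c1|exact: c2].
have cK : compact (limset F `*` limset F') by apply: compact_setX; exact: limset_compact.
have imE : h @` (limset F `*` limset F') = image_set F F' (fun x y => h (x, y)).
  apply/seteqP; split=> z.
    by move=> [[x y] [/= xK yK] <-]; exists x, y.
  by move=> [x [y [xK yK <-]]]; exists (x, y).
have U0 : U (x0, y0) by apply: KU; split.
apply/eqP; rewrite eq_le; apply/andP; split.
  have [n Hn] := uniform_lipschitz Uo HU' cK KU.
  by apply: (upper_bound Hn); [exists x0|exists y0].
rewrite imE; apply: (@lower_bound R F F' _ (D1 (x0, y0)) (D2 (x0, y0)) x0 y0 x0K y0K p0 q0 _ _ dense HD1).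
- by move=> eta eta0; exact: (strict_differentiability Uo HU' U0 eta0).
- have [m [M HM]] := image_bounded Uo HU' cK KU.
  by exists m, M => z [x [y [xK yK <-]]]; apply: HM; split.
Qed.

(** Any closed path gives a periodic orbit. This provides the second orbit when the arithmetic
    hypothesis concerns one Cantor set only. *)
Lemma multiplier_of_limset (x : R) : limset F x -> exists a u y A, @multiplier R F a u y A.
Proof.
move=> xK; have [a [s _]] := xK 0%N.
have [u [pu lu u0]] := connectable a a.
have [y cyc] := cycle_fixpoint pu lu u0; have [A mul] := multiplier_exists cyc.
by exists a, u, y, A.
Qed.

End DimensionFormula.

Lemma denq_le_fraction (R : realType) (q : rat) (i j : nat) : (0 < j)%N ->
  ratr q = i%:R / j%:R :> R -> (denq q)%:~R <= j%:R :> R.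
Proof.
move=> j0 E; have jn : j%:R != 0 :> R by rewrite pnatr_eq0 -lt0n.
have dn : (denq q)%:~R != 0 :> R by rewrite intr_eq0 denq_eq0.
have E2 : numq q * j%:Z = i%:Z * denq q.
  apply/eqP; rewrite -(eqr_int R) !rmorphM /=; apply/eqP.
  have h : ratr q = (numq q)%:~R / (denq q)%:~R :> R by [].
  move: E; rewrite h => /eqP; rewrite eqr_div // => /eqP.
  by rewrite -!pmulrn.
have dv : (denq q %| j%:Z)%Z.
  rewrite -(@Gauss_dvdzr _ (numq q)); first by rewrite E2 dvdz_mull.
  by rewrite coprimezE coprime_sym coprime_num_den.
have : (`|denq q| <= j)%N by apply: dvdn_leq.
by rewrite -(ler_nat R) natr_absz ger0_norm ?denq_ge0.
Qed.

(** * Density from the arithmetic of eigenvalues *)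

Section Density.
Context {R : realType}.
Variables F F' : markov_ifs R.

Definition log_multiplier (E : markov_ifs R) (A : R) :=
  exists (a : alph E) u x, multiplier a u x A.

Lemma log_multiplier_gt0 (E : markov_ifs R) A : log_multiplier E A -> 0 < A.
Proof. by move=> [a [u [x [_ A0 _]]]]. Qed.

(** By the Dirichlet alternative, precision [l] can fail only if [A / B] is a fraction with
    denominator at most [B / l + 1]. *)
Lemma dense_of_incommensurable :
  (forall l : R, 0 < l -> exists A B, [/\ log_multiplier F A, log_multiplier F' B &
     forall i j : nat, (0 < i)%N -> (0 < j)%N -> j%:R * A = i%:R * B -> B / l + 1 < j%:R]) ->
  dense_multipliers F F'.
Proof.
move=> H l l0; have [A [B [mA mB no]]] := H l l0.
have A0 := log_multiplier_gt0 mA; have B0 := log_multiplier_gt0 mB.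
have [a [u [x mu]]] := mA; have [a' [u' [x' mu']]] := mB.
exists a, u, x, A, a', u', x', B; split=> //.
have [//|[i [j [i0 j0 E jle]]]] := commensurable_or_dense A0 B0 l0.
by have := no i j i0 j0 E; rewrite ltNge jle.
Qed.

Lemma commensurable_rational (A B : R) (i j : nat) : 0 < B -> (0 < j)%N ->
  j%:R * A = i%:R * B -> A / B = i%:R / j%:R.
Proof.
move=> B0 j0 E; apply/eqP; rewrite eqr_div ?(gt_eqF B0) ?pnatr_eq0 -?lt0n //.
by rewrite mulrC E.
Qed.

Lemma dense_of_irrational A B : log_multiplier F A -> log_multiplier F' B ->
  irrational (A / B) -> dense_multipliers F F'.
Proof.
move=> mA mB irr; apply: dense_of_incommensurable => l l0; exists A, B; split=> // i j i0 j0 E.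
exfalso; apply: irr; apply/rationalP; exists i%:Z, j.
exact: commensurable_rational (log_multiplier_gt0 mB) j0 E.
Qed.

(** If both [A] and [A'] were commensurable with [B], their ratio would be rational; so one of them
    is incommensurable with [B]. *)
Lemma dense_of_irrational2 A A' B : log_multiplier F A -> log_multiplier F A' ->
  log_multiplier F' B -> irrational (A / A') -> dense_multipliers F F'.
Proof.
move=> mA mA' mB irr; have B0 := log_multiplier_gt0 mB.
have A0 := log_multiplier_gt0 mA; have A'0 := log_multiplier_gt0 mA'.
apply: dense_of_incommensurable => l l0.
have [[i [j [i0 j0 E]]]|no] := pselect (exists i j : nat, [/\ (0 < i)%N, (0 < j)%N &
    j%:R * A = i%:R * B]); last first.
  by exists A, B; split=> // i j i0 j0 E; case: no; exists i, j.
exists A', B; split=> // i' j' i'0 j'0 E'; exfalso; apply: irr; apply/rationalP.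
exists (i * j')%:Z, (j * i')%N; apply: commensurable_rational => //.
  by rewrite muln_gt0 j0.
rewrite !natrM (_ : j%:R * i'%:R * A = i'%:R * (j%:R * A)); last by ring.
by rewrite E (mulrCA _ i%:R) -E'; ring.
Qed.

Lemma dense_of_denominators (A : nat -> R) B (q : nat -> rat) :
  (forall n, log_multiplier F (A n)) -> log_multiplier F' B ->
  (forall n, A n / B = ratr (q n)) -> ((denq (q n))%:~R : R) @[n --> \oo] --> +oo ->
  dense_multipliers F F'.
Proof.
move=> mA mB Eq /cvgryPgt cv; have B0 := log_multiplier_gt0 mB.
apply: dense_of_incommensurable => l l0.
have [n _ /(_ n (leqnn n)) /= hn] := cv (B / l + 1).
exists (A n), B; split=> // i j i0 j0 E; apply: lt_le_trans hn _.
by apply: (denq_le_fraction (i := i)) => //; rewrite -Eq; exact: commensurable_rational.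
Qed.

(** Either [A 0] is incommensurable with [B] and serves alone, or [A 0 / B = i0 / j0]. In that case
    a fraction for [A n / B] with denominator [j] gives one for [A n / A 0] with denominator
    [j * i0], so [j] must be large when the denominators of the latter ratios are. *)
Lemma dense_of_denominators2 (A : nat -> R) B (q : nat -> rat) :
  (forall n, log_multiplier F (A n)) -> log_multiplier F' B ->
  (forall n, A n / A 0%N = ratr (q n)) -> ((denq (q n))%:~R : R) @[n --> \oo] --> +oo ->
  dense_multipliers F F'.
Proof.
move=> mA mB Eq /cvgryPgt cv; have B0 := log_multiplier_gt0 mB.
apply: dense_of_incommensurable => l l0.
have A00 := log_multiplier_gt0 (mA 0%N).
have [[i0 [j0 [i00 j00 E0]]]|no] := pselect (exists i j : nat, [/\ (0 < i)%N, (0 < j)%N &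
    j%:R * A 0%N = i%:R * B]); last first.
  by exists (A 0%N), B; split=> // i j i1 j1 E; case: no; exists i, j.
have [n _ /(_ n (leqnn n)) /= hn] := cv ((B / l + 1) * i0%:R).
exists (A n), B; split=> // i j i1 j1 E; have i0p : 0 < i0%:R :> R by rewrite ltr0n.
rewrite -(ltr_pM2r i0p); apply: lt_le_trans hn _; rewrite -natrM.
apply: (denq_le_fraction (i := (i * j0)%N)); first by rewrite muln_gt0 j1.
rewrite -Eq; apply: commensurable_rational => //; first by rewrite muln_gt0 j1.
rewrite !natrM (_ : j%:R * i0%:R * A n = i0%:R * (j%:R * A n)); last by ring.
by rewrite E (mulrCA _ i%:R) -E0; ring.
Qed.

End Density.

Theorem corollary1 (R : realType) (Sigma Sigma' : subshift) (r r' : \bar R)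
  (hr : (1%:E < r)%E) (hr' : (1%:E < r')%E)
  (g : expanding_map Sigma r) (g' : expanding_map Sigma' r') :
  let K := cantor_set g in
  let K' := cantor_set g' in
  exists C : R, forall c0 alpha : R, 1 < c0 -> C <= c0 -> 0 < alpha <= 1 ->
  HD K + HD K' < 1 -> H_alpha g c0 alpha -> H_alpha g' c0 alpha ->
  [/\ (exists x mu y lambda : R,
         [/\ periodic_eigenvalue g x mu, periodic_eigenvalue g' y lambda &
             irrational (ln `|mu| / ln `|lambda|)]) ->
      forall h : R * R -> R, admissible (K `*` K') h ->
        HD (h @` (K `*` K')) = HD K + HD K',
      (exists x mu y lambda : R,
         [/\ periodic_eigenvalue g x mu, periodic_eigenvalue g y lambda &
             irrational (ln `|mu| / ln `|lambda|)]) ->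
      forall h : R * R -> R, admissible (K `*` K') h ->
        HD (h @` (K `*` K')) = HD K + HD K',
      (exists (x mu : nat -> R) (y lambda : R),
         [/\ forall n, periodic_eigenvalue g (x n) (mu n),
             periodic_eigenvalue g' y lambda &
             rational_denominators_to_infty
               (fun n => ln `|mu n| / ln `|lambda|)]) ->
      forall h : R * R -> R, admissible (K `*` K') h ->
        HD (h @` (K `*` K')) = HD K + HD K' &
      (exists x mu : nat -> R,
         (forall n, periodic_eigenvalue g (x n) (mu n)) /\
         rational_denominators_to_infty
           (fun n => ln `|mu n| / ln `|mu 0%N|)) ->
      forall h : R * R -> R, admissible (K `*` K') h ->
        HD (h @` (K `*` K')) = HD K + HD K'].
Proof.
move=> K K'; exists 0 => c0 alpha _ _ _ HD1 _ _.
have [F [FK Fmul]] := ifs_of_map g hr; have [F' [FK' Fmul']] := ifs_of_map g' hr'.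
have log_mult x mu : periodic_eigenvalue g x mu -> log_multiplier F (ln `|mu|).
  by move=> /Fmul[a [s [A [mul ->]]]]; exists a, s, x.
have log_mult' x mu : periodic_eigenvalue g' x mu -> log_multiplier F' (ln `|mu|).
  by move=> /Fmul'[a [s [A [mul ->]]]]; exists a, s, x.
(* The point of the product carried by admissibility shows that [K'] is nonempty, hence has a
   periodic orbit. *)
have any_mult h : admissible (K `*` K') h -> exists B, log_multiplier F' B.
  move=> [_ [[x y] [_ /= yK] _]]; rewrite /K' -FK' in yK.
  by have [a [u [z [B mB]]]] := multiplier_of_limset yK; exists B, a, u, z.
have formula h : dense_multipliers F F' -> admissible (K `*` K') h ->
    HD (h @` (K `*` K')) = HD K + HD K'.
  move=> dm; rewrite /K /K' -FK -FK'; apply: dimension_formula => //.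
  by rewrite FK FK'.
split.
- move=> [x [mu [y [lambda [px py irr]]]]] h.
  exact: formula (dense_of_irrational (log_mult _ _ px) (log_mult' _ _ py) irr).
- move=> [x [mu [y [lambda [px py irr]]]]] h adm; have [B mB] := any_mult h adm.
  exact: formula (dense_of_irrational2 (log_mult _ _ px) (log_mult _ _ py) mB irr) adm.
- move=> [x [mu [y [lambda [px py [q [Eq cv]]]]]]] h.
  apply: formula; apply: (dense_of_denominators (A := fun n => ln `|mu n|) _ (log_mult' _ _ py) Eq cv).
  by move=> n; exact: log_mult (px n).
- move=> [x [mu [px [q [Eq cv]]]]] h adm; have [B mB] := any_mult h adm.
  apply: formula adm; apply: (dense_of_denominators2 (A := fun n => ln `|mu n|) _ mB Eq cv).
  by move=> n; exact: log_mult (px n).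
Qed.
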